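(* Let $A$ be a (not necessarily densely defined) closed symmetric operator in a Hilbert space $\mathfrak H$ with equal defect numbers $n_+(A)=n_-(A)\le\infty$, let $\Pi=\{\mathcal H,\Gamma_0,\Gamma_1\}$ be a boundary triplet for $A^*$ with Weyl function $M(\lambda)$, and let $\tau(\lambda)=\{\phi(\lambda),\psi(\lambda)\}$ be a Nevanlinna pair in $\mathcal H$. Then: (i) The pair $\{\phi,\psi\}$ is $\Pi$-admissible if and only if the following two conditions are satisfied: $$\text{(a)}\quad w\text{-}\lim_{y\uparrow\infty}\frac{\phi(iy)\,(\psi(iy)+M(iy)\phi(iy))^{-1}}{y}=0,$$ $$\text{(b)}\quad w\text{-}\lim_{y\uparrow\infty}\frac{\psi(iy)\,(\psi(iy)+M(iy)\phi(iy))^{-1}M(iy)}{y}=0 .$$ (ii) If, in addition, $A_0=\ker\Gamma_0$ is an operator, then the $\Pi$-admissibility of $\{\phi,\psi\}$ is equivalent to the single condition (a). (iii) If $A_1=\ker\Gamma_1$ is an operator, then the $\Pi$-admissibility of $\{\phi,\psi\}$ is equivalent to the single condition (b).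
   Context: A linear relation in $\mathfrak H$ is a linear subspace of $\mathfrak H^2$; $\operatorname{mul}T=\{g:\{0,g\}\in T\}$; $T$ is an operator iff $\operatorname{mul}T=\{0\}$. $A^*$ is the adjoint linear relation; write $\widehat f=\{f,f'\}$. $w$-$\lim$ is the limit in the weak operator topology. Boundary triplet for $A^*$: a triplet $\{\mathcal H,\Gamma_0,\Gamma_1\}$ with $\mathcal H$ a Hilbert space, $\dim\mathcal H=n_\pm(A)$, and $\Gamma_0,\Gamma_1$ bounded linear operators from $A^*$ (graph inner product) to $\mathcal H$ such that $(f',g)-(f,g')=(\Gamma_1\widehat f,\Gamma_0\widehat g)_{\mathcal H}-(\Gamma_0\widehat f,\Gamma_1\widehat g)_{\mathcal H}$ for all $\widehat f,\widehat g\in A^*$ and $\{\Gamma_0,\Gamma_1\}:A^*\to\mathcal H^2$ is surjective. $A_0=\ker\Gamma_0$ and $A_1=\ker\Gamma_1$ are selfadjoint extensions (relations) of $A$. The Weyl function $M(\lambda)$ and $\gamma$-field $\gamma(\lambda)$ are defined for $\lambda\in\mathbb C\setminus\mathbb R$ by $M(\lambda)\Gamma_0\widehat f_\lambda=\Gamma_1\widehat f_\lambda$, $\gamma(\lambda)\Gamma_0\widehat f_\lambda=f_\lambda$ for $\widehat f_\lambda=\{f_\lambda,\lambda f_\lambda\}\in A^*$. Nevanlinna pair in $\mathcal H$: a pair $\{\phi,\psi\}$ of holomorphic functions on $\mathbb C\setminus\mathbb R$ with values bounded operators on $\mathcal H$ such that $\operatorname{Im}(\phi(\lambda)^*\psi(\lambda))/\operatorname{Im}\lambda\ge0$,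 $\psi(\bar\lambda)^*\phi(\lambda)-\phi(\bar\lambda)^*\psi(\lambda)=0$, and $0\in\rho(\psi(\lambda)\pm i\phi(\lambda))$ for $\lambda\in\mathbb C_\pm$. It is identified with the family of linear relations $\tau(\lambda)=\{\{\phi(\lambda)h,\psi(\lambda)h\}:h\in\mathcal H\}$ (a Nevanlinna family). $\Pi$-admissibility: by the Kreĭn–Naimark formula, for each Nevanlinna family $\tau$ there is a minimal selfadjoint extension (linear relation) $\widetilde A$ of $A$ in a Hilbert space $\widetilde{\mathfrak H}\supset\mathfrak H$, unique up to unitary equivalence, with $P_{\mathfrak H}(\widetilde A-\lambda)^{-1}\upharpoonright\mathfrak H=(A_0-\lambda)^{-1}-\gamma(\lambda)(M(\lambda)+\tau(\lambda))^{-1}\gamma(\bar\lambda)^*$, $\lambda\in\mathbb C\setminus\mathbb R$ (minimal: $\widetilde{\mathfrak H}=\overline{\operatorname{span}}\{\mathfrak H+(\widetilde A-\lambda)^{-1}\mathfrak H:\lambda\in\rho(\widetilde A)\}$). The family $\tau$ (the pair $\{\phi,\psi\}$) is $\Pi$-admissible if $\widetilde A$ is an operator, i.e. $\operatorname{mul}\widetilde A=\{0\}$. *)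

(* Defs.v *)
From HB Require Import structures.
From mathcomp Require Import all_boot all_order all_algebra.
From mathcomp Require Import sesquilinear.
From mathcomp Require Import complex.
From mathcomp Require Import all_classical all_reals all_analysis.

Set Implicit Arguments.
Unset Strict Implicit.
Unset Printing Implicit Defensive.

Import Order.TTheory GRing.Theory Num.Theory.
Import numFieldNormedType.Exports.

Local Open Scope classical_set_scope.
Local Open Scope complex_scope.
Local Open Scope ring_scope.

(* The inner product is linear in its first argument. *)
HB.mixin Record CompleteNormedModule_isHilbert (R : realType) V
    & CompleteNormedModule R[i] V := {
  inner : V -> V -> R[i] ;
  inner_linearl : forall (a : R[i]) (x y z : V),
    inner (a *: x + y) z = a * inner x z + inner y z ;
  innerC : forall x y : V, inner x y = Num.conj (inner y x) ;
  inner_norm : forall x : V, inner x x = `|x| ^+ 2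
}.

#[short(type="hilbertType")]
HB.structure Definition Hilbert (R : realType) :=
  { V of CompleteNormedModule R[i] V & CompleteNormedModule_isHilbert R V }.

Notation "[< x , y >]" := (inner x y)
  (at level 0, x, y at level 99, format "[<  x ,  y  >]") : ring_scope.

Section InnerProduct.
Context {R : realType} {V : hilbertType R}.
Implicit Types (x y z : V).

Lemma innerDl x y z : [< x + y, z >] = [< x, z >] + [< y, z >].
Proof. by rewrite -[x in LHS]scale1r inner_linearl mul1r. Qed.

Lemma inner0l z : [< 0, z >] = 0.
Proof. by apply: (addIr [< 0, z >]); rewrite -innerDl addr0 add0r. Qed.

Lemma innerZl (a : R[i]) x z : [< a *: x, z >] = a * [< x, z >].
Proof. by rewrite -[a *: x]addr0 inner_linearl inner0l addr0. Qed.

Lemma innerZr (a : R[i]) x z : [< x, a *: z >] = Num.conj a * [< x, z >].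
Proof. by rewrite innerC innerZl rmorphM /= -innerC. Qed.

Lemma innerDr x y z : [< x, y + z >] = [< x, y >] + [< x, z >].
Proof. by rewrite innerC innerDl rmorphD /= -!innerC. Qed.

Lemma inner0r x : [< x, 0 >] = 0.
Proof. by rewrite innerC inner0l rmorph0. Qed.

Lemma inner_eq0 x : ([< x, x >] == 0) = (x == 0).
Proof. by rewrite inner_norm sqrf_eq0 normr_eq0. Qed.

Let inner_zmodl z : zmod_morphism (fun x => [< x, z >]).
Proof. by move=> x y /=; rewrite -scaleN1r innerDl innerZl mulN1r. Qed.

Let inner_zmodr z : zmod_morphism (inner z).
Proof. by move=> x y; rewrite -scaleN1r innerDr innerZr rmorphN1 mulN1r. Qed.

HB.instance Definition _ :=
  isBilinear.Build R[i] V V R[i] ( *%R ) (@Num.conj R[i] \; *%R) (@inner R V)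
    inner_zmodl inner_zmodr (fun z a x => innerZl a x z)
    (fun x a z => innerZr a x z).

Let inner_hermitian x y : inner x y = (-1) ^+ false * Num.conj (inner y x).
Proof. by rewrite mul1r innerC. Qed.

HB.instance Definition _ := isHermitianSesquilinear.Build R[i] V false
  (@Num.conj R[i]) (@inner R V) inner_hermitian.

Let inner_gt0 x : x != 0 -> 0 < inner x x.
Proof. by move=> x0; rewrite inner_norm exprn_gt0// normr_gt0. Qed.

HB.instance Definition _ :=
  isDotProduct.Build R[i] V (@inner R V) inner_gt0.

End InnerProduct.

Section Operators.
Context {R : realType}.
Local Notation C := R[i].

Definition bounded_operator {U V : hilbertType R} (T : U -> V) : Prop :=
  linear T /\ continuous T.

Definition adjoint_operator {U V : hilbertType R} (T : U -> V) (v : V) : U :=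
  xget 0 [set u | forall x, [< T x, v >] = [< x, u >]].

Definition operator_Im {U : hilbertType R} (T : U -> U) (u : U) : U :=
  (2 * 'i) ^-1 *: (T u - adjoint_operator T u).

(* The two-sided inverse of a bijective T, and a junk function otherwise. *)
Definition inverse_operator {U V : hilbertType R} (T : U -> V) (v : V) : U :=
  xget 0 [set u | T u = v].

(* Complex differentiability in the operator norm. *)
Definition holomorphic_at {U V : hilbertType R} (F : C -> U -> V) (l0 : C) :=
  exists2 D : U -> V, bounded_operator D &
  forall e : R, 0 < e -> exists2 d : R, 0 < d &
    forall l : C, `|l - l0| < d%:C -> forall u : U,
      `|F l u - F l0 u - (l - l0) *: D u| <= e%:C * `|l - l0| * `|u|.

Definition weak_lim0_pinfty {U V : hilbertType R} (F : R -> U -> V) : Prop :=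
  forall u v, ([< F y u, v >] : C^o) @[y --> +oo] --> (0 : C^o).

End Operators.

Section Subspaces.
Context {R : realType}.
Local Notation C := R[i].

Definition linear_subspace {V : lmodType C} (S : set V) : Prop :=
  S 0 /\ forall (a : C) x y, S x -> S y -> S (a *: x + y).

Definition linear_span {V : lmodType C} (S : set V) : set V :=
  smallest linear_subspace S.

Definition orthonormal_basis {V : hilbertType R} (S B : set V) : Prop :=
  [/\ B `<=` S,
      forall x y, B x -> B y -> [< x, y >] = (x == y)%:R
    & S `<=` closure (linear_span B)].

(* Equality of the Hilbert dimensions of closed subspaces, as cardinals. *)
Definition eq_hilbert_dim {U V : hilbertType R} (S : set U) (T : set V) : Prop :=
  exists B B', [/\ orthonormal_basis S B, orthonormal_basis T B' & (B #= B')%card].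

End Subspaces.

Section LinearRelations.
Context {R : realType}.
Local Notation C := R[i].

Definition graph {U V : hilbertType R} (T : U -> V) : set (U * V) :=
  [set p | p.2 = T p.1].

Definition relation_inverse {U V : hilbertType R} (T : set (U * V)) :
  set (V * U) := [set p | T (p.2, p.1)].

Definition relation_sum {U V : hilbertType R} (S T : set (U * V)) :
    set (U * V) :=
  [set p | exists g h, [/\ S (p.1, g), T (p.1, h) & p.2 = g + h]].

(* The operator whose graph is the single-valued everywhere defined T. *)
Definition relation_operator {U V : hilbertType R} (T : set (U * V)) (u : U) :
  V := xget 0 [set v | T (u, v)].

Context {H : hilbertType R}.
Implicit Types (T A : set (H * H)) (l : C).

Definition mul_part T : set H := [set g | T (0, g)].

Definition is_operator T : Prop := mul_part T = [set 0].

Definition relation_shift T l : set (H * H) :=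
  relation_sum T (graph (fun f => - (l *: f))).

Definition resolvent_relation T l : set (H * H) :=
  relation_inverse (relation_shift T l).

Definition resolvent T l : H -> H := relation_operator (resolvent_relation T l).

Definition resolvent_set T : set C :=
  [set l | exists2 S : H -> H,
     bounded_operator S & resolvent_relation T l = graph S].

Definition adjoint_relation T : set (H * H) :=
  [set f | forall g, T g -> [< f.2, g.1 >] = [< f.1, g.2 >]].

Definition selfadjoint_relation T : Prop := adjoint_relation T = T.

Definition closed_symmetric_operator A : Prop :=
  [/\ linear_subspace A, closed A, is_operator A & A `<=` adjoint_relation A].

Definition eigen_relation T l : set (H * H) :=
  [set f | T f /\ f.2 = l *: f.1].

Definition defect_space A l : set H :=
  [set f | adjoint_relation A (f, l *: f)].

Definition equal_defect_numbers A : Prop :=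
  eq_hilbert_dim (defect_space A 'i) (defect_space A (- 'i)).

End LinearRelations.

Section BoundaryTriplets.
Context {R : realType} {H B : hilbertType R}.
Local Notation C := R[i].
Variables (A : set (H * H)) (G0 G1 : H * H -> B).

(* G0 and G1 are operators with domain A^*; their values off A^* are
   irrelevant. *)
Definition bounded_on_graph (T : set (H * H)) (G : H * H -> B) : Prop :=
  (forall (a : C) f g, T f -> T g -> G (a *: f + g) = a *: G f + G g) /\
  exists k : R, forall f, T f ->
    `|G f| ^+ 2 <= k%:C * ([< f.1, f.1 >] + [< f.2, f.2 >]).

Definition boundary_triplet : Prop :=
  [/\ eq_hilbert_dim [set: B] (defect_space A 'i) /\
        eq_hilbert_dim [set: B] (defect_space A (- 'i)),
      bounded_on_graph (adjoint_relation A) G0 /\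
        bounded_on_graph (adjoint_relation A) G1,
      forall f g, adjoint_relation A f -> adjoint_relation A g ->
        [< f.2, g.1 >] - [< f.1, g.2 >] = [< G1 f, G0 g >] - [< G0 f, G1 g >]
    & forall h0 h1, exists f, [/\ adjoint_relation A f, G0 f = h0 & G1 f = h1]].

Definition boundary_kernel (G : H * H -> B) : set (H * H) :=
  [set f | adjoint_relation A f /\ G f = 0].

(* The only element {f, l f} of A^* with boundary value G0 {f, l f} = h. *)
Definition defect_element (l : C) (h : B) : H * H :=
  xget 0 [set f | eigen_relation (adjoint_relation A) l f /\ G0 f = h].

Definition weyl_function (l : C) (h : B) : B := G1 (defect_element l h).

Definition gamma_field (l : C) (h : B) : H := (defect_element l h).1.


Lemma defect_elementE (l : C) (f : H * H) :
  boundary_triplet -> complex.Im l != 0 ->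
  eigen_relation (adjoint_relation A) l f -> defect_element l (G0 f) = f.
Proof.
move=> [_ [[G0lin _] _] green _] l_nreal [Af fl].
rewrite /defect_element; case: xgetP => [g _ [[Ag gl] g0]|/(_ f) []] //.
set d := (-1) *: g + f.
have Ad : adjoint_relation A d.
  by move=> h Ah; rewrite /= !(innerDl, innerZl) (Af _ Ah) (Ag _ Ah).
have G0d : G0 d = 0 by rewrite G0lin// g0 scaleN1r addNr.
have dl : d.2 = l *: d.1.
  by rewrite /= gl fl scalerA mulrC -scalerA -scalerDr.
have := green _ _ Ad Ad; rewrite G0d dl inner0r inner0l subrr.
rewrite innerZl innerZr -mulrBl => /eqP; rewrite mulf_eq0 inner_eq0.
case/orP=> [|/eqP d10].
  rewrite subr_eq0 => /eqP; case: l l_nreal {fl gl dl} => a b /= b0 [] /eqP.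
  by rewrite eq_sym eqNr (negPf b0).
suff /eqP : d = 0 by rewrite /d scaleN1r addrC subr_eq0 => /eqP.
by rewrite [d]surjective_pairing dl d10 scaler0.
Qed.

Lemma weyl_functionE (l : C) (f : H * H) :
  boundary_triplet -> complex.Im l != 0 ->
  eigen_relation (adjoint_relation A) l f -> weyl_function l (G0 f) = G1 f.
Proof. by move=> *; rewrite /weyl_function defect_elementE. Qed.

Lemma gamma_fieldE (l : C) (f : H * H) :
  boundary_triplet -> complex.Im l != 0 ->
  eigen_relation (adjoint_relation A) l f -> gamma_field l (G0 f) = f.1.
Proof. by move=> *; rewrite /gamma_field defect_elementE. Qed.

End BoundaryTriplets.

Section NevanlinnaPairs.
Context {R : realType} {B : hilbertType R}.
Local Notation C := R[i].

Definition nevanlinna_pair (phi psi : C -> B -> B) : Prop :=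
  [/\ forall l, complex.Im l != 0 ->
        [/\ bounded_operator (phi l), bounded_operator (psi l),
            holomorphic_at phi l & holomorphic_at psi l],
      forall l, complex.Im l != 0 -> forall h,
        0 <= [< operator_Im (adjoint_operator (phi l) \o psi l) h, h >]
             / (complex.Im l)%:C,
      forall l, complex.Im l != 0 -> forall h,
        adjoint_operator (psi (Num.conj l)) (phi l h)
        - adjoint_operator (phi (Num.conj l)) (psi l h) = 0
    & (forall l, 0 < complex.Im l ->
         resolvent_set (graph (fun h => psi l h + 'i *: phi l h)) 0) /\
      (forall l, complex.Im l < 0 ->
         resolvent_set (graph (fun h => psi l h - 'i *: phi l h)) 0)].

Definition nevanlinna_family (phi psi : C -> B -> B) (l : C) : set (B * B) :=
  range (fun h => (phi l h, psi l h)).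

End NevanlinnaPairs.

Section Admissibility.
Context {R : realType} {H B : hilbertType R}.
Local Notation C := R[i].
Variables (A : set (H * H)) (G0 G1 : H * H -> B) (tau : C -> set (B * B)).

Definition isometric_embedding {K : hilbertType R} (J : H -> K) : Prop :=
  linear J /\ forall x y, [< J x, J y >] = [< x, y >].

(* The orthogonal projection of K onto the copy J(H) of H, read in H. *)
Definition projection_onto {K : hilbertType R} (J : H -> K) (k : K) : H :=
  xget 0 [set h | forall g, [< k - J h, J g >] = 0].

Definition minimal_extension {K : hilbertType R} (J : H -> K)
    (At : set (K * K)) : Prop :=
  closure (linear_span
    (range J `|` \bigcup_(l in resolvent_set At) (resolvent At l @` range J)))
  = setT.

(* K contains H through the isometric embedding J. *)
Definition krein_naimark_extension {K : hilbertType R} (J : H -> K)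
    (At : set (K * K)) : Prop :=
  [/\ isometric_embedding J,
      linear_subspace At /\ selfadjoint_relation At,
      forall f, A f -> At (J f.1, J f.2),
      minimal_extension J At
    & forall l, complex.Im l != 0 -> forall f,
        projection_onto J (resolvent At l (J f)) =
        resolvent (boundary_kernel A G0) l f
        - gamma_field A G0 l
            (relation_operator
               (relation_inverse
                  (relation_sum (graph (weyl_function A G0 G1 l)) (tau l)))
               (adjoint_operator (gamma_field A G0 (Num.conj l)) f))].

(* The extension exists for every Nevanlinna family and is unique up to unitary
   equivalence, so that "the extension is an operator" may be expressed with an
   existential quantifier. *)
Definition Pi_admissible : Prop :=
  exists (K : hilbertType R) (J : H -> K) (At : set (K * K)),
    krein_naimark_extension J At /\ is_operator At.

End Admissibility.

(* Main.v *)
Require Import Defs.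
From HB Require Import structures.
From mathcomp Require Import all_boot all_order all_algebra.
From mathcomp Require Import sesquilinear.
From mathcomp Require Import complex.
From mathcomp Require Import all_classical all_reals all_analysis.
From mathcomp Require Import ring lra.

Set Implicit Arguments.
Unset Strict Implicit.
Unset Printing Implicit Defensive.

Import Order.TTheory GRing.Theory Num.Theory.
Import numFieldNormedType.Exports.

Local Open Scope classical_set_scope.
Local Open Scope complex_scope.
Local Open Scope ring_scope.

(** For a Nevanlinna pair let [R(l)] denote the right-hand side of the
    Krein-Naimark formula, and let [Q(y) = 1 + l * R(l)] for [l = i * y].  The
    theorem holds because admissibility, as well as the limits (a) and (b), express
    the strong convergence of [Q(y)] to zero, on all of [H], on the domain of
    [A_0] and on the domain of [A_1] respectively.

    Admissibility.  If the selfadjoint extension [At] is an operator, then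
    [1 + l * (At - l)^-1] is [(At - l)^-1 * At] on the dense domain of [At], hence
    tends to zero there and, being bounded, everywhere; compressing to [H] gives
    [Q -> 0] ([selfadjoint_operator_vanishes], [admissible_vanishes]).  Conversely,
    if [Q -> 0], an operator [At] is constructed ([realization],
    [vanishes_admissible]).  The vectors [e(l, h)], which are to become
    [(At - l)^-1 h], have inner products prescribed by the resolvent identity:
    [(l - conj m) * <e(l, h), e(m, g)> = <R(l) h, g> - <R(conj m) h, g>].  This form
    is positive by Pick's inequality ([halfplane_pick]), and [H] embeds into its
    completion by [h |-> lim - l * e(l, h)] along the imaginary axis, which is
    isometric exactly because [Q -> 0].  The pairs [(e(l, h), h + l * e(l, h))] are
    essentially selfadjoint, and as the [e(l, h)] span a dense subspace the
    closure is an operator.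

    Boundary values.  [R(l) h] is the solution [f] of [(f, h + l * f) \in A^*] with
    boundary values [G0 = - phi l c], [G1 = psi l c] ([krein_formula]); this
    description gives the symmetry, the positivity and the holomorphy of [R].
    Green's identity then evaluates the form
    [<R(l) (f2 - l * f1) - f1, g2 - conj l * g1>]: for [f], [g] in [A_0] it is the
    operator of condition (a) between the values of [G1], and for [f], [g] in [A_1]
    the operator of condition (b) between the values of [G0] ([boundary_form0],
    [boundary_form1]).  Up to a bounded term the form is [l * <Q(y) f1, g1>]
    ([form_asymptotics]), so (a) and (b) say that [Q] tends weakly to zero on the
    two domains.  Weak and strong convergence agree since
    [|Q(y) f| ^ 2 <= Re <Q(y) f, f>] ([remainder_sqr]).  Since [Q] is bounded, it
    only remains to know which domains are dense: [A^*] is the sum of [A_0] and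
    [A_1] and is densely defined because [A] is an operator
    ([adjoint_total]), and the domain of [A_0] or [A_1] is dense when that
    relation is an operator ([kernel0_total], [kernel1_total]).

    Pick's inequality is proved from complex differentiability alone.  Contour
    integrals are replaced by trapezoidal sums with [2 ^ n] nodes: they are
    additive under bisection and exact on affine functions, which is what
    Goursat's argument needs.  In logarithmic coordinates this yields Cauchy's
    formula for circular means ([cauchy_mean]) and Pick's inequality for the disc;
    exhausting the upper half-plane by discs gives the inequality with the
    derivatives on the diagonal. *)

(** * Real-valued norms and sequential limits *)

Section RealNorm.
Context {R : realType}.
Local Notation C := R[i].

(** The order of [R[i]] is partial; a norm with values in [R] gives access to the
    decision procedures for ordered fields. *)
Definition nrm {V : normedZmodType C} (x : V) : R := complex.Re `|x|.

Lemma cReD (a b : C) : complex.Re (a + b) = complex.Re a + complex.Re b.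
Proof. by case: a; case: b. Qed.
Lemma cImD (a b : C) : complex.Im (a + b) = complex.Im a + complex.Im b.
Proof. by case: a; case: b. Qed.
Lemma cReN (a : C) : complex.Re (- a) = - complex.Re a.
Proof. by case: a. Qed.
Lemma cImN (a : C) : complex.Im (- a) = - complex.Im a.
Proof. by case: a. Qed.
Lemma cReM (a b : C) : complex.Re (a * b)
  = complex.Re a * complex.Re b - complex.Im a * complex.Im b.
Proof. by case: a; case: b. Qed.
Lemma cImM (a b : C) : complex.Im (a * b)
  = complex.Re a * complex.Im b + complex.Im a * complex.Re b.
Proof. by case: a; case: b. Qed.
Lemma cReJ (a : C) : complex.Re (Num.conj a) = complex.Re a.
Proof. by case: a. Qed.
Lemma cImJ (a : C) : complex.Im (Num.conj a) = - complex.Im a.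
Proof. by case: a. Qed.
Lemma cReC (r : R) : complex.Re r%:C = r. Proof. by []. Qed.
Lemma cImC (r : R) : complex.Im r%:C = 0. Proof. by []. Qed.
Lemma cRe_i : complex.Re ('i%R : C) = 0. Proof. by rewrite -complexiE. Qed.
Lemma cIm_i : complex.Im ('i%R : C) = 1. Proof. by rewrite -complexiE. Qed.
Lemma cRe0 : complex.Re (0 : C) = 0. Proof. by []. Qed.
Lemma cIm0 : complex.Im (0 : C) = 0. Proof. by []. Qed.
Lemma cRe1 : complex.Re (1 : C) = 1. Proof. by []. Qed.
Lemma cIm1 : complex.Im (1 : C) = 0. Proof. by []. Qed.

Definition ReImE := (cReD, cImD, cReN, cImN, cReM, cImM, cReJ, cImJ, cReC, cImC, cRe_i,
  cIm_i, cRe0, cIm0, cRe1, cIm1).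

Lemma complex_eq (a b : C) :
  complex.Re a = complex.Re b -> complex.Im a = complex.Im b -> a = b.
Proof. by case: a; case: b => ? ? ? ? /= -> ->. Qed.

Lemma conjCC (r : R) : Num.conj (r%:C : C) = r%:C.
Proof. by apply: complex_eq; rewrite !ReImE// oppr0. Qed.

Lemma conjD (a b : C) : Num.conj (a + b) = Num.conj a + Num.conj b.
Proof. exact: rmorphD. Qed.
Lemma conjN (a : C) : Num.conj (- a) = - Num.conj a.
Proof. exact: rmorphN. Qed.
Lemma conjM (a b : C) : Num.conj (a * b) = Num.conj a * Num.conj b.
Proof. exact: rmorphM. Qed.
Lemma conjV (a : C) : Num.conj a^-1 = (Num.conj a)^-1.
Proof. exact: fmorphV. Qed.
Lemma conj_i : Num.conj ('i%R : C) = - 'i%R.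
Proof. exact: conjCi. Qed.
Lemma conj1 : Num.conj (1 : C) = 1. Proof. exact: rmorph1. Qed.
Lemma conj0 : Num.conj (0 : C) = 0. Proof. exact: rmorph0. Qed.

Definition conjE := (conjD, conjN, conjM, conjV, conj_i, conj1, conj0, conjCC,
  @conjCK C).

Lemma le_eps (a b : R) : (forall e : R, 0 < e -> a <= b + e) -> a <= b.
Proof. by move=> h; apply/ler_addgt0Pl => e e0; rewrite addrC; apply: h. Qed.

Section Normed.
Context {V : normedZmodType C}.
Implicit Types x y : V.

Lemma nrmE x : `|x| = (nrm x)%:C.
Proof.
by apply: complex_eq => //=; rewrite (ger0_Im (normr_ge0 x)).
Qed.

Lemma nrm_ge0 x : 0 <= nrm x.
Proof. by rewrite -ler0c -nrmE. Qed.

Lemma nrm0 : nrm (0 : V) = 0.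
Proof. by rewrite /nrm normr0. Qed.

Lemma nrm_eq0 x : (nrm x == 0) = (x == 0).
Proof. by rewrite -(normr_eq0 x) nrmE -(inj_eq (@complexI R)). Qed.

Lemma nrm_gt0 x : (0 < nrm x) = (x != 0).
Proof. by rewrite lt_neqAle nrm_ge0 andbT eq_sym nrm_eq0. Qed.

Lemma nrmD x y : nrm (x + y) <= nrm x + nrm y.
Proof. by have := ler_normD x y; rewrite !nrmE -rmorphD /= lecR. Qed.

Lemma nrmN x : nrm (- x) = nrm x.
Proof. by rewrite /nrm normrN. Qed.

Lemma nrmB x y : nrm (x - y) <= nrm x + nrm y.
Proof. by rewrite -(nrmN y) nrmD. Qed.

Lemma nrmBC x y : nrm (x - y) = nrm (y - x).
Proof. by rewrite -nrmN opprB. Qed.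

Lemma nrm_tri y x z : nrm (x - z) <= nrm (x - y) + nrm (y - z).
Proof. by rewrite -(subrKA y) nrmD. Qed.

Lemma nrm_le_dist x y : nrm x <= nrm y + nrm (x - y).
Proof. by rewrite -{1}(subrK y x) addrC nrmD. Qed.

Lemma nrm_small x : (forall e : R, 0 < e -> nrm x <= e) -> x = 0.
Proof.
move=> h; apply/eqP; rewrite -nrm_eq0 eq_le nrm_ge0 andbT.
by apply/ler_addgt0Pl => e e0; rewrite addr0; apply: h.
Qed.
End Normed.

Lemma nrmM (a b : C) : nrm (a * b) = nrm a * nrm b.
Proof. by apply: complexI; rewrite rmorphM /= -!nrmE normrM. Qed.

Lemma nrmV (a : C) : nrm a^-1 = (nrm a)^-1.
Proof. by apply: complexI; rewrite fmorphV /= -!nrmE normfV. Qed.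

Lemma nrmC (r : R) : nrm (r%:C : C) = `|r|.
Proof. by rewrite /nrm normc_def /= expr0n addr0 sqrtr_sqr. Qed.

Lemma nrm_i : nrm ('i%R : C) = 1.
Proof. by rewrite /nrm normCi. Qed.

Lemma nrmJ (a : C) : nrm (Num.conj a) = nrm a.
Proof. by rewrite /nrm norm_conjC. Qed.

Lemma nrm_sqr (a : C) : nrm a ^+ 2 = complex.Re a ^+ 2 + complex.Im a ^+ 2.
Proof. by apply: complexI; rewrite rmorphXn /= -nrmE add_Re2_Im2. Qed.

Lemma mul_conj (a : C) : a * Num.conj a = (nrm a ^+ 2)%:C.
Proof. by rewrite rmorphXn /= -nrmE normCK. Qed.

Lemma Re_le_nrm (a : C) : `|complex.Re a| <= nrm a.
Proof.
by rewrite -ler_sqr ?nnegrE ?nrm_ge0// nrm_sqr real_normK ?num_real// lerDl sqr_ge0.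
Qed.

Lemma Im_le_nrm (a : C) : `|complex.Im a| <= nrm a.
Proof.
by rewrite -ler_sqr ?nnegrE ?nrm_ge0// nrm_sqr real_normK ?num_real// lerDr sqr_ge0.
Qed.

Lemma nrm_le_ReIm (a : C) : nrm a <= `|complex.Re a| + `|complex.Im a|.
Proof.
rewrite -ler_sqr ?nnegrE ?nrm_ge0 ?addr_ge0// nrm_sqr sqrrD.
rewrite !real_normK ?num_real// -addrA lerD2l lerDr.
by rewrite mulrn_wge0// mulr_ge0.
Qed.

Lemma nrmZ {V : normedModType C} (a : C) (x : V) : nrm (a *: x) = nrm a * nrm x.
Proof. by apply: complexI; rewrite rmorphM /= -!nrmE normrZ. Qed.

Definition tends {V : normedZmodType C} (u : nat -> V) (l : V) :=
  forall e : R, 0 < e -> exists N, forall n, (N <= n)%N -> nrm (u n - l) < e.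

Definition cauchy_seq {V : normedZmodType C} (u : nat -> V) :=
  forall e : R, 0 < e ->
    exists N, forall m n, (N <= m)%N -> (N <= n)%N -> nrm (u m - u n) < e.

Lemma invn_lt (e : R) : 0 < e -> exists N, forall n, (N <= n)%N -> n.+1%:R^-1 < e.
Proof.
move=> e0; exists (Num.truncn e^-1) => n Nn.
rewrite invf_plt ?posrE ?ltr0n//.
by rewrite (lt_le_trans (truncnS_gt _))// ler_nat.
Qed.

Lemma tendsP {V : normedModType C} (u : nat -> V) (l : V) :
  tends u l <-> u @ \oo --> l.
Proof.
split.
  move=> ul; apply/cvgrPdist_lt => e e0.
  have Ie : complex.Im e = 0 by exact: ger0_Im (ltW e0).
  have eE : e = (complex.Re e)%:C by apply: complex_eq.
  have [|N NP] := ul (complex.Re e); first by rewrite -ltcR -eE.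
  exists N => // n Nn; rewrite distrC nrmE eE ltcR; exact: NP.
move=> /cvgrPdist_lt ul e e0.
have [|N _ NP] := ul e%:C; first by rewrite ltcR.
by exists N => n /NP; rewrite distrC nrmE ltcR.
Qed.

Lemma cauchy_tends {V : completeNormedModType C} (u : nat -> V) :
  cauchy_seq u -> exists l, tends u l.
Proof.
move=> uc.
suff /cvg_ex[l ul] : cvg (u @ \oo) by exists l; apply/tendsP.
apply: cauchy_cvg; apply/cauchy_ballP => e e0.
have Ie : complex.Im e = 0 by exact: ger0_Im (ltW e0).
have eE : e = (complex.Re e)%:C by apply: complex_eq.
have [|N NP] := uc (complex.Re e); first by rewrite -ltcR -eE.
exists ([set u n | n in [set n | (N <= n)%N]],
        [set u n | n in [set n | (N <= n)%N]]).
  by split; exists N => // n /= Nn; exists n.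
move=> [x y] /= [[m Nm <-] [n Nn <-]].
by rewrite -ball_normE /ball_ /= nrmE eE ltcR; apply: NP.
Qed.

Lemma tends_uniq {V : normedZmodType C} (u : nat -> V) l l' :
  tends u l -> tends u l' -> l = l'.
Proof.
move=> ul ul'; apply/eqP; rewrite -subr_eq0; apply/eqP; apply: nrm_small => e e0.
have [N NP] := ul _ (divr_gt0 e0 (ltr0n R 2)).
have [N' NP'] := ul' _ (divr_gt0 e0 (ltr0n R 2)).
have := NP _ (leq_maxl N N'); have := NP' _ (leq_maxr N N').
rewrite (nrmBC _ l) => h1 h2; have := nrm_tri (u (maxn N N')) l l'; lra.
Qed.

Lemma tends_cauchy {V : normedZmodType C} (u : nat -> V) l :
  tends u l -> cauchy_seq u.
Proof.
move=> ul e e0; have [N NP] := ul _ (divr_gt0 e0 (ltr0n R 2)).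
exists N => m n /NP h1 /NP; rewrite nrmBC => h2.
have := nrm_tri l (u m) (u n); lra.
Qed.

End RealNorm.

(** * Orthogonal projections and the Riesz representation *)

Section LinearMaps.
Context {R : realType} {U V : lmodType R[i]}.

Lemma lin0 (T : U -> V) : linear T -> T 0 = 0.
Proof.
move=> lT; have := lT 1 0 0; rewrite !scale1r addr0 => /eqP.
by rewrite -subr_eq0 opprD addNKr oppr_eq0 => /eqP.
Qed.

Lemma linZ (T : U -> V) (a : R[i]) x : linear T -> T (a *: x) = a *: T x.
Proof. by move=> lT; rewrite -[a *: x]addr0 lT lin0// addr0. Qed.

Lemma linD (T : U -> V) x y : linear T -> T (x + y) = T x + T y.
Proof. by move=> lT; have := lT 1 x y; rewrite !scale1r. Qed.

Lemma linN (T : U -> V) x : linear T -> T (- x) = - T x.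
Proof. by move=> lT; rewrite -scaleN1r linZ// scaleN1r. Qed.

Lemma linB (T : U -> V) x y : linear T -> T (x - y) = T x - T y.
Proof. by move=> lT; rewrite linD// linN. Qed.

End LinearMaps.

Section HilbertBasics.
Context {R : realType} {V : hilbertType R}.
Local Notation C := R[i].
Implicit Types x y z : V.

Lemma innerNl x z : [< - x, z >] = - [< x, z >].
Proof. by rewrite -scaleN1r innerZl mulN1r. Qed.
Lemma innerNr x z : [< x, - z >] = - [< x, z >].
Proof. by rewrite -scaleN1r innerZr rmorphN1 mulN1r. Qed.
Lemma innerBl x y z : [< x - y, z >] = [< x, z >] - [< y, z >].
Proof. by rewrite innerDl innerNl. Qed.
Lemma innerBr x y z : [< x, y - z >] = [< x, y >] - [< x, z >].
Proof. by rewrite innerDr innerNr. Qed.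

Definition innerE := (@innerDl R V, @innerDr R V, innerBl, innerBr, innerNl, innerNr,
  @innerZl R V, @innerZr R V, @inner0l R V, @inner0r R V).

Lemma inner_sqr x : [< x, x >] = (nrm x ^+ 2)%:C.
Proof. by rewrite inner_norm nrmE rmorphXn. Qed.

Lemma inner_ext x y : (forall z, [< x, z >] = [< y, z >]) -> x = y.
Proof.
move=> h; apply/eqP; rewrite -subr_eq0 -inner_eq0 innerBl h subrr //.
Qed.

Lemma inner_extr x y : (forall z, [< z, x >] = [< z, y >]) -> x = y.
Proof. by move=> h; apply: inner_ext => z; rewrite innerC h -innerC. Qed.

Lemma cauchy_schwarz x y : nrm [< x, y >] <= nrm x * nrm y.
Proof.
have [->|y0] := eqVneq y 0; first by rewrite inner0r !nrm0 mulr0.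
have ny : 0 < nrm y by rewrite nrm_gt0.
have nyC : ((nrm y ^+ 2)%:C : C) != 0.
  by rewrite -inner_sqr inner_eq0.
set a := [< x, y >].
have : 0 <= nrm (x - (a / (nrm y ^+ 2)%:C) *: y) ^+ 2 by rewrite exprn_ge0 ?nrm_ge0.
rewrite -lecR -(inner_sqr (x - _)) !innerE -/a -[ [< y, x >] ]conjCK -innerC -/a !inner_sqr.
rewrite !conjE.
have alg (N X b : C) : N != 0 ->
    X - b / N * a + (- (a / N * b) - - (a / N * (b / N * N))) = X - a * b / N.
  by move=> N0; field.
rewrite alg// mul_conj -fmorphV -rmorphM -rmorphB /= lecR subr_ge0 ler_pdivrMr ?exprn_gt0//.
by rewrite -exprMn ler_sqr ?nnegrE ?nrm_ge0 ?mulr_ge0 ?nrm_ge0.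
Qed.

Lemma nrm_sqrD x y :
  nrm (x + y) ^+ 2 = nrm x ^+ 2 + nrm y ^+ 2 + 2 * complex.Re [< x, y >].
Proof.
have : ((nrm (x + y) ^+ 2)%:C : C) = (nrm x ^+ 2)%:C + (nrm y ^+ 2)%:C
   + ([< x, y >] + Num.conj [< x, y >]).
  by rewrite -!inner_sqr !innerE -innerC; ring.
move=> /(congr1 (@complex.Re R)); rewrite !ReImE => ->; ring.
Qed.

Lemma nrm_sqrB x y :
  nrm (x - y) ^+ 2 = nrm x ^+ 2 + nrm y ^+ 2 - 2 * complex.Re [< x, y >].
Proof. by rewrite nrm_sqrD nrmN innerNr cReN mulrN. Qed.

Lemma parallelogram x y :
  nrm (x + y) ^+ 2 + nrm (x - y) ^+ 2 = 2 * nrm x ^+ 2 + 2 * nrm y ^+ 2.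
Proof. by rewrite nrm_sqrD nrm_sqrB; ring. Qed.

Lemma tends_innerl (u : nat -> V) l z :
  tends u l -> (forall n, [< u n, z >] = 0) -> [< l, z >] = 0.
Proof.
move=> ul uz; apply: nrm_small => e e0.
have z0 : 0 < nrm z + 1 by rewrite ltr_wpDl ?nrm_ge0.
have [N /(_ N (leqnn N)) NP] := ul _ (divr_gt0 e0 z0).
have -> : [< l, z >] = - [< u N - l, z >] by rewrite innerBl uz sub0r opprK.
rewrite nrmN (le_trans (cauchy_schwarz _ _))//.
rewrite (@le_trans _ _ (e / (nrm z + 1) * (nrm z + 1)))//; last first.
  by rewrite divfK ?gt_eqF.
by rewrite ler_pM ?nrm_ge0 ?(ltW NP)// lerDl.
Qed.

Definition seq_closed (S : set V) :=
  forall (u : nat -> V) l, (forall n, S (u n)) -> tends u l -> S l.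

Lemma subspace_sum (S : set V) (a b : C) x y :
  linear_subspace S -> S x -> S y -> S (a *: x + b *: y).
Proof.
move=> [S0 SL] Sx Sy; apply: (SL) => //.
by rewrite -[b *: y]addr0; apply: SL.
Qed.

(** The minimizing sequence of the distance to a convex set is Cauchy, by the
    parallelogram identity. *)
Lemma orthogonal_projection (S : set V) (x : V) :
  linear_subspace S -> seq_closed S ->
  exists2 s, S s & forall t, S t -> [< x - s, t >] = 0.
Proof.
move=> linS clS; have [S0 SL] := linS.
pose D := [set nrm (x - s) | s in S].
have infD : has_inf D.
  split; first by exists (nrm (x - 0)), 0.
  by exists 0 => _ [s _ <-]; exact: nrm_ge0.
set d := inf D.
have dle s : S s -> d <= nrm (x - s).
  by move=> Ss; apply: ge_inf; [case: infD | exists s].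
have d0 : 0 <= d.
  by apply: lb_le_inf; [case: infD | move=> _ [s _ <-]; exact: nrm_ge0].
have ex n : exists s, S s /\ nrm (x - s) < d + n.+1%:R^-1.
  have [|_ [s Ss <-] h] := inf_adherent (_ : 0 < (n.+1%:R^-1 : R)) infD.
    by rewrite invr_gt0 ltr0n.
  by exists s.
have [u uP] := choice ex.
have mid m n : nrm (u m - u n) ^+ 2 <=
    2 * nrm (x - u m) ^+ 2 + 2 * nrm (x - u n) ^+ 2 - 4 * d ^+ 2.
  have := parallelogram (x - u m) (x - u n).
  have -> : x - u m - (x - u n) = u n - u m by rewrite opprB addrC addrA subrK.
  have -> : x - u m + (x - u n) = (2 : C) *: (x - ((2^-1 : C) *: u m + (2^-1 : C) *: u n)).
    rewrite scalerBr scalerDr !scalerA mulfV ?pnatr_eq0// !scale1r.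
    by rewrite scaler_nat mulr2n opprD addrACA.
  rewrite nrmZ.
  have -> : nrm (2 : C) = 2.
    have -> : (2 : C) = (2 : R)%:C by rewrite -[2]/(1 + 1) rmorphD.
    by rewrite nrmC ger0_norm.
  have := dle _ (subspace_sum 2^-1 2^-1 linS (uP m).1 (uP n).1).
  set w := nrm (x - _) => dw; rewrite (nrmBC (u n)) exprMn => h.
  have : d ^+ 2 <= w ^+ 2 by rewrite ler_sqr ?nnegrE// (le_trans d0).
  lra.
have cu : cauchy_seq u.
  move=> e e0; have dp : 0 < 8 * (d + 1) by lra.
  have [|N NP] := @invn_lt R (Num.min 1 (e ^+ 2 / (8 * (d + 1)))).
    by rewrite lt_min ltr01 /= divr_gt0// exprn_gt0.
  exists N => m n Nm Nn.
  rewrite -ltr_sqr ?nnegrE ?nrm_ge0// ?(ltW e0)//; apply: (le_lt_trans (mid m n)).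
  have key k : (N <= k)%N -> nrm (x - u k) ^+ 2 < d ^+ 2 + e ^+ 2 / 4.
    move=> /NP; set i : R := k.+1%:R^-1; rewrite lt_min => /andP[i1].
    rewrite ltr_pdivlMr// => i2.
    have i0 : 0 < i by rewrite invr_gt0 ltr0n.
    have h : nrm (x - u k) ^+ 2 < (d + i) ^+ 2.
      by rewrite ltr_sqr ?nnegrE ?nrm_ge0 ?addr_ge0 ?(ltW i0)//; exact: (uP k).2.
    apply: (lt_le_trans h); nra.
  have := key m Nm; have := key n Nn; nra.
have [s us] := cauchy_tends cu.
have Ss : S s by apply: clS us => n; exact: (uP n).1.
have ds : nrm (x - s) <= d.
  apply: le_eps => e e0.
  have [N NP] := us _ (divr_gt0 e0 (ltr0n R 2)).
  have [M MP] := invn_lt (divr_gt0 e0 (ltr0n R 2)).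
  have h1 := NP _ (leq_maxl N M); have h2 := MP _ (leq_maxr N M).
  have h3 := (uP (maxn N M)).2; move: h2 h3; set i : R := _^-1 => h2 h3.
  have := nrm_tri (u (maxn N M)) x s; lra.
exists s => // t St.
have [->|t0] := eqVneq t 0; first by rewrite inner0r.
have nt : 0 < nrm t by rewrite nrm_gt0.
set a := [< x - s, t >].
have St' : S (s + (a / (nrm t ^+ 2)%:C) *: t).
  by rewrite addrC; apply: SL.
have h : nrm (x - s) ^+ 2 <= nrm (x - (s + (a / (nrm t ^+ 2)%:C) *: t)) ^+ 2.
  by rewrite ler_sqr ?nnegrE ?nrm_ge0// (le_trans ds)// dle.
move: h; rewrite opprD addrA [in X in _ <= X]nrm_sqrB innerZr -/a nrmZ nrmM nrmV nrmC.
rewrite (ger0_norm (exprn_ge0 _ (nrm_ge0 _))).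
rewrite !conjE [Num.conj a / _ * a]mulrAC [Num.conj a * a]mulrC mul_conj.
rewrite -fmorphV -rmorphM cReC.
have -> : (nrm a / nrm t ^+ 2 * nrm t) ^+ 2 = nrm a ^+ 2 / nrm t ^+ 2.
  by field; rewrite gt_eqF.
move=> h; apply/eqP; rewrite -nrm_eq0 -sqrf_eq0 eq_le exprn_ge0 ?nrm_ge0// andbT.
have : nrm a ^+ 2 / nrm t ^+ 2 <= 0 by lra.
by rewrite ler_pdivrMr ?exprn_gt0// mul0r.
Qed.

(** A vector of a closed subspace is recognized by its inner products with the
    orthogonal complement: this is how ranges are shown to be everything. *)
Lemma double_orthogonal (S : set V) (x : V) :
  linear_subspace S -> seq_closed S ->
  (forall y, (forall s, S s -> [< s, y >] = 0) -> [< x, y >] = 0) -> S x.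
Proof.
move=> linS clS h; have [s Ss sP] := orthogonal_projection x linS clS.
suff -> : x = s by [].
apply/eqP; rewrite -subr_eq0 -inner_eq0 innerBl.
rewrite h; last by move=> t St; rewrite innerC sP// rmorph0.
by rewrite innerC sP// rmorph0 subrr.
Qed.

Lemma riesz (f : V -> C) (c : R) :
  (forall (a : C) x y, f (a *: x + y) = a * f x + f y) ->
  (forall x, nrm (f x) <= c * nrm x) -> exists u, forall x, f x = [< x, u >].
Proof.
move=> lf bf.
have f0 : f 0 = 0.
  have := lf 1 0 0; rewrite scale1r addr0 mul1r => /eqP.
  by rewrite -subr_eq0 opprD addNKr oppr_eq0 => /eqP.
have fZ a x : f (a *: x) = a * f x by rewrite -[a *: x]addr0 lf f0 addr0.
have fB x y : f (x - y) = f x - f y.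
  by rewrite addrC -scaleN1r lf mulN1r addrC.
have [h|/existsNP[x0 fx0]] := pselect (forall x, f x = 0).
  by exists 0 => x; rewrite h inner0r.
(* The representing vector spans the orthogonal complement of the kernel. *)
pose S := [set x | f x = 0].
have linS : linear_subspace S.
  by split=> // a x y; rewrite /S /= => fx fy; rewrite lf fx fy mulr0 addr0.
have c0 : 0 <= `|c| + 1 by rewrite addr_ge0.
have clS : seq_closed S.
  move=> u l uS ul; rewrite /S /=; apply: nrm_small => e e0.
  have [|N /(_ _ (leqnn _)) NP] := ul (e / (`|c| + 1)).
    by rewrite divr_gt0// ltr_wpDl.
  have -> : f l = - f (u N - l) by rewrite fB (uS N) sub0r opprK.
  rewrite nrmN (le_trans (bf _))// (@le_trans _ _ ((`|c| + 1) * nrm (u N - l)))//.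
    by rewrite ler_wpM2r ?nrm_ge0// (le_trans (ler_norm c))// lerDl.
  move: NP; rewrite ltr_pdivlMr; first by rewrite mulrC => /ltW.
  by rewrite ltr_wpDl.
have [s Ss sP] := orthogonal_projection x0 linS clS.
set y := x0 - s; have fy : f y = f x0 by rewrite fB Ss subr0.
have y0 : [< y, y >] != 0.
  rewrite inner_eq0; apply/eqP => y0; apply: fx0; rewrite -fy y0 //.
exists (Num.conj (f y / [< y, y >]) *: y) => x.
rewrite innerZr conjCK.
have : [< y, f y *: x - f x *: y >] = 0.
  apply: sP; rewrite /S /= fB !fZ; ring.
rewrite innerC => /eqP; rewrite conjC_eq0 innerBl !innerZl subr_eq0 => /eqP h.
rewrite mulrAC h; field => //.
Qed.

End HilbertBasics.

(** * Complex differentiability *)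

Section ComplexDerivative.
Context {R : realType}.
Local Notation C := R[i].
Implicit Types (f g : C -> C) (z w : C).

Definition near_point z (P : C -> Prop) :=
  exists2 d : R, 0 < d & forall w, nrm (w - z) < d -> P w.

Lemma near_pointI z (P Q : C -> Prop) : near_point z P -> near_point z Q ->
  near_point z (fun w => P w /\ Q w).
Proof.
move=> [d d0 hd] [d' d'0 hd']; exists (Num.min d d'); first by rewrite lt_min d0.
by move=> w; rewrite lt_min => /andP[/hd ? /hd' ?].
Qed.

Lemma near_pointW z (P Q : C -> Prop) : (forall w, P w -> Q w) ->
  near_point z P -> near_point z Q.
Proof. by move=> PQ [d d0 hd]; exists d => // w /hd /PQ. Qed.

Definition ccont f z :=
  forall e : R, 0 < e -> near_point z (fun w => nrm (f w - f z) <= e).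

Lemma ccont_cst (c : C) z : ccont (fun=> c) z.
Proof. by move=> e e0; exists 1 => // w _; rewrite subrr nrm0 ltW. Qed.

Lemma ccont_id z : ccont id z.
Proof. by move=> e e0; exists e => // w /ltW. Qed.

Lemma ccontD f g z : ccont f z -> ccont g z -> ccont (fun w => f w + g w) z.
Proof.
move=> hf hg e e0.
apply: near_pointW (near_pointI (hf _ (divr_gt0 e0 (ltr0n R 2)))
                                (hg _ (divr_gt0 e0 (ltr0n R 2)))) => w [h1 h2].
rewrite opprD addrACA; have := nrmD (f w - f z) (g w - g z); lra.
Qed.

Lemma ccontM f g z : ccont f z -> ccont g z -> ccont (fun w => f w * g w) z.
Proof.
move=> hf hg e e0.
pose K := nrm (f z) + nrm (g z) + 1.
have K1 : 1 <= K by rewrite /K lerDr addr_ge0 ?nrm_ge0.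
have K0 : 0 < K by rewrite (lt_le_trans ltr01).
pose e' := Num.min 1 (e / (2 * K)).
have e'0 : 0 < e' by rewrite lt_min ltr01 divr_gt0 ?mulr_gt0.
have e'1 : e' <= 1 by rewrite ge_min lexx.
have e'e : e' * (2 * K) <= e.
  by rewrite -ler_pdivlMr ?mulr_gt0// ge_min lexx orbT.
apply: near_pointW (near_pointI (hf _ e'0) (hg _ e'0)) => w [h1 h2].
have -> : f w * g w - f z * g z =
  (f w - f z) * (g w - g z) + (f w - f z) * g z + f z * (g w - g z) by ring.
have := nrmD ((f w - f z) * (g w - g z) + (f w - f z) * g z) (f z * (g w - g z)).
have := nrmD ((f w - f z) * (g w - g z)) ((f w - f z) * g z).
rewrite !nrmM; move: h1 h2 (nrm_ge0 (f w - f z)) (nrm_ge0 (g w - g z)).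
move: (nrm_ge0 (f z)) (nrm_ge0 (g z)); rewrite /K in e'e *.
move: (nrm (f z)) (nrm (g z)) (nrm (f w - _)) (nrm (g w - _)) e'e.
move=> a b x y e'e a0 b0 xe ye x0 y0.
have : x * y <= e' by rewrite (le_trans (ler_pM x0 y0 xe (le_trans ye e'1)))// mulr1.
have : x * b <= e' * b by rewrite ler_wpM2r.
have : a * y <= a * e' by rewrite ler_wpM2l.
nra.
Qed.

Lemma ccontV f z : f z != 0 -> ccont f z -> ccont (fun w => (f w)^-1) z.
Proof.
move=> fz0 hf e e0.
have a0 : 0 < nrm (f z) by rewrite nrm_gt0.
pose a := nrm (f z).
pose e' := Num.min (a / 2) (e * (a ^+ 2 / 2)).
have e'0 : 0 < e' by rewrite lt_min !mulr_gt0 ?invr_gt0 ?exprn_gt0.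
apply: near_pointW (hf _ e'0) => w; rewrite le_min => /andP[h1 h2].
have fwa : a / 2 <= nrm (f w).
  have := nrm_le_dist (f z) (f w); rewrite nrmBC -/a; lra.
have fw0 : f w != 0 by rewrite -nrm_gt0; apply: lt_le_trans fwa; rewrite divr_gt0.
have -> : (f w)^-1 - (f z)^-1 = - (f w - f z) / (f w * f z).
  by field; rewrite ?fw0 ?fz0.
rewrite nrmM nrmN nrmV nrmM -/a ler_pdivrMr ?mulr_gt0 ?nrm_gt0//.
apply: (le_trans h2); rewrite ler_wpM2l ?(ltW e0)//.
have -> : a ^+ 2 / 2 = a / 2 * a by ring.
by rewrite ler_wpM2r ?nrm_ge0.
Qed.

Lemma ccont_comp f g z : ccont f z -> ccont g (f z) -> ccont (fun w => g (f w)) z.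
Proof.
move=> hf hg e /hg [d d0 hd].
apply: near_pointW (hf _ (divr_gt0 d0 (ltr0n R 2))) => w h; apply: hd; lra.
Qed.

(** Caratheodory's form of differentiability: the chain rule and the rules for
    products and inverses become algebra on the slope function. *)
Definition cderiv f z (D : C) :=
  exists phi, [/\ forall w, f w = f z + (w - z) * phi w, phi z = D & ccont phi z].

Definition cdiff f z := exists D, cderiv f z D.

Lemma cderivP f z D : cderiv f z D <-> forall e : R, 0 < e ->
  near_point z (fun w => nrm (f w - f z - (w - z) * D) <= e * nrm (w - z)).
Proof.
split=> [[phi [fE phiz cphi]] e /cphi|h].
  apply: near_pointW => w h; rewrite fE phiz in h *.
  have -> : f z + (w - z) * phi w - f z - (w - z) * D = (phi w - D) * (w - z) by ring.
  by rewrite nrmM ler_wpM2r ?nrm_ge0.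
exists (fun w => if w == z then D else (f w - f z) / (w - z)); split.
- move=> w; have [->|wz] := eqVneq w z; first by rewrite subrr mul0r addr0.
  by rewrite mulrC divfK ?subr_eq0// addrC subrK.
- by rewrite eqxx.
- move=> e e0; apply: near_pointW (h e e0) => w; rewrite eqxx.
  have [->|wz] := eqVneq w z.
    by move=> _; rewrite subrr nrm0; exact: ltW.
  have -> : f w - f z - (w - z) * D = ((f w - f z) / (w - z) - D) * (w - z).
    by field; rewrite subr_eq0.
  by rewrite nrmM ler_pM2r// nrm_gt0 subr_eq0.
Qed.

Lemma cderiv_uniq f z D D' : cderiv f z D -> cderiv f z D' -> D = D'.
Proof.
move=> /cderivP h /cderivP h'.
apply/eqP; rewrite -subr_eq0; apply/eqP; apply: nrm_small => e e0.
have e2 := divr_gt0 e0 (ltr0n R 2).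
have [d d0 hd] := near_pointI (h _ e2) (h' _ e2).
have d2 : 0 < d / 2 by rewrite divr_gt0.
have [|h1 h2] := hd (z + (d / 2)%:C).
  by rewrite addrC addKr nrmC gtr0_norm//; lra.
have zE : z + (d / 2)%:C - z = (d / 2)%:C by rewrite addrC addKr.
move: h1 h2; rewrite zE.
set x := f _ - f z => h1 h2.
have : nrm ((d / 2)%:C * (D - D')) <= e * (d / 2).
  have -> : (d / 2)%:C * (D - D') = (x - (d / 2)%:C * D') - (x - (d / 2)%:C * D) by ring.
  apply: (le_trans (nrmB _ _)); move: h1 h2; rewrite nrmC gtr0_norm//; lra.
by rewrite nrmM nrmC gtr0_norm// mulrC ler_pM2r.
Qed.

Lemma cdiff_cont f z : cdiff f z -> ccont f z.
Proof.
move=> [D [phi [fE phiz cphi]]].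
have -> : f = fun w => f z + (w - z) * phi w by apply/funext.
apply: ccontD; first exact: ccont_cst.
by apply: ccontM => //; apply: ccontD (@ccont_id _) (@ccont_cst _ _).
Qed.

Lemma cderiv_cst (c : C) z : cderiv (fun=> c) z 0.
Proof. by exists (fun=> 0); split=> [w||]; rewrite ?mulr0 ?addr0//; apply: ccont_cst. Qed.

Lemma cderiv_id z : cderiv id z 1.
Proof.
by exists (fun=> 1); split=> [w||]; rewrite ?mulr1 ?subrKC//; apply: ccont_cst.
Qed.

Lemma cderivD f g z D E : cderiv f z D -> cderiv g z E ->
  cderiv (fun w => f w + g w) z (D + E).
Proof.
move=> [p [fE <- cp]] [q [gE <- cq]]; exists (fun w => p w + q w); split=> //.
  by move=> w; rewrite fE gE; ring.
exact: ccontD.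
Qed.

Lemma cderivM f g z D E : cderiv f z D -> cderiv g z E ->
  cderiv (fun w => f w * g w) z (D * g z + f z * E).
Proof.
move=> df dg; have cg : ccont g z by apply: cdiff_cont; exists E.
move: df dg => [p [fE <- cp]] [q [gE <- cq]].
exists (fun w => p w * g w + f z * q w); split=> //.
  by move=> w; rewrite fE [g w]gE; ring.
by apply: ccontD; apply: ccontM => //; exact: ccont_cst.
Qed.

Lemma cderivZ (c : C) f z D : cderiv f z D -> cderiv (fun w => c * f w) z (c * D).
Proof.
by move=> df; have := cderivM (cderiv_cst c z) df; rewrite mul0r add0r.
Qed.

Lemma cdiff_cst (c : C) z : cdiff (fun=> c) z.
Proof. by exists 0; apply: cderiv_cst. Qed.

Lemma cdiff_id z : cdiff id z.
Proof. by exists 1; apply: cderiv_id. Qed.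

Lemma cdiffD f g z : cdiff f z -> cdiff g z -> cdiff (fun w => f w + g w) z.
Proof. by move=> [D df] [E dg]; exists (D + E); apply: cderivD. Qed.

Lemma cdiffM f g z : cdiff f z -> cdiff g z -> cdiff (fun w => f w * g w) z.
Proof. by move=> [D df] [E dg]; exists (D * g z + f z * E); apply: cderivM. Qed.

Lemma cdiffV f z : f z != 0 -> cdiff f z -> cdiff (fun w => (f w)^-1) z.
Proof.
move=> fz0 df; have cf := cdiff_cont df; case: df => D [p [fE pz cp]].
have [d d0 hd] : near_point z (fun w => f w != 0).
  have [|d d0 hd] := cf (nrm (f z) / 2); first by rewrite divr_gt0 ?nrm_gt0.
  exists d => // w /hd; apply: contraTneq => ->; rewrite sub0r nrmN -ltNge.
  by move: fz0; rewrite -nrm_gt0; lra.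
pose q w := - (p w) / (f w * f z).
have cq : ccont q z.
  apply: ccontM.
    have -> : (fun w => - p w) = (fun w => -1 * p w) by apply/funext => w; rewrite mulN1r.
    by apply: ccontM => //; apply: ccont_cst.
  apply: ccontV; first by rewrite mulf_neq0.
  by apply: ccontM => //; apply: ccont_cst.
exists (q z); apply/cderivP => e /cq [d' d'0 hd'].
exists (Num.min d d'); first by rewrite lt_min d0.
move=> w; rewrite lt_min => /andP[/hd fw0 /hd' h].
have -> : (f w)^-1 - (f z)^-1 - (w - z) * q z = (q w - q z) * (w - z).
  have -> : (f w)^-1 - (f z)^-1 = (w - z) * q w; last by ring.
  have : f w - f z = (w - z) * p w by rewrite {1}fE; ring.
  rewrite /q mulrA mulrN => <-.
  by field; rewrite ?fw0 ?fz0.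
by rewrite nrmM ler_wpM2r ?nrm_ge0.
Qed.

Lemma cderiv_comp f g z D E : cderiv f z D -> cderiv g (f z) E ->
  cderiv (fun w => g (f w)) z (D * E).
Proof.
move=> df dg; have cf : ccont f z by apply: cdiff_cont; exists D.
move: df dg => [p [fE <- cp]] [q [gE <- cq]].
exists (fun w => p w * q (f w)); split=> //.
  move=> w; rewrite [LHS]gE; congr (_ + _).
  have -> : f w - f z = (w - z) * p w by rewrite {1}fE; ring.
  by rewrite mulrA.
by apply: ccontM => //; apply: ccont_comp.
Qed.

Lemma cdiff_comp f g z : cdiff f z -> cdiff g (f z) -> cdiff (fun w => g (f w)) z.
Proof. by move=> [D df] [E dg]; exists (D * E); apply: cderiv_comp. Qed.

Lemma cdiff_near f g z : near_point z (fun w => f w = g w) -> cdiff f z -> cdiff g z.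
Proof.
move=> fg [D /cderivP h]; exists D; apply/cderivP => e /h.
have [d d0 hd] := fg.
have fgz : f z = g z by apply: hd; rewrite subrr nrm0.
by move=> h'; apply: near_pointW (near_pointI fg h') => w [ <-]; rewrite fgz.
Qed.

End ComplexDerivative.

(** * Goursat's theorem for dyadic contour sums *)

Section DyadicGoursat.
Context {R : realType}.
Local Notation C := R[i].
Implicit Types (f g : C -> C) (z w : C).

Lemma halfC (r : R) : ((r / 2)%:C : C) = r%:C / 2.
Proof. by rewrite rmorphM /= fmorphV /= rmorph_nat. Qed.

Lemma two_neq0 : (2 : C) != 0. Proof. by rewrite pnatr_eq0. Qed.
Hint Resolve two_neq0 : core.

Lemma nrm_half (a : C) : nrm (a / 2) = nrm a / 2.
Proof.
have -> : (2 : C) = (2 : R)%:C by rewrite rmorph_nat.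
by rewrite nrmM nrmV nrmC ger0_norm.
Qed.

(** The trapezoidal mean of [g] along the segment from [a] to [b], with
    [2 ^ n] steps. *)
Fixpoint av n g (a b : C) : C :=
  if n is m.+1 then (av m g a ((a + b) / 2) + av m g ((a + b) / 2) b) / 2
  else (g a + g b) / 2.

Definition on_segment (P : C -> Prop) (a b : C) :=
  forall s : R, 0 <= s -> s <= 1 -> P (a + s%:C * (b - a)).

Lemma on_segmentl P a b : on_segment P a b -> on_segment P a ((a + b) / 2).
Proof.
move=> h s s0 s1; have -> : a + s%:C * ((a + b) / 2 - a) = a + (s / 2)%:C * (b - a).
  by rewrite halfC; field.
by apply: h; lra.
Qed.

Lemma on_segmentr P a b : on_segment P a b -> on_segment P ((a + b) / 2) b.
Proof.
move=> h s s0 s1.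
have -> : (a + b) / 2 + s%:C * (b - (a + b) / 2) = a + ((1 + s) / 2)%:C * (b - a).
  by rewrite halfC rmorphD /= rmorph1; field.
by apply: h; lra.
Qed.

Lemma on_segment_start P a b : on_segment P a b -> P a.
Proof. by move=> /(_ 0 (lexx 0) ler01); rewrite mul0r addr0. Qed.

Lemma on_segment_end P a b : on_segment P a b -> P b.
Proof. by move=> /(_ 1 ler01 (lexx 1)); rewrite mul1r addrC subrK. Qed.

Lemma avD n f g a b : av n (fun w => f w + g w) a b = av n f a b + av n g a b.
Proof. by elim: n a b => [|n ih] a b /=; rewrite ?ih; field. Qed.

Lemma avZ n (c : C) f a b : av n (fun w => c * f w) a b = c * av n f a b.
Proof. by elim: n a b => [|n ih] a b /=; rewrite ?ih; field. Qed.

Lemma avB n f g a b : av n (fun w => f w - g w) a b = av n f a b - av n g a b.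
Proof. by elim: n a b => [|n ih] a b /=; rewrite ?ih; field. Qed.

(** The trapezoidal rule is exact on affine functions for every number of nodes;
    no limit is taken in the definition of contour sums. *)
Lemma av_affine n (p q a b : C) : av n (fun w => p + q * w) a b = p + q * ((a + b) / 2).
Proof. by elim: n a b => [|n ih] a b /=; rewrite ?ih; field. Qed.

Lemma av_cst n (c a b : C) : av n (fun=> c) a b = c.
Proof. by elim: n a b => [|n ih] a b /=; rewrite ?ih; field. Qed.

Lemma av_shift n g a b c : av n (fun w => g (w + c)) a b = av n g (a + c) (b + c).
Proof.
elim: n a b => [|n ih] a b //=; rewrite !ih.
by have -> : (a + c + (b + c)) / 2 = (a + b) / 2 + c by field.
Qed.

Lemma eq_av n f g a b : on_segment (fun w => f w = g w) a b -> av n f a b = av n g a b.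
Proof.
elim: n a b => [|n ih] a b h /=.
  by rewrite (on_segment_start h) (on_segment_end h).
by rewrite (ih _ _ (on_segmentl h)) (ih _ _ (on_segmentr h)).
Qed.

Lemma av_bound n g (K : R) a b :
  on_segment (fun w => nrm (g w) <= K) a b -> nrm (av n g a b) <= K.
Proof.
elim: n a b => [|n ih] a b h /=; rewrite nrm_half.
  have := on_segment_start h; have := on_segment_end h => /= h1 h2.
  have := nrmD (g a) (g b); lra.
have := ih _ _ (on_segmentl h); have := ih _ _ (on_segmentr h) => h1 h2.
have := nrmD (av n g a ((a + b) / 2)) (av n g ((a + b) / 2) b); lra.
Qed.

Lemma Re_half (a : C) : complex.Re (a / 2) = complex.Re a / 2.
Proof.
have -> : a / 2 = (2^-1)%:C * a.
  by rewrite mulrC fmorphV /= rmorph_nat.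
by rewrite cReM cReC cImC mul0r subr0 mulrC.
Qed.

Lemma av_Re_ge0 n g a b :
  on_segment (fun w => 0 <= complex.Re (g w)) a b -> 0 <= complex.Re (av n g a b).
Proof.
elim: n a b => [|n ih] a b h /=; rewrite Re_half cReD.
  have := on_segment_start h; have := on_segment_end h => /= h1 h2; lra.
have := ih _ _ (on_segmentl h); have := ih _ _ (on_segmentr h) => h1 h2; lra.
Qed.

(** The trapezoidal contour sum along the boundary of the parallelogram with
    corner [z] and edges [u] and [v]. *)
Definition contour n g z u v :=
  u * av n g z (z + u) + v * av n g (z + u) (z + u + v)
  - u * av n g (z + v) (z + u + v) - v * av n g z (z + v).

(** Interior edges of a subdivision cancel exactly. *)
Lemma contourS n g z u v : contour n.+1 g z u v =
  contour n g z (u / 2) (v / 2) + contour n g (z + u / 2) (u / 2) (v / 2)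
  + contour n g (z + v / 2) (u / 2) (v / 2)
  + contour n g (z + u / 2 + v / 2) (u / 2) (v / 2).
Proof.
rewrite /contour /=.
have -> : (z + (z + u)) / 2 = z + u / 2 by field.
have -> : (z + u + (z + u + v)) / 2 = z + u + v / 2 by field.
have -> : (z + v + (z + u + v)) / 2 = z + v + u / 2 by field.
have -> : (z + (z + v)) / 2 = z + v / 2 by field.
have -> : z + u / 2 + u / 2 = z + u by field.
have -> : z + v / 2 + v / 2 = z + v by field.
have -> : z + u / 2 + v / 2 + u / 2 = z + u + v / 2 by field.
have -> : z + u + v / 2 + v / 2 = z + u + v by field.
have -> : z + v / 2 + u / 2 + v / 2 = z + v + u / 2 by field.
have -> : z + v / 2 + u / 2 = z + u / 2 + v / 2 by ring.
have -> : z + u / 2 + v / 2 + v / 2 = z + v + u / 2 by field.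
by field.
Qed.

Lemma contour_affine n (p q z u v : C) : contour n (fun w => p + q * w) z u v = 0.
Proof. by rewrite /contour !av_affine; field. Qed.

Lemma contourD n f g z u v :
  contour n (fun w => f w + g w) z u v = contour n f z u v + contour n g z u v.
Proof. by rewrite /contour !avD; ring. Qed.

Definition on_cell (P : C -> Prop) (z u v : C) :=
  forall s t : R, 0 <= s <= 1 -> 0 <= t <= 1 -> P (z + s%:C * u + t%:C * v).

Lemma contour_bound n g (K : R) z u v : on_cell (fun w => nrm (g w) <= K) z u v ->
  nrm (contour n g z u v) <= 2 * (nrm u + nrm v) * K.
Proof.
move=> h.
have i0 : 0 <= (0 : R) <= 1 by rewrite lexx ler01.
have i1 : 0 <= (1 : R) <= 1 by rewrite lexx ler01.
have b1 : nrm (av n g z (z + u)) <= K.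
  apply: av_bound => s s0 s1 /=; have := h s 0 _ i0; rewrite s0 s1 => /(_ isT).
  by congr (nrm (g _) <= K); rewrite rmorph0; ring.
have b2 : nrm (av n g (z + u) (z + u + v)) <= K.
  apply: av_bound => s s0 s1 /=; have := h 1 s i1; rewrite s0 s1 => /(_ isT).
  by congr (nrm (g _) <= K); rewrite rmorph1; ring.
have b3 : nrm (av n g (z + v) (z + u + v)) <= K.
  apply: av_bound => s s0 s1 /=; have := h s 1 _ i1; rewrite s0 s1 => /(_ isT).
  by congr (nrm (g _) <= K); rewrite rmorph1; ring.
have b4 : nrm (av n g z (z + v)) <= K.
  apply: av_bound => s s0 s1 /=; have := h 0 s i0; rewrite s0 s1 => /(_ isT).
  by congr (nrm (g _) <= K); rewrite rmorph0; ring.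
rewrite /contour.
apply: (le_trans (nrmB _ _)); rewrite nrmM.
have := nrmB (u * av n g z (z + u) + v * av n g (z + u) (z + u + v))
  (u * av n g (z + v) (z + u + v)).
have := nrmD (u * av n g z (z + u)) (v * av n g (z + u) (z + u + v)).
rewrite !nrmM => h1 h2.
have u0 := nrm_ge0 u; have v0 := nrm_ge0 v.
have := ler_wpM2l u0 b1; have := ler_wpM2l v0 b2.
have := ler_wpM2l u0 b3; have := ler_wpM2l v0 b4; lra.
Qed.

(** The side length of the dyadic squares of generation [k]. *)
Definition hk (k : nat) : R := (2^-1) ^+ k.

Lemma hkS k : hk k.+1 = hk k / 2. Proof. by rewrite /hk exprS mulrC. Qed.
Lemma hk0 k : 0 < hk k. Proof. by rewrite exprn_gt0// invr_gt0. Qed.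
Lemma hk_small (e : R) : 0 < e -> exists N, forall k, (N <= k)%N -> hk k < e.
Proof.
move=> /invn_lt[N hN]; exists N => k /hN; apply: le_lt_trans.
rewrite /hk exprVn lef_pV2 ?posrE ?exprn_gt0 ?ltr0n//.
by rewrite -natrX ler_nat ltn_expl.
Qed.

(** A counterexample passes from a square to one of its quarters, and the nested
    squares so obtained shrink to a point where the local hypothesis fails. *)
Lemma dyadic_cousin (P : nat -> R -> R -> Prop) :
  (forall k s t, P k.+1 s t -> P k.+1 (s + hk k.+1) t -> P k.+1 s (t + hk k.+1) ->
     P k.+1 (s + hk k.+1) (t + hk k.+1) -> P k s t) ->
  (forall s t, 0 <= s <= 1 -> 0 <= t <= 1 -> exists2 d, 0 < d & forall k s' t',
     0 <= s' -> s' + hk k <= 1 -> 0 <= t' -> t' + hk k <= 1 ->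
     s' <= s <= s' + hk k -> t' <= t <= t' + hk k -> hk k < d -> P k s' t') ->
  P 0%N 0 0.
Proof.
move=> Hsplit Hloc; apply: contrapT => nP0.
have step k (p : R * R) : exists q : R * R,
    ~ P k p.1 p.2 -> ~ P k.+1 q.1 q.2 /\
      (p.1 <= q.1 <= p.1 + hk k.+1) /\ (p.2 <= q.2 <= p.2 + hk k.+1).
  have h0 := ltW (hk0 k.+1).
  have le1 (x : R) : x <= x <= x + hk k.+1 by rewrite lexx lerDl.
  have le2 (x : R) : x <= x + hk k.+1 <= x + hk k.+1 by rewrite lexx lerDl h0.
  case: p => s t /=.
  have [h1|h1] := pselect (P k.+1 s t); last by exists (s, t).
  have [h2|h2] := pselect (P k.+1 (s + hk k.+1) t); last by exists (s + hk k.+1, t).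
  have [h3|h3] := pselect (P k.+1 s (t + hk k.+1)); last by exists (s, t + hk k.+1).
  have [h4|h4] := pselect (P k.+1 (s + hk k.+1) (t + hk k.+1)).
    by exists (s, t) => /(_ (Hsplit _ _ _ h1 h2 h3 h4)).
  by exists (s + hk k.+1, t + hk k.+1).
have [F HF] := choice (fun kp : nat * (R * R) => step kp.1 kp.2).
pose fix sq k := if k is m.+1 then F (m, sq m) else (0, 0).
have inv k : ~ P k (sq k).1 (sq k).2.
  elim: k => [//|k ih]; exact: (HF (k, sq k) ih).1.
have mono k : ((sq k).1 <= (sq k.+1).1 <= (sq k).1 + hk k.+1) /\
    ((sq k).2 <= (sq k.+1).2 <= (sq k).2 + hk k.+1).
  by have [_] := HF (k, sq k) (inv k).
have mono2 k j : ((sq k).1 <= (sq (j + k)%N).1 <= (sq k).1 + hk k - hk (j + k)%N) /\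
    ((sq k).2 <= (sq (j + k)%N).2 <= (sq k).2 + hk k - hk (j + k)%N).
  elim: j => [|j [/andP[a1 a2] /andP[b1 b2]]]; first by rewrite add0n !addrK !lexx.
  have [/andP[c1 c2] /andP[d1 d2]] := mono (j + k)%N.
  have := hkS (j + k); rewrite addSn => hh; rewrite hh in c2 d2 *.
  split; apply/andP; split; lra.
have bnd k : [/\ 0 <= (sq k).1, (sq k).1 + hk k <= 1, 0 <= (sq k).2 & (sq k).2 + hk k <= 1].
  have := mono2 0%N k; rewrite addn0 /= /hk expr0 => -[/andP[a1 a2] /andP[b1 b2]].
  by split; lra.
have lim (x : nat -> R) : (forall k j, x k <= x (j + k)%N <= x k + hk k - hk (j + k)%N) ->
    exists s, forall k, x k <= s <= x k + hk k.
  move=> hx; pose S := range x.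
  have ubS k : ubound S (x k + hk k).
    move=> _ [m _ <-]; have [km|mk] := leqP k m.
      have := hx k (m - k)%N; rewrite subnK// => /andP[_]; have := hk0 m; lra.
    have := hx m (k - m)%N; rewrite subnK 1?ltnW// => /andP[]; have := hk0 k; lra.
  exists (sup S) => k; apply/andP; split.
    by apply: ub_le_sup; [exists (x 0%N + hk 0); exact: ubS | exists k].
  by apply: ge_sup; [exists (x 0%N), 0%N | exact: ubS].
have [s Hs] := lim (fun k => (sq k).1) (fun k j => (mono2 k j).1).
have [t Ht] := lim (fun k => (sq k).2) (fun k j => (mono2 k j).2).
have in01 (x y : R) k : 0 <= y -> y + hk k <= 1 -> y <= x <= y + hk k -> 0 <= x <= 1.
  by move=> y0 y1 /andP[yx xy]; apply/andP; split; lra.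
have [b1 b2 b3 b4] := bnd 0%N.
have [d d0 hd] := Hloc s t (in01 _ _ _ b1 b2 (Hs 0%N)) (in01 _ _ _ b3 b4 (Ht 0%N)).
have [N hN] := hk_small d0.
have [c1 c2 c3 c4] := bnd N.
by apply: (inv N); apply: hd => //; exact: hN.
Qed.

(** Goursat: near each point the function is affine up to an error small against
    the distance, contour sums of affine functions vanish, and contour sums are
    additive under subdivision. *)
Lemma goursat g z u v : on_cell (cdiff g) z u v ->
  tends (fun n => contour n g z u v) 0.
Proof.
move=> dg.
suff key e : 0 < e -> exists N, forall n, (N <= n)%N -> nrm (contour n g z u v) <= e.
  move=> e e0; have [N hN] := key _ (divr_gt0 e0 (ltr0n R 2)).
  exists N => n /hN; rewrite subr0; lra.
move=> e0.
pose pt (s t : R) := z + s%:C * u + t%:C * v.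
pose P k s t := exists N, forall n, (N <= n)%N ->
  nrm (contour n g (pt s t) ((hk k)%:C * u) ((hk k)%:C * v)) <= e * hk k ^+ 2.
suff [N hN] : P 0%N 0 0.
  exists N => n /hN; rewrite /hk !expr0 expr1n mulr1 rmorph1 !mul1r.
  by rewrite /pt rmorph0 !mul0r !addr0.
apply: dyadic_cousin => [k s t|s t s01 t01].
- move=> [N1 h1] [N2 h2] [N3 h3] [N4 h4].
  exists (maxn (maxn N1 N2) (maxn N3 N4)).+1 => -[//|n].
  rewrite ltnS !geq_max => /andP[/andP[/h1 {}h1 /h2 {}h2] /andP[/h3 {}h3 /h4 {}h4]].
  rewrite contourS.
  have hE w : (hk k)%:C * w / 2 = (hk k.+1)%:C * w by rewrite hkS halfC; field.
  rewrite !hE.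
  have -> : pt s t + (hk k.+1)%:C * u = pt (s + hk k.+1) t by rewrite /pt rmorphD /=; ring.
  have -> : pt s t + (hk k.+1)%:C * v = pt s (t + hk k.+1) by rewrite /pt rmorphD /=; ring.
  have -> : pt (s + hk k.+1) t + (hk k.+1)%:C * v = pt (s + hk k.+1) (t + hk k.+1).
    by rewrite /pt !rmorphD /=; ring.
  move: h1 h2 h3 h4; set a := contour _ _ _ _ _; set b := contour _ _ _ _ _.
  set c := contour _ _ _ _ _; set d := contour _ _ _ _ _ => h1 h2 h3 h4.
  have := nrmD (a + b + c) d; have := nrmD (a + b) c; have := nrmD a b.
  have : hk k ^+ 2 = 4 * hk k.+1 ^+ 2 by rewrite hkS; field.
  move=> ->; lra.
- set w := pt s t; have [D /cderivP dgw] := dg s t s01 t01.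
  pose m := nrm u + nrm v.
  have m0 : 0 <= m by rewrite addr_ge0 ?nrm_ge0.
  pose e' := e / (2 * m ^+ 2 + 1).
  have mp : 0 < 2 * m ^+ 2 + 1 by rewrite ltr_wpDl// mulr_ge0// exprn_ge0.
  have e'0 : 0 < e' by rewrite divr_gt0.
  have [d d0 hd] := dgw _ e'0.
  exists (d / (m + 1)); first by rewrite divr_gt0// ltr_wpDl.
  move=> k s' t' s'0 s'1 t'0 t'1 /andP[ss1 ss2] /andP[tt1 tt2].
  rewrite ltr_pdivlMr ?ltr_wpDl// => hkd.
  exists 0%N => n _; have hp := hk0 k.
  (* [r] is the deviation from the tangent at the point [w] of the cell. *)
  pose r y := g y - g w - (y - w) * D.
  have -> : g = fun y => (g w - w * D) + D * y + r y.
    by apply/funext => y; rewrite /r; ring.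
  rewrite contourD contour_affine add0r.
  have close : on_cell (fun y => nrm (y - w) <= m * hk k) (pt s' t')
      ((hk k)%:C * u) ((hk k)%:C * v).
    move=> a b /andP[a0 a1] /andP[b0 b1] /=.
    have -> : pt s' t' + a%:C * ((hk k)%:C * u) + b%:C * ((hk k)%:C * v) - w =
      (s' + a * hk k - s)%:C * u + (t' + b * hk k - t)%:C * v.
      by rewrite /w /pt !(rmorphB, rmorphD, rmorphM) /=; ring.
    apply: (le_trans (nrmD _ _)); rewrite !nrmM !nrmC.
    have aux (x x' c : R) : x' <= x <= x' + hk k -> 0 <= c <= 1 ->
        `|x' + c * hk k - x| <= hk k.
      move=> /andP[p1 p2] /andP[q1 q2]; rewrite ler_norml.
      have : c * hk k <= hk k by rewrite ler_piMl// ltW.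
      have : 0 <= c * hk k by rewrite mulr_ge0// ltW.
      by move=> ? ?; apply/andP; split; lra.
    have hs : `|s' + a * hk k - s| <= hk k by apply: aux; apply/andP.
    have ht : `|t' + b * hk k - t| <= hk k by apply: aux; apply/andP.
    have := ler_wpM2r (nrm_ge0 u) hs; have := ler_wpM2r (nrm_ge0 v) ht.
    by rewrite /m; lra.
  have rb : on_cell (fun y => nrm (r y) <= e' * (m * hk k)) (pt s' t')
      ((hk k)%:C * u) ((hk k)%:C * v).
    move=> a b ha hb; have /= hc := close a b ha hb.
    have hyd : nrm (pt s' t' + a%:C * ((hk k)%:C * u) + b%:C * ((hk k)%:C * v) - w) < d.
      apply: (le_lt_trans hc); apply: le_lt_trans hkd.
      by rewrite mulrC ler_wpM2l ?(ltW hp)// lerDl.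
    by apply: (le_trans (hd _ hyd)); rewrite ler_wpM2l// ltW.
  apply: (le_trans (contour_bound n rb)).
  rewrite !nrmM !nrmC (gtr0_norm hp) -mulrDr -/m.
  have -> : 2 * (hk k * m) * (e' * (m * hk k)) = (e' * (2 * m ^+ 2)) * hk k ^+ 2 by ring.
  rewrite ler_wpM2r ?exprn_ge0 ?(ltW hp)//.
  have -> : e' * (2 * m ^+ 2) = e' * (2 * m ^+ 2 + 1) - e' by ring.
  by rewrite /e' divfK ?gt_eqF// gerBl ltW.
Qed.

End DyadicGoursat.

(** * Circular means and Cauchy's formula *)

Section Tends.
Context {R : realType}.
Local Notation C := R[i].

Lemma tends_cst {V : normedZmodType C} (l : V) : tends (fun=> l) l.
Proof. by move=> e e0; exists 0%N => n _; rewrite subrr nrm0. Qed.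

Lemma tendsD {V : normedZmodType C} (u v : nat -> V) a b :
  tends u a -> tends v b -> tends (fun n => u n + v n) (a + b).
Proof.
move=> ua vb e e0.
have [N hN] := ua _ (divr_gt0 e0 (ltr0n R 2)).
have [M hM] := vb _ (divr_gt0 e0 (ltr0n R 2)).
exists (maxn N M) => n; rewrite geq_max => /andP[/hN h1 /hM h2].
rewrite opprD addrACA; have := nrmD (u n - a) (v n - b); lra.
Qed.

Lemma tendsN {V : normedZmodType C} (u : nat -> V) a :
  tends u a -> tends (fun n => - u n) (- a).
Proof.
by move=> ua e /ua[N hN]; exists N => n /hN; rewrite -opprD nrmN.
Qed.

Lemma tendsZl (c : C) (u : nat -> C) a : tends u a -> tends (fun n => c * u n) (c * a).
Proof.
move=> ua e e0; have c0 : 0 < nrm c + 1 by rewrite ltr_wpDl ?nrm_ge0.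
have [N hN] := ua _ (divr_gt0 e0 c0); exists N => n /hN h.
rewrite -mulrBr nrmM; move: h; rewrite ltr_pdivlMr// => h.
have := nrm_ge0 (u n - a); have := nrm_ge0 c; nra.
Qed.

Lemma tends_approx {V : normedZmodType C} (u : nat -> V) (l : V) :
  (forall e : R, 0 < e -> exists2 v, tends v l & forall n, nrm (u n - v n) <= e) ->
  tends u l.
Proof.
move=> h e e0; have [v vl uv] := h _ (divr_gt0 e0 (ltr0n R 2)).
have [N hN] := vl _ (divr_gt0 e0 (ltr0n R 2)).
exists N => n /hN h1; have := uv n; have := nrm_tri (v n) (u n) l; lra.
Qed.

Lemma tends_sum (T : Type) (s : seq T) (u : T -> nat -> C) (l : T -> C) :
  (forall i, tends (u i) (l i)) ->
  tends (fun n => \sum_(i <- s) u i n) (\sum_(i <- s) l i).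
Proof.
move=> h; elim: s => [|x s ih].
  under eq_fun do rewrite big_nil; rewrite big_nil; exact: tends_cst.
under eq_fun do rewrite big_cons; rewrite big_cons; exact: tendsD.
Qed.

Lemma tends_Re_ge0 (u : nat -> C) l : tends u l ->
  (forall n, 0 <= complex.Re (u n)) -> 0 <= complex.Re l.
Proof.
move=> ul h; apply: le_eps => e e0; have [N /(_ N (leqnn N)) hN] := ul _ e0.
have := Re_le_nrm (u N - l); rewrite cReD cReN.
have := h N; have := ler_norm (complex.Re (u N) - complex.Re l); lra.
Qed.

End Tends.

Section CircleMean.
Context {R : realType}.
Local Notation C := R[i].
Implicit Types (f g F G : C -> C) (z w a : C).

Definition cexp (w : C) : C :=
  (expR (complex.Re w))%:C * Complex (cos (complex.Im w)) (sin (complex.Im w)).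

Lemma cexpD a b : cexp (a + b) = cexp a * cexp b.
Proof.
case: a b => [x y] [x' y']; rewrite /cexp /= expRD cosD sinD.
by apply: complex_eq; rewrite /= !(mul0r, subr0, addr0); ring.
Qed.

Lemma nrm_cexp w : nrm (cexp w) = expR (complex.Re w).
Proof.
rewrite /cexp nrmM nrmC ger0_norm ?expR_ge0// -[RHS]mulr1; congr (_ * _).
apply/eqP; rewrite -(@eqrXn2 _ 2%N) ?nrm_ge0// nrm_sqr /= cos2Dsin2 expr1n //.
Qed.

Lemma derive_small (f : R -> R) (x df : R) : is_derive x 1 f df ->
  forall e : R, 0 < e -> exists2 d : R, 0 < d &
    forall h, `|h| < d -> `|f (x + h) - f x - h * df| <= e * `|h|.
Proof.
move=> [dff dE] e e0.
have : (h^-1 *: (f (h *: 1 + x) - f x)) @[h --> 0^'] --> df.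
  by rewrite -dE; exact: dff.
move/cvgrPdist_le => /(_ e e0); rewrite near_withinE => /nbhs_ballP[d d0 hd].
exists d => // h hh; have [->|h0] := eqVneq h 0.
  by rewrite addr0 subrr mul0r subrr normr0 mulr0.
have := hd h; rewrite /ball /= sub0r normrN => /(_ hh h0).
rewrite -[h *: 1]/(h * 1) mulr1 addrC [x + h]addrC => hle.
have -> : f (h + x) - f x - h * df = - (df - h^-1 * (f (h + x) - f x)) * h by field.
by rewrite normrM normrN ler_wpM2r// addrC.
Qed.

(** At the origin the claim reduces to the derivatives of [expR], [sin] and [cos]
    at [0]; the functional equation transports it to all points. *)
Lemma cderiv_cexp0 : cderiv cexp 0 1.
Proof.
apply/cderivP => e e0.
pose e' := Num.min 1 (e / 10).
have e'0 : 0 < e' by rewrite lt_min ltr01 divr_gt0.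
have e'1 : e' <= 1 by rewrite ge_min lexx.
have e'e : e' * 10 <= e by rewrite -ler_pdivlMr// ge_min lexx orbT.
clearbody e'.
have [d1 d10 h1] := derive_small (is_derive_expR (0 : R)) e'0.
have [d2 d20 h2] := derive_small (is_derive_sin (0 : R)) e'0.
have [d3 d30 h3] := derive_small (is_derive_cos (0 : R)) e'0.
exists (Num.min e' (Num.min d1 (Num.min d2 d3))).
  by rewrite !lt_min e'0 d10 d20.
move=> w; rewrite !subr0 mulr1 !lt_min => /and4P[wd w1 w2 w3].
set x := complex.Re w; set y := complex.Im w.
have hx : `|x| <= nrm w := Re_le_nrm w.
have hy : `|y| <= nrm w := Im_le_nrm w.
have := h1 x (le_lt_trans hx w1); have := h2 y (le_lt_trans hy w2).
have := h3 y (le_lt_trans hy w3).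
rewrite !add0r expR0 sin0 cos0 oppr0 mulr0 !mulr1 !subr0 => {}h3 {}h2 {}h1.
have -> : cexp 0 = 1.
  by apply: complex_eq; rewrite /cexp !ReImE /= expR0 cos0 sin0; ring.
apply: (le_trans (nrm_le_ReIm _)).
rewrite !(cReD, cImD, cReN, cImN) /cexp -/x -/y !(cReM, cImM, cReC, cImC) /=.
rewrite !(mul0r, subr0, addr0) -/x -/y.
have n0 := nrm_ge0 w.
move: h1 h2 h3 hx hy wd n0; move: (nrm w) (expR x) (sin y) (cos y).
move=> m E s c; rewrite !ler_norml => /andP[h1 h1'] /andP[h2 h2'] /andP[h3 h3'].
move=> /andP[hx hx'] /andP[hy hy'] wd m0.
have hxm : e' * `|x| <= e' * m by rewrite ler_wpM2l ?(ltW e'0)// ler_norml hx.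
have hym : e' * `|y| <= e' * m by rewrite ler_wpM2l ?(ltW e'0)// ler_norml hy.
have em : e' * m <= m by rewrite ler_piMl.
have E3 : `|E| <= 3 by rewrite ler_norml; apply/andP; split; lra.
have E1 : `|E - 1| <= 2 * e'.
  rewrite ler_norml; apply/andP; split; nra.
have A1 : `|E * c - 1 - x| <= 4 * (e' * m).
  have -> : E * c - 1 - x = (E - 1 - x) + E * (c - 1) by ring.
  apply: (le_trans (ler_normD _ _)); rewrite normrM.
  have : `|E - 1 - x| <= e' * m by rewrite ler_norml; apply/andP; split; lra.
  have : `|c - 1| <= e' * m by rewrite ler_norml; apply/andP; split; lra.
  move=> hc; have := ler_pM (normr_ge0 E) (normr_ge0 (c - 1)) E3 hc; lra.
have A2 : `|E * s - y| <= 5 * (e' * m).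
  have -> : E * s - y = E * (s - y) + (E - 1) * y by ring.
  apply: (le_trans (ler_normD _ _)); rewrite !normrM.
  have hs : `|s - y| <= e' * m by rewrite ler_norml; apply/andP; split; lra.
  have hy2 : `|y| <= m by rewrite ler_norml hy.
  have := ler_pM (normr_ge0 E) (normr_ge0 (s - y)) E3 hs.
  have := ler_pM (normr_ge0 (E - 1)) (normr_ge0 y) E1 hy2; lra.
have : e' * 10 * m <= e * m by rewrite ler_wpM2r.
have : 0 <= e' * m by rewrite mulr_ge0// ltW.
lra.
Qed.

Lemma cdiff_cexp z : cdiff cexp z.
Proof.
have -> : cexp = fun w => cexp z * cexp (w - z).
  by apply/funext => w; rewrite -cexpD addrC subrK.
apply: cdiffM (cdiff_cst _ _) _; apply: cdiff_comp.
  exact: cdiffD (cdiff_id _) (cdiff_cst _ _).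
by rewrite subrr; exists 1; exact: cderiv_cexp0.
Qed.

(** The period [2 * pi * 'i] of the exponential. *)
Definition tpi : C := Complex 0 (pi *+ 2).

Lemma tpi_neq0 : tpi != 0.
Proof.
by apply/eqP => -[] /eqP; rewrite mulrn_eq0 /= gt_eqF// pi_gt0.
Qed.

Lemma cexp_tpi w : cexp (w + tpi) = cexp w.
Proof. by rewrite /cexp cReD cImD /= addr0 sinD2pi cosD2pi. Qed.

(** The dyadic approximation of the mean of [F] over the circle of radius
    [expR x]. *)
Definition cmean n F (x : R) : C := av n (fun w => F (cexp w)) x%:C (x%:C + tpi).

Lemma on_circle (P : C -> Prop) (x : R) :
  (forall z, nrm z = expR x -> P z) ->
  on_segment (fun w => P (cexp w)) x%:C (x%:C + tpi).
Proof.
move=> h s s0 s1; apply: h; rewrite nrm_cexp; congr expR.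
by rewrite cReD cReM cReC cImC [_ + tpi]addrC addrK /= mul0r mulr0 subr0 addr0.
Qed.

Lemma cmean_bound n F (x K : R) : (forall z, nrm z = expR x -> nrm (F z) <= K) ->
  nrm (cmean n F x) <= K.
Proof. by move=> h; apply: av_bound; exact: (on_circle h). Qed.

Lemma eq_cmean n F G (x : R) : (forall z, nrm z = expR x -> F z = G z) ->
  cmean n F x = cmean n G x.
Proof. by move=> h; apply: eq_av; exact: (on_circle h). Qed.

Lemma cmean_Re_ge0 n F (x : R) :
  (forall z, nrm z = expR x -> 0 <= complex.Re (F z)) -> 0 <= complex.Re (cmean n F x).
Proof. by move=> h; apply: av_Re_ge0; exact: (on_circle h). Qed.

Lemma cmeanD n F G x : cmean n (fun z => F z + G z) x = cmean n F x + cmean n G x.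
Proof. exact: avD. Qed.

Lemma cmeanB n F G x : cmean n (fun z => F z - G z) x = cmean n F x - cmean n G x.
Proof. exact: avB. Qed.

Lemma cmeanZ n c F x : cmean n (fun z => c * F z) x = c * cmean n F x.
Proof. exact: avZ. Qed.

Lemma cmean_cst n c x : cmean n (fun=> c) x = c.
Proof. exact: av_cst. Qed.

(** In logarithmic coordinates an annulus is a rectangle whose horizontal edges
    carry the same values, so the contour sum is the difference of two circular
    means. *)
Lemma cmean_annulus F (x0 x1 : R) : x0 <= x1 ->
  (forall z, expR x0 <= nrm z <= expR x1 -> cdiff F z) ->
  tends (fun n => cmean n F x1 - cmean n F x0) 0.
Proof.
move=> x01 dF.
have dg : on_cell (cdiff (fun w => F (cexp w))) x0%:C (x1 - x0)%:C tpi.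
  move=> s t /andP[s0 s1] /andP[t0 t1]; apply: cdiff_comp (cdiff_cexp _) _.
  apply: dF; rewrite nrm_cexp !ler_expR !(cReD, cReM, cReC, cImC) /=.
  rewrite !(mul0r, mulr0, subr0, addr0).
  have : s * (x1 - x0) <= x1 - x0 by rewrite ler_piMl// subr_ge0.
  have : 0 <= s * (x1 - x0) by rewrite mulr_ge0// subr_ge0.
  by move=> ? ?; apply/andP; split; lra.
have := tendsZl tpi^-1 (goursat dg); rewrite mulr0.
have -> // : (fun n => tpi^-1 * contour n (fun w => F (cexp w)) x0%:C (x1 - x0)%:C tpi) =
  (fun n => cmean n F x1 - cmean n F x0).
apply/funext => n; rewrite /contour /cmean.
have -> : x0%:C + (x1 - x0)%:C = x1%:C :> C by rewrite -rmorphD /= addrC subrK.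
have -> : av n (fun w => F (cexp w)) (x0%:C + tpi) (x1%:C + tpi) =
    av n (fun w => F (cexp w)) x0%:C x1%:C.
  by rewrite -av_shift; under eq_fun do rewrite cexp_tpi.
by field; exact: tpi_neq0.
Qed.

(** The mean is the same on small circles, where the function is nearly
    constant. *)
Lemma cmean_center F (x : R) : ccont F 0 ->
  (forall z, z != 0 -> nrm z <= expR x -> cdiff F z) ->
  tends (fun n => cmean n F x) (F 0).
Proof.
move=> cF dF; apply: tends_approx => e e0.
have [d d0 hd] := cF e e0.
pose x0 := Num.min x (ln (d / 2)).
have x0d : expR x0 < d.
  apply: (@le_lt_trans _ _ (d / 2)); last by lra.
  by rewrite -[leRHS]lnK ?posrE ?divr_gt0// ler_expR ge_min lexx orbT.
have x0x : x0 <= x by rewrite ge_min lexx.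
exists (fun n => (cmean n F x - cmean n F x0) + F 0).
  rewrite -[X in tends _ X]add0r; apply: tendsD (tends_cst _).
  apply: cmean_annulus => // z /andP[z0 zx]; apply: dF => //.
  by rewrite -nrm_gt0 (lt_le_trans _ z0)// expR_gt0.
move=> n; have -> : cmean n F x - (cmean n F x - cmean n F x0 + F 0) =
  cmean n F x0 - F 0 by ring.
rewrite -[in X in _ - X](cmean_cst n (F 0) x0) -cmeanB.
apply: cmean_bound => z zx; apply: hd; by rewrite subr0 zx.
Qed.

(** The two means are compared node by node; bisection makes the continuity uniform
    along the circle, whence a bound that is independent of the number of nodes. *)
Lemma cmean_cross F (xa : R) : (forall z, nrm z = expR xa -> ccont F z) ->
  forall e : R, 0 < e -> exists2 d : R, 0 < d & forall h : R, 0 < h -> h < d ->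
    forall n, nrm (cmean n F (xa + h) - cmean n F (xa - h)) <= e.
Proof.
move=> cF e e0.
pose Q (h : R) (s : R) := nrm (F (cexp (xa%:C + s%:C * tpi + h%:C)) -
   F (cexp (xa%:C + s%:C * tpi - h%:C))) <= e.
pose P k (s t : R) := exists2 d : R, 0 < d & forall h : R, 0 < h -> h < d ->
  forall s', s <= s' <= s + hk k -> Q h s'.
have [d d0 hd] : P 0%N 0 0.
  apply: dyadic_cousin => [k s t [d1 d10 h1] [d2 d20 h2] _ _|s t s01 t01].
    exists (Num.min d1 d2); first by rewrite lt_min d10.
    move=> h h0; rewrite lt_min => /andP[hd1 hd2] s' /andP[ss1 ss2].
    have [le|lt] := leP s' (s + hk k.+1); first by apply: h1 => //; rewrite ss1.
    apply: h2 => //; rewrite (ltW lt) /=; have := @hkS R k; move: ss2; lra.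
  have nc : nrm (cexp (xa%:C + s%:C * tpi)) = expR xa.
    by rewrite nrm_cexp cReD cReM !cReC cImC /= mulr0 mul0r subr0 addr0.
  have [d d0 hd] : near_point (xa%:C + s%:C * tpi) (fun w =>
      nrm (F (cexp w) - F (cexp (xa%:C + s%:C * tpi))) <= e / 2).
    apply: (ccont_comp (cdiff_cont (cdiff_cexp _)) (cF _ nc)).
    by rewrite divr_gt0.
  have tp0 : 0 < nrm tpi + 1 by rewrite ltr_wpDl// nrm_ge0.
  exists (d / 2 / (nrm tpi + 1)); first by rewrite !divr_gt0.
  move=> k s' t' _ _ _ _ /andP[a1 a2] _ hkd; exists (d / 2); first by rewrite divr_gt0.
  move=> h h0 hd2 s'' /andP[b1 b2]; rewrite /Q.
  have close (r : R) : `|r| < d / 2 ->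
      nrm (xa%:C + s''%:C * tpi + r%:C - (xa%:C + s%:C * tpi)) < d.
    move=> rd.
    have -> : xa%:C + s''%:C * tpi + r%:C - (xa%:C + s%:C * tpi) =
      (s'' - s)%:C * tpi + r%:C by rewrite rmorphB /=; ring.
    have := nrmD ((s'' - s)%:C * tpi) r%:C; rewrite nrmM !nrmC.
    have : `|s'' - s| <= hk k by rewrite ler_norml; apply/andP; split; lra.
    move: hkd; rewrite ltr_pdivlMr//.
    have := nrm_ge0 tpi; have := hk0 (R:=R) k; have := normr_ge0 (s'' - s); nra.
  have c1 := hd _ (close h _); have c2 := hd _ (close (- h) _).
  move: c1 c2; rewrite rmorphN /= normrN gtr0_norm// => /(_ hd2) c1 /(_ hd2) c2.
  move: c1 c2; set p := F _; set q := F _; set r := F _ => c1 c2.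
  have := nrm_tri q p r; rewrite (nrmBC q r); lra.
exists d => // h h0 hd' n; rewrite /cmean.
have e1 : (xa + h)%:C = xa%:C + h%:C :> C by rewrite rmorphD.
have e2 : (xa - h)%:C = xa%:C + (- h)%:C :> C by rewrite rmorphD.
rewrite e1 e2 ![_ + _ + tpi]addrAC -!(av_shift n (fun w => F (cexp w))) -avB.
apply: av_bound => s s0 s1 /=; have := hd h h0 hd' s.
rewrite /hk expr0 add0r s0 s1 => /(_ isT); rewrite /Q.
have -> : xa%:C + tpi - xa%:C = tpi by rewrite addrC addKr.
by rewrite rmorphN.
Qed.

(** The exceptional point [a] is avoided by two annuli; the means jump little
    across the circle through [a]. *)
Lemma cmean_disc F (a : C) (x : R) : a != 0 -> nrm a < expR x ->
  (forall z, z != a -> nrm z <= expR x -> cdiff F z) -> ccont F a ->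
  tends (fun n => cmean n F x) (F 0).
Proof.
move=> a0 ax dF cFa; apply: tends_approx => e e0.
pose xa := ln (nrm a).
have na : expR xa = nrm a by rewrite lnK// posrE nrm_gt0.
have xax : xa < x by rewrite -ltr_expR na.
have cF z : nrm z = expR xa -> ccont F z.
  move=> zx; have [->//|za] := eqVneq z a; apply: cdiff_cont; apply: dF => //.
  by rewrite zx na ltW.
have [d d0 hd] := cmean_cross cF e0.
pose h := Num.min (d / 2) (x - xa).
have h0 : 0 < h by rewrite lt_min divr_gt0// subr_gt0.
have hlt : h < d.
  have : h <= d / 2 by rewrite ge_min lexx.
  lra.
have hx : xa + h <= x.
  have : h <= x - xa by rewrite ge_min lexx orbT.
  lra.
exists (fun n => (cmean n F x - cmean n F (xa + h)) + cmean n F (xa - h)).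
  rewrite -[X in tends _ X]add0r; apply: tendsD.
    apply: cmean_annulus => // z /andP[z1 z2]; apply: dF => //.
    apply: contraTneq z1 => ->; rewrite -na -ltNge ltr_expR; lra.
  have dF' z : nrm z <= expR (xa - h) -> cdiff F z.
    move=> zx; apply: dF.
      apply: contraTneq zx => ->; rewrite -na -ltNge ltr_expR; lra.
    apply: (le_trans zx); rewrite ler_expR; lra.
  apply: cmean_center => [|z _]; last exact: dF'.
  by apply: cdiff_cont; apply: dF'; rewrite nrm0 expR_ge0.
move=> n; have := hd h h0 hlt n; congr (nrm _ <= e); ring.
Qed.

(** The circle is pushed to infinity, where the kernel is small. *)
Lemma cmean_kernel (a : C) : nrm a < 1 ->
  tends (fun n => cmean n (fun z => a / (z - a)) 0) 0.
Proof.
move=> a1; apply: tends_approx => e e0.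
pose K := nrm a + nrm a / e + 1.
have ae0 : 0 <= nrm a / e by rewrite divr_ge0 ?nrm_ge0// ltW.
have K1 : 1 <= K by rewrite /K; have := nrm_ge0 a; lra.
have K0 : 0 < K by rewrite (lt_le_trans ltr01).
exists (fun n => - (cmean n (fun z => a / (z - a)) (ln K) - cmean n (fun z => a / (z - a)) 0)).
  rewrite -[X in tends _ X]oppr0; apply: tendsN.
  apply: cmean_annulus => [|z /andP[z1 _]]; first by rewrite ln_ge0.
  apply: cdiffM; first exact: cdiff_cst.
  apply: cdiffV; last exact: cdiffD (cdiff_id _) (cdiff_cst _ _).
  rewrite subr_eq0; apply: contraTneq z1 => ->; by rewrite expR0 -ltNge.
move=> n; rewrite opprK addrC subrK; apply: cmean_bound => z; rewrite lnK ?posrE// => zK.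
have : K - nrm a <= nrm (z - a).
  by have := nrm_le_dist z a; rewrite zK; lra.
have Ka : 0 < K - nrm a by rewrite /K; lra.
move=> h; rewrite nrmM nrmV ler_pdivrMr ?(lt_le_trans Ka)//.
apply: (@le_trans _ _ (e * (K - nrm a))); last by rewrite ler_wpM2l ?(ltW e0).
rewrite -ler_pdivrMl// mulrC /K; lra.
Qed.

(** Cauchy's formula for both sides of the circle.  Subtracting [G a] makes the
    integrand continuous at [a], by the slope function of [G]; what is left is a
    multiple of the kernel. *)
Lemma cauchy_mean G (a : C) : nrm a != 1 -> (forall z, nrm z <= 1 -> cdiff G z) ->
  tends (fun n => cmean n (fun z => G z * (a / (z - a))) 0)
        ((if nrm a < 1 then G a else 0) - G 0).
Proof.
move=> a1 dG.
have [a_0|a0] := eqVneq a 0.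
  rewrite a_0 nrm0 ltr01 subrr.
  have -> : (fun z : C => G z * (0 / (z - 0))) = fun=> 0.
    by apply/funext => z; rewrite mul0r mulr0.
  under eq_fun do rewrite cmean_cst; exact: tends_cst.
case: ltP => [lt|ge].
- have [D [phi [GE phia cphi]]] := dG a (ltW lt).
  pose F z := a * phi z.
  have FE z : z != a -> F z = (G z - G a) * (a / (z - a)).
    move=> za; rewrite [G z]GE /F; field; by rewrite subr_eq0.
  have -> : (fun n => cmean n (fun z => G z * (a / (z - a))) 0) =
     (fun n => cmean n F 0 + G a * cmean n (fun z => a / (z - a)) 0).
    apply/funext => n; rewrite -cmeanZ -cmeanD; apply: eq_cmean => z zx.
    rewrite FE; first by ring.
    by apply: contra_eq_neq zx => ->; rewrite expR0 lt_eqF.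
  have -> : G a - G 0 = F 0 + G a * 0.
    rewrite FE 1?eq_sym//; field; by rewrite ?sub0r ?oppr_eq0 ?a0.
  apply: tendsD; last by apply: tendsZl; exact: cmean_kernel.
  apply: (@cmean_disc _ a); rewrite ?expR0//; last first.
    by apply: ccontM => //; exact: ccont_cst.
  move=> z za z1; apply: (@cdiff_near _ (fun z => (G z - G a) * (a / (z - a)))).
    exists (nrm (z - a)); first by rewrite nrm_gt0 subr_eq0.
    move=> w wz; rewrite FE//; apply: contraTneq wz => ->.
    by rewrite nrmBC -leNgt.
  apply: cdiffM; first exact: cdiffD (dG _ z1) (cdiff_cst _ _).
  apply: cdiffM; first exact: cdiff_cst.
  apply: cdiffV; first by rewrite subr_eq0.
  exact: cdiffD (cdiff_id _) (cdiff_cst _ _).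
- have gt : 1 < nrm a by rewrite lt_neqAle eq_sym a1.
  have -> : 0 - G 0 = G 0 * (a / (0 - a)) by field; rewrite ?sub0r ?oppr_eq0 ?a0.
  have dF z : nrm z <= 1 -> cdiff (fun z => G z * (a / (z - a))) z.
    move=> z1; apply: cdiffM; first exact: dG.
    apply: cdiffM; first exact: cdiff_cst.
    apply: cdiffV; last exact: cdiffD (cdiff_id _) (cdiff_cst _ _).
    by rewrite subr_eq0; apply: contraTneq z1 => ->; rewrite -ltNge.
  apply: (@cmean_center (fun z => G z * (a / (z - a)))) => [|z _].
    by apply: cdiff_cont; apply: dF; rewrite nrm0.
  by rewrite expR0; exact: dF.
Qed.

End CircleMean.

(** * Pick's inequality *)

Section Pick.
Context {R : realType}.
Local Notation C := R[i].

Lemma cmean_sum n (T : Type) (s : seq T) (F : T -> C -> C) (x : R) :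
  cmean n (fun z => \sum_(i <- s) F i z) x = \sum_(i <- s) cmean n (F i) x.
Proof.
elim: s => [|i s ih].
  by under [LHS]eq_cmean do rewrite big_nil; rewrite cmean_cst big_nil.
by under [LHS]eq_cmean do rewrite big_cons; rewrite cmeanD ih big_cons.
Qed.

(** Pick's inequality for points on both sides of the unit circle.  On the circle
    the sum is the value at the vector [z / (z - p i)] of a form with nonnegative
    real part; Cauchy's formula evaluates its mean. *)
Lemma disc_pick (T : finType) (G : T -> T -> C -> C) (p : T -> C) :
  (forall i j z, nrm z <= 1 -> cdiff (G i j) z) ->
  (forall z (c : T -> C), nrm z = 1 ->
     0 <= complex.Re (\sum_i \sum_j c i * Num.conj (c j) * G i j z)) ->
  (forall i, p i != 0) -> (forall i, nrm (p i) != 1) ->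
  (forall i j, p i * Num.conj (p j) != 1) ->
  0 <= complex.Re (\sum_i \sum_j
    ((if nrm (p i) < 1 then G i j (p i) else 0)
     - (if 1 < nrm (p j) then G i j (Num.conj (p j))^-1 else 0))
    / (1 - p i * Num.conj (p j))).
Proof.
move=> dG posG p0 p1 pp.
pose b j := (Num.conj (p j))^-1.
have cp0 j : Num.conj (p j) != 0 by rewrite conjC_eq0.
have nb j : nrm (b j) = (nrm (p j))^-1 by rewrite nrmV nrmJ.
have np j : 0 < nrm (p j) by rewrite nrm_gt0.
have b1 j : nrm (b j) != 1 by rewrite nb invr_eq1.
have bE j : (nrm (b j) < 1) = (1 < nrm (p j)) by rewrite nb invf_lt1.
pose w n i j := (1 - p i * Num.conj (p j))^-1 *
   (cmean n (fun z => G i j z * (p i / (z - p i))) 0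
    - cmean n (fun z => G i j z * (b j / (z - b j))) 0).
apply: (@tends_Re_ge0 _ (fun n => \sum_i \sum_j w n i j)).
  apply: tends_sum => i; apply: tends_sum => j.
  rewrite mulrC; apply: tendsZl.
  have -> : forall x y : C, x - y = (x - G i j 0) + - (y - G i j 0) by move=> x y; ring.
  apply: tendsD; first by apply: cauchy_mean => // z; exact: dG.
  apply: tendsN; rewrite -bE; apply: cauchy_mean => // z; exact: dG.
move=> n.
have -> : \sum_i \sum_j w n i j = cmean n (fun z => \sum_i \sum_j
    (1 - p i * Num.conj (p j))^-1 *
    (G i j z * (p i / (z - p i)) - G i j z * (b j / (z - b j)))) 0.
  rewrite cmean_sum; apply: eq_bigr => i _; rewrite cmean_sum; apply: eq_bigr => j _.
  by rewrite cmeanZ cmeanB.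
apply: cmean_Re_ge0 => z; rewrite expR0 => z1.
have zJ : z * Num.conj z = 1 by rewrite mul_conj z1 expr1n.
have z0 : z != 0 by rewrite -nrm_gt0 z1.
have zJE : Num.conj z = z^-1 by apply: (mulfI z0); rewrite zJ divff.
have := posG z (fun i => z / (z - p i)) z1; congr (0 <= complex.Re _).
apply: eq_bigr => i _; apply: eq_bigr => j _.
have zp : z - p i != 0.
  by rewrite subr_eq0; apply: contra_neq (p1 i) => <-.
have zb : z - b j != 0.
  by rewrite subr_eq0; apply: contra_neq (b1 j) => <-.
rewrite !conjE zJE.
have q0 := cp0 j; have pq := pp i j.
move: zb; rewrite /b; move: q0 pq; move: (Num.conj (p j)) => q q0 pq zb.
have zq : 1 - z * q != 0.
  apply: contra_neq zb => h; have -> : z = q^-1; last by rewrite subrr.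
  by apply: (mulIf q0); rewrite mulVf//; apply/eqP; rewrite eq_sym -subr_eq0 h.
have zq' : z^-1 - q != 0.
  apply: contra_neq zq => h; have -> : q = z^-1 by apply/eqP; rewrite eq_sym -subr_eq0 h.
  by rewrite divff// subrr.
have zq2 : z * q - 1 != 0 by rewrite -oppr_eq0 opprB.
have pq' : 1 - p i * q != 0 by rewrite subr_eq0 eq_sym.
have -> : q^-1 / (z - q^-1) = (z * q - 1)^-1.
  by field; rewrite ?zq2 ?q0 ?zb.
have -> : z^-1 / (z^-1 - q) = (1 - z * q)^-1.
  by field; rewrite ?zq ?zq' ?z0.
by field; rewrite ?zp ?zq ?zq2 ?pq'.
Qed.

Lemma realCV (r : R) : ((r^-1)%:C : C) = (r%:C)^-1.
Proof. exact: fmorphV. Qed.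

Definition ultimately (P : nat -> Prop) := exists N, forall n, (N <= n)%N -> P n.

Lemma ultimatelyI P Q : ultimately P -> ultimately Q -> ultimately (fun n => P n /\ Q n).
Proof.
move=> [N hN] [M hM]; exists (maxn N M) => n; rewrite geq_max => /andP[/hN ? /hM ?].
by split.
Qed.

Lemma ultimatelyW (P Q : nat -> Prop) : (forall n, P n -> Q n) ->
  ultimately P -> ultimately Q.
Proof. by move=> PQ [N hN]; exists N => n /hN /PQ. Qed.

Lemma ultimately_all (T : finType) (P : T -> nat -> Prop) :
  (forall i, ultimately (P i)) -> ultimately (fun n => forall i, P i n).
Proof.
move=> /choice[N hN]; exists (\max_i N i) => n hn i; apply: hN.
by apply: leq_trans hn; exact: leq_bigmax.
Qed.

Lemma tends_ultimately_Re_ge0 (u : nat -> C) l : tends u l ->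
  ultimately (fun n => 0 <= complex.Re (u n)) -> 0 <= complex.Re l.
Proof.
move=> ul [M hM]; apply: (@tends_Re_ge0 _ (fun n => u (n + M)%N)) => [|n].
  by move=> e /ul[N hN]; exists N => n nN; apply: hN; rewrite (leq_trans nN)// leq_addr.
by apply: hM; rewrite leq_addl.
Qed.

(** Parameters of the exhausting discs; starting from [1 / 2] keeps the radii
    positive. *)
Definition dn (n : nat) : R := (n.+2)%:R^-1.

Lemma dn_gt0 n : 0 < dn n. Proof. by rewrite invr_gt0 ltr0n. Qed.
Lemma dn_le n : dn n <= 2^-1.
Proof. by rewrite lef_pV2 ?posrE ?ltr0n// ler_nat. Qed.
Lemma dn_small (e : R) : 0 < e -> ultimately (fun n => dn n < e).
Proof.
move=> /invn_lt[N hN]; exists N => n /hN; apply: le_lt_trans.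
by rewrite lef_pV2 ?posrE ?ltr0n// ler_nat.
Qed.

Lemma ccont_dn (g : C -> C) : ccont g 0 -> tends (fun n => g (dn n)%:C) (g 0).
Proof.
move=> cg e e0; have [d d0 hd] := cg _ (divr_gt0 e0 (ltr0n R 2)).
have [N hN] := dn_small d0; exists N => n /hN h.
have := hd (dn n)%:C; rewrite subr0 nrmC gtr0_norm ?dn_gt0// => /(_ h); lra.
Qed.

Lemma ccontN (g : C -> C) z : ccont g z -> ccont (fun w => - g w) z.
Proof. by move=> cg e /cg; apply: near_pointW => w; rewrite -opprD nrmN. Qed.

Lemma tends_neq (u : nat -> C) (l c : C) : tends u l -> l != c ->
  ultimately (fun n => u n != c).
Proof.
move=> ul lc; have [|N hN] := ul (nrm (l - c)); first by rewrite nrm_gt0 subr_eq0.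
by exists N => n /hN; apply: contraTneq => ->; rewrite nrmBC ltxx.
Qed.

Lemma ccontB (f g : C -> C) z : ccont f z -> ccont g z -> ccont (fun w => f w - g w) z.
Proof. by move=> cf cg; apply: ccontD => //; apply: ccontN. Qed.

(* The discs with center ['i / d] and radius [1 / d - d ^ 2] exhaust the upper
   half-plane as [d] tends to [0], and [kappa d] is [1 / d ^ 2] minus the square of
   the radius.  [beta l d] is the reflection of [l] in the circle, and [mult l d] the
   ratio of the kernels of the disc and of the half-plane, scaled by [d]. *)
Let kappa (d : C) : C := 2 * d - d * d * d * d.
Let beta (l d : C) : C := Num.conj l - d * (kappa d + Num.conj l * Num.conj l)
  / (d * Num.conj l + 'i).
Let mult (l d : C) : C := 'i * ((1 - d * d * d) * (1 - d * d * d)) / (d * Num.conj l + 'i).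

Let i_neq0 : ('i : C) != 0. Proof. by rewrite -nrm_gt0 nrm_i. Qed.

Let ccont_kappa : ccont kappa 0.
Proof.
by apply: ccontB; do ?[apply: ccontM|exact: ccont_id|exact: ccont_cst].
Qed.

Let ccont_den (l : C) : ccont (fun d => (d * Num.conj l + 'i)^-1) 0.
Proof.
apply: ccontV; first by rewrite mul0r add0r.
by apply: ccontD; do ?[apply: ccontM|exact: ccont_id|exact: ccont_cst].
Qed.

Let beta0 l : beta l 0 = Num.conj l.
Proof. by rewrite /beta !mul0r subr0. Qed.

Let ccont_beta l : ccont (beta l) 0.
Proof.
apply: ccontB; first exact: ccont_cst.
apply: ccontM; last exact: ccont_den.
apply: ccontM; first exact: ccont_id.
by apply: ccontD; [exact: ccont_kappa|exact: ccont_cst].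
Qed.

Let mult0 l : mult l 0 = 1.
Proof. by rewrite /mult !mul0r subr0 !mulr1 add0r divff. Qed.

Let ccont_mult l : ccont (mult l) 0.
Proof.
apply: ccontM; last exact: ccont_den.
apply: ccontM; first exact: ccont_cst.
by apply: ccontM; apply: ccontB; do ?[apply: ccontM|exact: ccont_id|exact: ccont_cst].
Qed.

(** An entry of the matrix of difference quotients of [f], extended by zero to the
    lower half-plane.  [D] replaces the quotient when its two points coincide. *)
Definition pick_term (f : C -> C) (D l m : C) : C :=
  if (0 < complex.Im l) && (l == Num.conj m) then D else
  ((if 0 < complex.Im l then f l else 0)
   - (if complex.Im m < 0 then f (Num.conj m) else 0)) / (l - Num.conj m).

Let beta_tends l : tends (fun n => beta l (dn n)%:C) (Num.conj l).
Proof. by have := ccont_dn (ccont_beta l); rewrite beta0. Qed.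

Let ev_small (l : C) : ultimately (fun n => (dn n) * nrm l < 1).
Proof.
have l1 : 0 < nrm l + 1 by rewrite ltr_wpDl// nrm_ge0.
have [|N hN] := @dn_small (nrm l + 1)^-1; first by rewrite invr_gt0.
exists N => n /hN; rewrite -[X in _ < X]div1r ltr_pdivlMr// => h.
have := dn_gt0 n; nra.
Qed.

Let ev_den (l : C) : ultimately (fun n => (dn n)%:C * Num.conj l + 'i != 0).
Proof.
apply: ultimatelyW (ev_small l) => n h; apply: contraTneq h => h.
have : (dn n)%:C * Num.conj l = - 'i by apply/eqP; rewrite -addr_eq0 h.
move/(congr1 nrm); rewrite nrmM nrmJ nrmC nrmN nrm_i ger0_norm ?(ltW (dn_gt0 n))//.
by move=> ->; rewrite ltxx.
Qed.

Let ev_beta (l m : C) : complex.Im m != 0 ->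
  ultimately (fun n => beta m (dn n)%:C != l).
Proof.
move=> m0; have [ <-|lm] := eqVneq (Num.conj m) l; last exact: tends_neq (@beta_tends m) lm.
have m_0 : Num.conj m * Num.conj m != 0.
  by rewrite mulf_neq0 ?conjC_eq0//; apply: contra_neq m0 => ->.
have := @ccont_dn (fun d => kappa d + Num.conj m * Num.conj m).
rewrite /kappa !mul0r mulr0 subr0 add0r => h.
have {}h := h (ccontD ccont_kappa (@ccont_cst _ _ _)).
apply: ultimatelyW (ultimatelyI (tends_neq h m_0) (ev_den m)) => n [h1 h2].
rewrite /beta /kappa; apply/eqP => h3.
have : (dn n)%:C * (2 * (dn n)%:C - (dn n)%:C * (dn n)%:C * (dn n)%:C * (dn n)%:C +
   Num.conj m * Num.conj m) / ((dn n)%:C * Num.conj m + 'i) = 0.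
  by apply/eqP; rewrite -oppr_eq0 -[_ == _](inj_eq (addrI (Num.conj m))) addr0 h3.
move/eqP; rewrite !mulf_eq0 invr_eq0 (negPf h2) (negPf h1) !orbF.
by rewrite -nrm_eq0 nrmC normr_eq0 gt_eqF// dn_gt0.
Qed.

(* For small [d] the sign of [Im l] decides on which side of the circle [l] lies:
   the square of its distance to the center exceeds the square of the radius by
   [|l| ^ 2 - 2 * Im l / d + kappa d]. *)
Let ev_side (l : C) : complex.Im l != 0 -> ultimately (fun n =>
  [/\ (nrm (l - 'i / (dn n)%:C) < (dn n)^-1 - dn n ^+ 2) = (0 < complex.Im l),
      ((dn n)^-1 - dn n ^+ 2 < nrm (l - 'i / (dn n)%:C)) = (complex.Im l < 0) &
      l - 'i / (dn n)%:C != 0]).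
Proof.
move=> l0; pose S := complex.Re l ^+ 2 + complex.Im l ^+ 2 + 1.
have S0 : 0 < S by rewrite ltr_wpDl// addr_ge0 ?sqr_ge0.
have [|N hN] := @dn_small (`|complex.Im l| / S); first by rewrite divr_gt0// normr_gt0.
apply: ultimatelyW (ultimatelyI (ex_intro _ N hN) (ev_small l)) => n [h sm].
have d0 := dn_gt0 n; have d2 := dn_le n.
move: h; rewrite ltr_pdivlMr// => h.
set d := dn n in d0 d2 h sm *.
have r0 : 0 < d^-1 - d ^+ 2.
  have : 2 <= d^-1 by rewrite -[2]invrK lef_pV2// posrE.
  have : d ^+ 2 <= 1 by nra.
  lra.
have nE : nrm (l - 'i / d%:C) ^+ 2 - (d^-1 - d ^+ 2) ^+ 2 =
   complex.Re l ^+ 2 + complex.Im l ^+ 2 - 2 * complex.Im l / d + 2 * d - d ^+ 4.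
  have -> : 'i / d%:C = 'i * (d^-1)%:C :> C by rewrite realCV.
  rewrite nrm_sqr !ReImE; field; by rewrite gt_eqF.
have n_0 : l - 'i / d%:C != 0.
  rewrite subr_eq0; apply: contraTneq sm => ->.
  rewrite nrmM nrm_i nrmV nrmC gtr0_norm// mul1r divff ?gt_eqF// ltxx //.
have cmp1 : (nrm (l - 'i / d%:C) < d^-1 - d ^+ 2) =
   (nrm (l - 'i / d%:C) ^+ 2 - (d^-1 - d ^+ 2) ^+ 2 < 0).
  by rewrite subr_lt0 ltr_sqr// nnegrE ?nrm_ge0// ltW.
have cmp2 : (d^-1 - d ^+ 2 < nrm (l - 'i / d%:C)) =
   (0 < nrm (l - 'i / d%:C) ^+ 2 - (d^-1 - d ^+ 2) ^+ 2).
  by rewrite subr_gt0 ltr_sqr// nnegrE ?nrm_ge0// ltW.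
have d4 : 0 < 2 * d - d ^+ 4 /\ 2 * d - d ^+ 4 <= 1.
  have : 0 < d ^+ 4 by rewrite exprn_gt0.
  have : d ^+ 4 <= d ^+ 1 by apply: ler_wiXn2l; rewrite ?(ltW d0)//; lra.
  rewrite expr1; lra.
rewrite cmp1 cmp2 nE n_0.
case: (ltgtP (complex.Im l) 0) l0 h => // il _.
- rewrite ltr0_norm// => h.
  set X := (X in X < 0); have Xp : 0 < X.
    have : 0 <= - (complex.Im l / d).
      by rewrite -mulNr divr_ge0 ?(ltW d0)// oppr_ge0 ltW.
    have := sqr_ge0 (complex.Re l); have := sqr_ge0 (complex.Im l); rewrite /X; lra.
  by rewrite Xp ltNge (ltW Xp).
- rewrite gtr0_norm// => h.
  have hS : S < complex.Im l / d by rewrite ltr_pdivlMr// mulrC.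
  set X := (X in X < 0); have Xn : X < 0 by move: hS S0; rewrite /X /S; lra.
  by rewrite Xn ltNge (ltW Xn).
Qed.

(** Pick's inequality for points in both half-planes, by exhausting the upper
    half-plane with discs.  The reflection of a point in the circle is never equal
    to the conjugate point, only tends to it: this produces the derivatives. *)
Lemma halfplane_pick (T : finType) (f : T -> T -> C -> C) (D : T -> T -> C) (l : T -> C) :
  (forall i, complex.Im (l i) != 0) ->
  (forall i j z, 0 < complex.Im z -> cdiff (f i j) z) ->
  (forall i j, 0 < complex.Im (l i) -> cderiv (f i j) (l i) (D i j)) ->
  (forall z (c : T -> C), 0 < complex.Im z ->
     0 <= complex.Im (\sum_i \sum_j c i * Num.conj (c j) * f i j z)) ->
  0 <= complex.Re (\sum_i \sum_j pick_term (f i j) (D i j) (l i) (l j)).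
Proof.
move=> l0 df dD posf.
have ex ij : exists phi : C -> C, 0 < complex.Im (l ij.1) ->
    [/\ forall w, f ij.1 ij.2 w = f ij.1 ij.2 (l ij.1) + (w - l ij.1) * phi w,
        phi (l ij.1) = D ij.1 ij.2 & ccont phi (l ij.1)].
  have [up|_] := boolP (0 < complex.Im (l ij.1)); last by exists id.
  by have [phi hphi] := dD ij.1 ij.2 up; exists phi.
have {ex}[phi hphi] := choice ex.
pose Y i j d := if (0 < complex.Im (l i)) && (l i == Num.conj (l j))
  then phi (i, j) (beta (l j) d) else
  ((if 0 < complex.Im (l i) then f i j (l i) else 0)
   - (if complex.Im (l j) < 0 then f i j (beta (l j) d) else 0)) / (l i - beta (l j) d).
have cY i j : ccont (Y i j) 0 /\ Y i j 0 = pick_term (f i j) (D i j) (l i) (l j).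
  have [cnd|ne] := boolP ((0 < complex.Im (l i)) && (l i == Num.conj (l j)));
    rewrite /Y /pick_term ?cnd ?(negPf ne).
    move: cnd => /andP[up /eqP lE]; have [_ p2 p3] := hphi (i, j) up.
    split; last by rewrite beta0 -lE.
    by apply: ccont_comp; [exact: ccont_beta|rewrite beta0 -lE].
  split; last by rewrite beta0.
  have [lE|lE] := eqVneq (l i) (Num.conj (l j)).
    move: ne; rewrite lE eqxx andbT cImJ oppr_gt0 => /negbTE ->.
    by rewrite subrr; under eq_fun do rewrite mul0r; exact: ccont_cst.
  apply: ccontM; last first.
    apply: ccontV; first by rewrite beta0 subr_eq0.
    by apply: ccontB; [exact: ccont_cst|exact: ccont_beta].
  apply: ccontB; first exact: ccont_cst.
  have [low|low] := boolP (complex.Im (l j) < 0); last exact: ccont_cst.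
  apply: ccont_comp; first exact: ccont_beta.
  by rewrite beta0; apply: cdiff_cont; apply: df; rewrite cImJ oppr_gt0.
pose g i j d := mult (l j) d * Y i j d.
have gt i j : tends (fun n => g i j (dn n)%:C) (pick_term (f i j) (D i j) (l i) (l j)).
  have [c1 c2] := cY i j.
  have := @ccont_dn (g i j) (ccontM (ccont_mult (l j)) c1).
  by rewrite {2}/g mult0 mul1r c2.
apply: (@tends_ultimately_Re_ge0 (fun n => \sum_i \sum_j g i j (dn n)%:C)).
  by apply: tends_sum => i; apply: tends_sum => j; exact: gt.
have E1 := ultimately_all (fun i => ev_side (l0 i)).
have E2 := ultimately_all (fun i => ev_den (l i)).
have E3 := ultimately_all (fun i => ultimately_all (fun j => ev_beta (l i) (l0 j))).
apply: ultimatelyW (ultimatelyI E1 (ultimatelyI E2 E3)) => n [e1 [e2 e3]].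
have d0 := dn_gt0 n; have d2 := dn_le n.
move: (dn n) d0 d2 e1 e2 e3 => d d0 d2 e1 e2 e3.
have dC0 : (d%:C : C) != 0 by rewrite -nrm_gt0 nrmC normr_gt0 gt_eqF.
pose r := d^-1 - d ^+ 2.
have r0 : 0 < r.
  have : 2 <= d^-1 by rewrite -[2]invrK lef_pV2// posrE.
  have : d ^+ 2 <= 1 by nra.
  rewrite /r; lra.
have rC0 : (r%:C : C) != 0 by rewrite -nrm_gt0 nrmC normr_gt0 gt_eqF.
have rE : r%:C = d%:C^-1 - d%:C ^+ 2 :> C by rewrite /r rmorphB /= realCV rmorphXn.
(* The points [p i] are the [l i] in the coordinate of the unit disc. *)
pose c0 : C := 'i / d%:C.
pose p i := (l i - c0) / r%:C.
have nrmp i : nrm (p i) = nrm (l i - c0) / r.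
  by rewrite /p nrmM nrmV nrmC gtr0_norm.
have p_lt i : (nrm (p i) < 1) = (0 < complex.Im (l i)).
  by have [ <- _ _] := e1 i; rewrite nrmp ltr_pdivrMr// mul1r.
have p_gt i : (1 < nrm (p i)) = (complex.Im (l i) < 0).
  by have [_ <- _] := e1 i; rewrite nrmp ltr_pdivlMr// mul1r.
have pJ j : Num.conj (p j) = (Num.conj (l j) + c0) / r%:C.
  rewrite /p /c0 !conjE; congr (_ / _); ring.
have lc j : Num.conj (l j) + c0 != 0.
  have [_ _] := e1 j; apply: contra_neq => h.
  have : Num.conj (Num.conj (l j) + c0) = 0 by rewrite h conj0.
  by rewrite /c0 !conjE mulNr.
have lc2 j : Num.conj (l j) + 'i / d%:C != 0 by exact: lc.
have bE j : c0 + r%:C * (Num.conj (p j))^-1 = beta (l j) d%:C.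
  have := lc2 j; have := e2 j; rewrite pJ /beta /kappa /c0.
  have : r%:C ^+ 2 = d%:C^-1 ^+ 2 - 2 * d%:C + d%:C ^+ 4 :> C by rewrite rE; field.
  have : 'i ^+ 2 = -1 :> C by exact: sqrCi.
  move: (Num.conj (l j)) (d%:C) (r%:C) ('i : C) dC0 rC0 => q x s I x0 s0 I2 s2 h1 h2.
  have -> : I / x + s * ((q + I / x) / s)^-1 = I / x + s ^+ 2 * x / (x * q + I).
    by field; rewrite ?h1 ?h2 ?x0 ?s0.
  rewrite s2; apply/eqP; rewrite -subr_eq0; apply/eqP.
  transitivity ((1 + I ^+ 2) / (x * (x * q + I))); last by rewrite I2 subrr mul0r.
  by field; rewrite ?h1 ?x0.
have pp i j : 1 - p i * Num.conj (p j) =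
    (Num.conj (l j) + c0) * (beta (l j) d%:C - l i) / r%:C ^+ 2.
  rewrite -bE pJ /p; field; by rewrite ?lc ?rC0.
have lb i j : l i - beta (l j) d%:C != 0 by rewrite subr_eq0 eq_sym.
have inup z : nrm z <= 1 -> 0 < complex.Im (c0 + r%:C * z).
  move=> z1; have -> : complex.Im (c0 + r%:C * z) = d^-1 + r * complex.Im z.
    by rewrite /c0 -realCV !ReImE; ring.
  have := Im_le_nrm z; rewrite ler_norml => /andP[h _].
  have : - 1 <= complex.Im z by lra.
  move=> h1; have : - r <= r * complex.Im z by rewrite -mulrN1 ler_pM2l.
  have : 0 < d ^+ 2 by rewrite exprn_gt0.
  rewrite /r; lra.
have hP := @disc_pick T (fun i j z => - 'i * f i j (c0 + r%:C * z)) p.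
have {hP} : 0 <= d * complex.Re (\sum_i \sum_j
   ((if nrm (p i) < 1 then - 'i * f i j (c0 + r%:C * p i) else 0) -
    (if 1 < nrm (p j) then - 'i * f i j (c0 + r%:C * (Num.conj (p j))^-1) else 0)) /
   (1 - p i * Num.conj (p j))).
  rewrite pmulr_rge0//; apply: hP.
  - move=> i j z z1; apply: cdiffM; first exact: cdiff_cst.
    apply: (@cdiff_comp _ (fun z => c0 + r%:C * z)); last by apply: df; exact: inup.
    apply: cdiffD; first exact: cdiff_cst.
    by apply: cdiffM; [exact: cdiff_cst|exact: cdiff_id].
  - move=> z c z1; have := posf (c0 + r%:C * z) c (inup z _); rewrite z1 => /(_ (lexx 1)).
    suff -> : \sum_i \sum_j c i * Num.conj (c j) * (- 'i * f i j (c0 + r%:C * z)) =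
       - 'i * \sum_i \sum_j c i * Num.conj (c j) * f i j (c0 + r%:C * z).
      by rewrite cReM !ReImE; lra.
    rewrite big_distrr; apply: eq_bigr => i _; rewrite big_distrr; apply: eq_bigr => j _ /=.
    ring.
  - move=> i; rewrite /p mulf_neq0 ?invr_eq0//; by have [_ _] := e1 i.
  - move=> i; have := p_lt i; have := p_gt i; case: (ltgtP (nrm (p i)) 1) => // _.
    by case: (ltgtP (complex.Im (l i)) 0) (l0 i).
  - move=> i j; rewrite eq_sym -subr_eq0 pp !mulf_neq0 ?invr_eq0 ?expf_eq0//.
    by rewrite subr_eq0.
suff -> : \sum_i \sum_j g i j d%:C = d%:C * \sum_i \sum_j
   ((if nrm (p i) < 1 then - 'i * f i j (c0 + r%:C * p i) else 0) -
    (if 1 < nrm (p j) then - 'i * f i j (c0 + r%:C * (Num.conj (p j))^-1) else 0)) /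
   (1 - p i * Num.conj (p j)) by rewrite cReM cReC cImC mul0r subr0.
rewrite big_distrr; apply: eq_bigr => i _; rewrite big_distrr; apply: eq_bigr => j _ /=.
have pl : c0 + r%:C * p i = l i by rewrite /p mulrC divfK// addrC subrK.
rewrite pp p_lt p_gt pl bE invf_div.
pose X := (if 0 < complex.Im (l i) then f i j (l i) else 0)
   - (if complex.Im (l j) < 0 then f i j (beta (l j) d%:C) else 0).
have -> : g i j d%:C = mult (l j) d%:C * (X / (l i - beta (l j) d%:C)).
  rewrite /g /Y; congr (_ * _); case: ifPn => [/andP[up /eqP lE]|//].
  have [h _ _] := hphi (i, j) up; rewrite /X up.
  have -> : complex.Im (l j) < 0 by rewrite -oppr_gt0 -cImJ -lE.
  rewrite (h (beta (l j) d%:C)) /=; field; exact: lb.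
have -> : (if 0 < complex.Im (l i) then - 'i * f i j (l i) else 0) -
   (if complex.Im (l j) < 0 then - 'i * f i j (beta (l j) d%:C) else 0) = - 'i * X.
  by rewrite /X; do 2!case: ifP => _; ring.
clearbody X.
rewrite rE /mult /c0; have := lb i j; have := e2 j; have := lc2 j; have := e3 i j.
move: (beta (l j) d%:C) => b.
move: (Num.conj (l j)) (l i) (d%:C) ('i : C) dC0 => q a x I x0 h1 h2 h3 h4.
have h5 : b - a != 0 by rewrite subr_eq0.
have -> : q + I / x = (x * q + I) / x by field.
have -> : b - a = - (a - b) by rewrite opprB.
move: (a - b) (x * q + I) h4 h3 => u v u0 v0.
by field; rewrite ?oppr_eq0 ?u0 ?v0 ?x0.
Qed.

End Pick.

(** * Completion of a semi-inner product space *)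

Section Triangle.
Context {R : realType} {V : normedZmodType R[i]}.
Implicit Types a b c : V.

Lemma nrm_lt2 b a c (e : R) : nrm (a - b) < e / 2 -> nrm (b - c) < e / 2 -> nrm (a - c) < e.
Proof. by have := nrm_tri b a c; lra. Qed.

Lemma nrm_lt3 b c a d (e : R) : nrm (a - b) < e / 3 -> nrm (b - c) < e / 3 ->
  nrm (c - d) < e / 3 -> nrm (a - d) < e.
Proof. by have := nrm_tri b a d; have := nrm_tri c b d; lra. Qed.
End Triangle.

(** A type with a positive semidefinite Hermitian form.  No vector space axioms
    are imposed on the carrier: elements with the same values of the form are
    identified in the completion. *)
Record preinner (R : realType) := Preinner {
  pcar :> Type;
  ppoint : pcar;
  padd : pcar -> pcar -> pcar;
  pscale : R[i] -> pcar -> pcar;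
  pform : pcar -> pcar -> R[i];
  pformD : forall x y z, pform (padd x y) z = pform x z + pform y z;
  pformZ : forall a x z, pform (pscale a x) z = a * pform x z;
  pformC : forall x y, pform x y = Num.conj (pform y x);
  pform_ge0 : forall x, 0 <= complex.Re (pform x x)
}.
Arguments ppoint {R p}.
Arguments padd {R p}.
Arguments pscale {R p}.
Arguments pform {R p}.

Section PreInner.
Context {R : realType} (P : preinner R).
Local Notation C := R[i].
Implicit Types x y z : P.

Lemma pformDr x y z : pform z (padd x y) = pform z x + pform z y.
Proof. by rewrite pformC pformD conjD -!pformC. Qed.

Lemma pformZr a x z : pform z (pscale a x) = Num.conj a * pform z x.
Proof. by rewrite pformC pformZ conjM -pformC. Qed.

Lemma pform_Im x : complex.Im (pform x x) = 0.
Proof. by have := congr1 (@complex.Im R) (pformC x x); rewrite cImJ; lra. Qed.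

Definition pnrm x : R := Num.sqrt (complex.Re (pform x x)).

Lemma pnrm_ge0 x : 0 <= pnrm x. Proof. exact: sqrtr_ge0. Qed.

Lemma pnrm_sqr x : pnrm x ^+ 2 = complex.Re (pform x x).
Proof. by rewrite sqr_sqrtr// pform_ge0. Qed.

Lemma pform_self x : pform x x = (pnrm x ^+ 2)%:C.
Proof. by apply: complex_eq; rewrite ?pnrm_sqr// pform_Im. Qed.

Definition psub x y := padd x (pscale (-1) y).

Lemma pform_subl x y z : pform (psub x y) z = pform x z - pform y z.
Proof. by rewrite pformD pformZ mulN1r. Qed.

Lemma pform_subr x y z : pform z (psub x y) = pform z x - pform z y.
Proof. by rewrite pformDr pformZr conjN conj1 mulN1r. Qed.

(** The discriminant argument, which also covers vectors of norm zero. *)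
Lemma pform_cs x y : nrm (pform x y) <= pnrm x * pnrm y.
Proof.
have key (t : R) : 0 <= pnrm x ^+ 2 - 2 * t * nrm (pform x y) ^+ 2
    + t ^+ 2 * nrm (pform x y) ^+ 2 * pnrm y ^+ 2.
  have := pform_ge0 (psub x (pscale (t%:C * pform x y) y)).
  rewrite pform_subl !pform_subr !pformZ !pformZr !pform_self [pform y x]pformC.
  rewrite !conjE.
  have -> : (pnrm x ^+ 2)%:C - t%:C * Num.conj (pform x y) * pform x y -
     (t%:C * pform x y * Num.conj (pform x y) -
      t%:C * pform x y * (t%:C * Num.conj (pform x y) * (pnrm y ^+ 2)%:C)) =
     (pnrm x ^+ 2)%:C - 2%:R * t%:C * (pform x y * Num.conj (pform x y))
     + t%:C * t%:C * (pform x y * Num.conj (pform x y)) * (pnrm y ^+ 2)%:C.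
    by ring.
  rewrite mul_conj.
  have -> : (2%:R : C) = (2 : R)%:C by rewrite rmorph_nat.
  rewrite -!rmorphM -rmorphB -rmorphD cReC; congr (0 <= _); ring.
rewrite -ler_sqr ?nnegrE ?nrm_ge0 ?mulr_ge0 ?pnrm_ge0// exprMn.
set F := nrm _ ^+ 2 in key *; have F0 : 0 <= F by rewrite exprn_ge0// nrm_ge0.
have := pnrm_ge0 y; rewrite le_eqVlt => /predU1P[y0|y0].
  rewrite -y0 expr0n mulr0; rewrite leNgt; apply/negP => Fp.
  have := key ((pnrm x ^+ 2 + 1) / (2 * F)); rewrite -y0 expr0n !mulr0 addr0.
  have -> : 2 * ((pnrm x ^+ 2 + 1) / (2 * F)) * F = pnrm x ^+ 2 + 1.
    by field; rewrite gt_eqF.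
  lra.
have y2 : 0 < pnrm y ^+ 2 by rewrite exprn_gt0.
have := key (pnrm y ^+ 2)^-1.
have -> : pnrm x ^+ 2 - 2 * (pnrm y ^+ 2)^-1 * F + (pnrm y ^+ 2)^-1 ^+ 2 * F * pnrm y ^+ 2
  = pnrm x ^+ 2 - F / pnrm y ^+ 2 by field; rewrite gt_eqF.
by rewrite subr_ge0 ler_pdivrMr.
Qed.

Lemma pnrmD x y : pnrm (padd x y) <= pnrm x + pnrm y.
Proof.
rewrite -ler_sqr ?nnegrE ?addr_ge0 ?pnrm_ge0// pnrm_sqr pformD !pformDr.
rewrite [pform y x]pformC !cReD cReJ -!pnrm_sqr.
have := pform_cs x y; have := Re_le_nrm (pform x y).
have := ler_norm (complex.Re (pform x y)); nra.
Qed.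

Lemma pnrmZ a x : pnrm (pscale a x) = nrm a * pnrm x.
Proof.
apply/eqP; rewrite -(@eqrXn2 _ 2%N) ?mulr_ge0 ?nrm_ge0 ?pnrm_ge0// exprMn.
by rewrite pnrm_sqr pformZ pformZr mulrA mul_conj cReM cReC cImC mul0r subr0 pnrm_sqr.
Qed.

Lemma pnrm_ext x y : (forall z, pform x z = pform y z) -> pnrm x = pnrm y.
Proof. by move=> h; rewrite /pnrm h pformC h -pformC. Qed.

Definition pcauchy (u : nat -> P) := forall e : R, 0 < e ->
  exists N, forall m n, (N <= m)%N -> (N <= n)%N -> pnrm (psub (u m) (u n)) < e.

Lemma pnrm_le_sub x y : pnrm x <= pnrm y + pnrm (psub x y).
Proof.
apply: le_trans (pnrmD _ _); rewrite le_eqVlt; apply/orP; left; apply/eqP.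
by apply: pnrm_ext => w; rewrite pformD pform_subl addrC subrK.
Qed.

Lemma pcauchy_bounded u : pcauchy u -> exists2 K : R, 0 < K & forall n, pnrm (u n) <= K.
Proof.
move=> /(_ 1 ltr01)[N hN].
pose K := \sum_(i < N.+1) pnrm (u i) + 1.
have s0 : 0 <= \sum_(i < N.+1) pnrm (u i) by apply: sumr_ge0 => i _; exact: pnrm_ge0.
have small n : (n < N.+1)%N -> pnrm (u n) <= K - 1.
  move=> nN; rewrite /K addrK (bigD1 (Ordinal nN))//= lerDl.
  by apply: sumr_ge0 => i _; exact: pnrm_ge0.
exists K => [|n]; first by rewrite /K; lra.
have [/small|Nn] := ltnP n N.+1; first by lra.
have := hN n N (ltnW Nn) (leqnn N); have := pnrm_le_sub (u n) (u N).
have := small N (ltnSn N); lra.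
Qed.

Lemma pcauchy_form u v : pcauchy u -> pcauchy v ->
  cauchy_seq (fun n => pform (u n) (v n)).
Proof.
move=> cu cv; have [K K0 hK] := pcauchy_bounded cu; have [L L0 hL] := pcauchy_bounded cv.
move=> e e0.
have [N hN] := cu _ (divr_gt0 e0 (mulr_gt0 (ltr0n R 2) L0)).
have [M hM] := cv _ (divr_gt0 e0 (mulr_gt0 (ltr0n R 2) K0)).
exists (maxn N M) => m n; rewrite !geq_max => /andP[Nm Mm] /andP[Nn Mn].
have -> : pform (u m) (v m) - pform (u n) (v n) =
  pform (psub (u m) (u n)) (v m) + pform (u n) (psub (v m) (v n)).
  by rewrite pform_subl pform_subr; ring.
have h1 : nrm (pform (psub (u m) (u n)) (v m)) < e / 2.
  apply: (le_lt_trans (pform_cs _ _)).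
  have := hN m n Nm Nn; rewrite ltr_pdivlMr ?mulr_gt0// => h.
  have := ler_wpM2l (pnrm_ge0 (psub (u m) (u n))) (hL m); lra.
have h2 : nrm (pform (u n) (psub (v m) (v n))) < e / 2.
  apply: (le_lt_trans (pform_cs _ _)).
  have := hM m n Mm Mn; rewrite ltr_pdivlMr ?mulr_gt0// => h.
  have := ler_wpM2r (pnrm_ge0 (psub (v m) (v n))) (hK n); lra.
have := nrmD (pform (psub (u m) (u n)) (v m)) (pform (u n) (psub (v m) (v n))); lra.
Qed.

Lemma pcauchyD u v : pcauchy u -> pcauchy v -> pcauchy (fun n => padd (u n) (v n)).
Proof.
move=> cu cv e e0; have [N hN] := cu _ (divr_gt0 e0 (ltr0n R 2)).
have [M hM] := cv _ (divr_gt0 e0 (ltr0n R 2)).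
exists (maxn N M) => m n; rewrite !geq_max => /andP[Nm Mm] /andP[Nn Mn].
have -> : pnrm (psub (padd (u m) (v m)) (padd (u n) (v n))) =
   pnrm (padd (psub (u m) (u n)) (psub (v m) (v n))).
  by apply: pnrm_ext => z; rewrite !(pformD, pform_subl); ring.
have := pnrmD (psub (u m) (u n)) (psub (v m) (v n)).
have := hN m n Nm Nn; have := hM m n Mm Mn; lra.
Qed.

Lemma pcauchyZ a u : pcauchy u -> pcauchy (fun n => pscale a (u n)).
Proof.
move=> cu e e0; have a0 : 0 < nrm a + 1 by rewrite ltr_wpDl// nrm_ge0.
have [N hN] := cu _ (divr_gt0 e0 a0).
exists N => m n Nm Nn.
have -> : pnrm (psub (pscale a (u m)) (pscale a (u n))) = pnrm (pscale a (psub (u m) (u n))).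
  by apply: pnrm_ext => z; rewrite !(pform_subl, pformZ); ring.
rewrite pnrmZ; have := hN m n Nm Nn; rewrite ltr_pdivlMr//.
have := pnrm_ge0 (psub (u m) (u n)); have := nrm_ge0 a; nra.
Qed.

Lemma pcauchy_cst x : pcauchy (fun=> x).
Proof.
move=> e e0; exists 0%N => m n _ _.
by rewrite /pnrm pform_subl !pform_subr !subrr cRe0 sqrtr0.
Qed.

End PreInner.

Section ComplexComplete.
Context {R : realType}.
Local Notation C := R[i].

Lemma real_cauchy (u : nat -> R) :
  (forall e : R, 0 < e -> exists N, forall m n, (N <= m)%N -> (N <= n)%N -> `|u m - u n| < e) ->
  exists l, forall e : R, 0 < e -> exists N, forall n, (N <= n)%N -> `|u n - l| < e.
Proof.
move=> uc.
suff /cvg_ex[l /cvgrPdist_lt ul] : cvg (u @ \oo).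
  exists l => e /ul[N _ hN]; exists N => n /hN; by rewrite distrC.
apply: cauchy_cvg; apply/cauchy_ballP => e e0.
have [N NP] := uc e e0.
exists ([set u n | n in [set n | (N <= n)%N]],
        [set u n | n in [set n | (N <= n)%N]]).
  by split; exists N => // n /= Nn; exists n.
by move=> [x y] /= [[m Nm <-] [n Nn <-]]; exact: NP.
Qed.

Lemma complex_cauchy (u : nat -> C) : cauchy_seq u -> exists l, tends u l.
Proof.
move=> uc.
have [a ha] : exists a, forall e : R, 0 < e -> exists N, forall n, (N <= n)%N ->
    `|complex.Re (u n) - a| < e.
  apply: real_cauchy => e /uc[N hN]; exists N => m n Nm Nn.
  by apply: le_lt_trans (hN m n Nm Nn); rewrite -cReN -cReD Re_le_nrm.
have [b hb] : exists b, forall e : R, 0 < e -> exists N, forall n, (N <= n)%N ->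
    `|complex.Im (u n) - b| < e.
  apply: real_cauchy => e /uc[N hN]; exists N => m n Nm Nn.
  by apply: le_lt_trans (hN m n Nm Nn); rewrite -cImN -cImD Im_le_nrm.
exists (Complex a b) => e e0.
have [N hN] := ha _ (divr_gt0 e0 (ltr0n R 2)).
have [M hM] := hb _ (divr_gt0 e0 (ltr0n R 2)).
exists (maxn N M) => n; rewrite geq_max => /andP[/hN h1 /hM h2].
apply: (le_lt_trans (nrm_le_ReIm _)); rewrite cReD cImD cReN cImN /=; lra.
Qed.

Lemma seq_complete_cvg (V : normedModType C) (F : set_system V) :
  (forall u : nat -> V, cauchy_seq u -> exists l, tends u l) ->
  ProperFilter F -> cauchy F -> cvg F.
Proof.
move=> sc FF /cauchyP Fc.
have /choice[w hw] : forall n, exists x : V, F (ball x (n.+1%:R^-1)%:C).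
  by move=> n; apply: Fc; rewrite ltcR invr_gt0 ltr0n.
have meet m n : nrm (w m - w n) < m.+1%:R^-1 + n.+1%:R^-1.
  have [x [xm xn]] := filter_ex (filterI (hw m) (hw n)).
  move: xm xn; rewrite -!ball_normE /ball_ /= !nrmE !ltcR => xm xn.
  by rewrite nrmBC in xn; apply: (le_lt_trans (nrm_tri x (w m) (w n))); exact: ltrD.
have [l wl] : exists l, tends w l.
  apply: sc => e e0.
  have [N hN] := invn_lt (divr_gt0 e0 (ltr0n R 2)).
  exists N => m n /hN h1 /hN h2; apply: (lt_trans (meet m n)).
  by rewrite [e](splitr e) ltrD.
apply/cvg_ex; exists l; apply/cvgrPdist_lt => e e0.
have Ie : complex.Im e = 0 by exact: ger0_Im (ltW e0).
have eE : e = (complex.Re e)%:C by apply: complex_eq.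
have r0 : 0 < complex.Re e by rewrite -ltcR -eE.
have [N hN] := wl _ (divr_gt0 r0 (ltr0n R 2)).
have [M hM] := invn_lt (divr_gt0 r0 (ltr0n R 2)).
apply: filterS (hw (maxn N M)) => x; rewrite -ball_normE /ball_ /= !nrmE eE !ltcR.
move=> h; apply: (@nrm_lt2 _ _ (w (maxn N M))).
  by rewrite nrmBC; apply: hN; exact: leq_maxl.
by apply: (lt_trans h); apply: hM; exact: leq_maxr.
Qed.

End ComplexComplete.

(** The completion consists of the functionals [y |-> lim (u n, y)] for Cauchy
    sequences [u], so that no quotient has to be taken. *)
Section CompletionType.
Context {R : realType} (P : preinner R).
Local Notation C := R[i].

Definition represents (u : nat -> P) (f : P -> C^o) :=
  pcauchy u /\ forall y, tends (fun n => pform (u n) y : C) (f y).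

Definition crep : {pred (P -> C^o)} := fun f => `[< exists u, represents u f >].

Lemma representsD u v f g : represents u f -> represents v g ->
  represents (fun n => padd (u n) (v n)) (f + g).
Proof.
move=> [cu uf] [cv vg]; split=> [|y]; first exact: pcauchyD.
under eq_fun do rewrite pformD; exact: (@tendsD _ C _ _ _ _ (uf y) (vg y)).
Qed.

Lemma representsZ a u f : represents u f ->
  represents (fun n => pscale a (u n)) (a *: f).
Proof.
move=> [cu uf]; split=> [|y]; first exact: pcauchyZ.
under eq_fun do rewrite pformZ; exact: tendsZl.
Qed.

Lemma represents_pform x : represents (fun=> x) (pform x).
Proof. by split=> [|y]; [exact: pcauchy_cst|exact: tends_cst]. Qed.

Fact crep_submod : submod_closed crep.
Proof.
split=> [|a f g /asboolP[u uf] /asboolP[v vg]].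
  apply/asboolP; exists (fun=> pscale 0 ppoint); split=> [|y]; first exact: pcauchy_cst.
  by under eq_fun do rewrite pformZ mul0r; exact: (@tends_cst _ C).
apply/asboolP; exists (fun n => padd (pscale a (u n)) (v n)).
by apply: representsD => //; exact: representsZ.
Qed.

HB.instance Definition _ := GRing.isSubmodClosed.Build C (P -> C^o) crep crep_submod.

Record completion := Completion { cfun :> P -> C^o; cfunP : cfun \in crep }.

HB.instance Definition _ := [isSub for cfun].
HB.instance Definition _ := [Choice of completion by <:].
HB.instance Definition _ := [SubChoice_isSubLmodule of completion by <:].

Implicit Types f g h : completion.

Lemma cfun_inj f g : (forall y, f y = g y) -> f = g.
Proof. by move=> fg; apply: val_inj; apply/funext. Qed.

Lemma cfunD f g y : (f + g) y = f y + g y.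
Proof. by []. Qed.

Lemma cfunZ a f y : (a *: f) y = a * f y.
Proof. by []. Qed.

Lemma rep_exists f : exists u, represents u f.
Proof. by have /asboolP := cfunP f. Qed.

Definition cinner f g : C := xget 0 [set l | exists u v,
  [/\ represents u f, represents v g & tends (fun n => pform (u n) (v n)) l]].

(* Two sequences representing the same functional differ by a Cauchy sequence
   that is weakly null, hence null. *)
Lemma represents_diff u u' (f : P -> C^o) : represents u f -> represents u' f ->
  forall e : R, 0 < e -> exists N, forall n, (N <= n)%N -> pnrm (psub (u n) (u' n)) < e.
Proof.
move=> [cu uf] [cu' u'f] e e0.
pose w n := psub (u n) (u' n).
have cw : pcauchy w by apply: pcauchyD => //; exact: pcauchyZ.
have wy y : tends (fun n => pform (w n) y : C) 0.
  have := @tendsD _ C _ _ _ _ (uf y) (@tendsN _ C _ _ (u'f y)); rewrite subrr.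
  by congr tends; apply/funext => n; rewrite pform_subl.
have [K K0 hK] := pcauchy_bounded cw.
have e2 : 0 < e ^+ 2 / 2 by rewrite divr_gt0// exprn_gt0.
have [N hN] := cw _ (divr_gt0 e2 K0).
have [M hM] := wy (w N) _ e2.
exists (maxn N M) => n; rewrite geq_max => /andP[Nn Mn].
rewrite -ltr_sqr ?nnegrE ?pnrm_ge0// ?(ltW e0)// pnrm_sqr -/(w n).
have -> : pform (w n) (w n) = pform (w n) (w N) + pform (w n) (psub (w n) (w N)).
  by rewrite pform_subr addrC subrK.
have h1 := hM n Mn; rewrite subr0 in h1.
have h2 := pform_cs (w n) (psub (w n) (w N)).
have h3 := hN n N Nn (leqnn N); rewrite ltr_pdivlMr// in h3.
have h4 := ler_wpM2r (pnrm_ge0 (psub (w n) (w N))) (hK n).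
have := Re_le_nrm (pform (w n) (w N) + pform (w n) (psub (w n) (w N))).
have := ler_norm (complex.Re (pform (w n) (w N) + pform (w n) (psub (w n) (w N)))).
have := nrmD (pform (w n) (w N)) (pform (w n) (psub (w n) (w N))).
lra.
Qed.

Lemma cinner_tends u v f g : represents u f -> represents v g ->
  tends (fun n => pform (u n) (v n)) (cinner f g).
Proof.
move=> uf vg; rewrite /cinner; case: xgetP => [l _ [u' [v' [u'f v'g ul]]]|no].
  apply: (@tends_approx _ C) => e e0; move: ul => ul.
  have [K K0 hK] := pcauchy_bounded uf.1; have [L L0 hL] := pcauchy_bounded v'g.1.
  have e2 := divr_gt0 e0 (ltr0n R 2).
  have [N hN] := represents_diff uf u'f (divr_gt0 e2 L0).
  have [M hM] := represents_diff vg v'g (divr_gt0 e2 K0).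
  exists (fun n => if (maxn N M <= n)%N then pform (u' n) (v' n) else pform (u n) (v n)).
    move=> e' /ul[N' hN']; exists (maxn (maxn N M) N') => n; rewrite geq_max => /andP[h /hN'].
    by rewrite h.
  move=> n; case: ifP => [|_]; last by rewrite subrr nrm0 ltW.
  rewrite geq_max => /andP[/hN h1 /hM h2].
  have -> : pform (u n) (v n) - pform (u' n) (v' n) =
      pform (psub (u n) (u' n)) (v' n) + pform (u n) (psub (v n) (v' n)).
    by rewrite pform_subl pform_subr; ring.
  rewrite ltr_pdivlMr// in h1; rewrite ltr_pdivlMr// in h2.
  apply: (le_trans (nrmD _ _)).
  have := pform_cs (psub (u n) (u' n)) (v' n).
  have := pform_cs (u n) (psub (v n) (v' n)).
  have := ler_wpM2l (pnrm_ge0 (psub (u n) (u' n))) (hL n).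
  have := ler_wpM2r (pnrm_ge0 (psub (v n) (v' n))) (hK n); lra.
have [l ul] := complex_cauchy (pcauchy_form uf.1 vg.1).
by case: (no l); exists u, v.
Qed.

Lemma cinner_uniq u v f g l : represents u f -> represents v g ->
  tends (fun n => pform (u n) (v n)) l -> cinner f g = l.
Proof. by move=> uf vg ul; apply: tends_uniq ul; exact: cinner_tends. Qed.

Lemma cinnerD f g h : cinner (f + g) h = cinner f h + cinner g h.
Proof.
have [u uf] := rep_exists f; have [v vg] := rep_exists g; have [w wh] := rep_exists h.
apply: (@cinner_uniq (fun n => padd (u n) (v n)) w) => //.
  by have := representsD uf vg; congr represents; apply/funext => y; rewrite -cfunD.
under eq_fun do rewrite pformD.
by apply: tendsD; exact: cinner_tends.
Qed.

Lemma cinnerZ a f h : cinner (a *: f) h = a * cinner f h.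
Proof.
have [u uf] := rep_exists f; have [w wh] := rep_exists h.
apply: (@cinner_uniq (fun n => pscale a (u n)) w) => //.
  by have := representsZ a uf; congr represents; apply/funext => y; rewrite -cfunZ.
under eq_fun do rewrite pformZ.
by apply: tendsZl; exact: cinner_tends.
Qed.

Lemma tendsJ (u : nat -> C) l : tends u l -> tends (fun n => Num.conj (u n)) (Num.conj l).
Proof.
move=> ul e /ul[N hN]; exists N => n /hN.
by rewrite -[_ - Num.conj l](rmorphB (@Num.conj C)) nrmJ.
Qed.

Lemma cinnerC f g : cinner f g = Num.conj (cinner g f).
Proof.
have [u uf] := rep_exists f; have [v vg] := rep_exists g.
apply: (@cinner_uniq u v) => //; under eq_fun do rewrite pformC.
by apply: tendsJ; exact: cinner_tends.
Qed.

Lemma cinner_ge0 f : 0 <= complex.Re (cinner f f).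
Proof.
have [u uf] := rep_exists f.
by apply: (tends_Re_ge0 (cinner_tends uf uf)) => n; exact: pform_ge0.
Qed.

(* The completion as a semi-inner product space, to reuse the inequalities. *)
Definition cpre : preinner R := Preinner (0 : completion) cinnerD cinnerZ cinnerC cinner_ge0.

Lemma cinner_eq0 f : cinner f f = 0 -> f = 0.
Proof.
move=> f0; have [u uf] := rep_exists f; have uu := cinner_tends uf uf.
rewrite f0 in uu; apply: cfun_inj => y.
have -> : (0 : completion) y = 0 by rewrite -[0](scale0r 0) cfunZ mul0r.
apply: (tends_uniq (uf.2 y)) => e e0.
have y0 : 0 < pnrm y + 1 by rewrite ltr_wpDl// pnrm_ge0.
have [N hN] := uu _ (exprn_gt0 2 (divr_gt0 e0 y0)).
exists N => n /hN; rewrite !subr0 pform_self nrmC ger0_norm ?exprn_ge0 ?pnrm_ge0//.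
rewrite ltr_sqr ?nnegrE ?pnrm_ge0 ?divr_ge0 ?(ltW e0) ?(ltW y0)//.
rewrite ltr_pdivlMr// => h; have := pform_cs (u n) y; have := pnrm_ge0 (u n); lra.
Qed.

Definition cnorm f : C := (@pnrm _ cpre f)%:C.

Lemma cnormD f g : cnorm (f + g) <= cnorm f + cnorm g.
Proof. by rewrite /cnorm -rmorphD lecR; exact: (@pnrmD _ cpre). Qed.

Lemma cnormZ (a : C) f : cnorm (a *: f) = `|a| * cnorm f.
Proof. by rewrite /cnorm nrmE -rmorphM; congr (_%:C); exact: (@pnrmZ _ cpre). Qed.

Lemma cnorm_eq0 f : cnorm f = 0 -> f = 0.
Proof.
move=> [f0]; apply: cinner_eq0.
by rewrite -[cinner f f]/(@pform _ cpre f f) pform_self f0 expr0n.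
Qed.

HB.instance Definition _ := Lmodule_isNormed.Build C completion cnormD cnormZ cnorm_eq0.

Lemma nrm_completion f : nrm f = @pnrm _ cpre f.
Proof. by []. Qed.

Definition embed (x : P) : completion :=
  @Completion (pform x) (asboolT (ex_intro _ (fun=> x) (represents_pform x))).

Lemma cinner_embed x y : cinner (embed x) (embed y) = pform x y.
Proof.
apply: (@cinner_uniq (fun=> x) (fun=> y)); [exact: represents_pform| |].
  exact: represents_pform.
exact: tends_cst.
Qed.

Lemma embed_dist x y : nrm (embed x - embed y) = pnrm (psub x y).
Proof.
have -> : embed x - embed y = embed (psub x y).
  apply: cfun_inj => z; rewrite cfunD -scaleN1r cfunZ /=.
  by rewrite pform_subl mulN1r.
by rewrite nrm_completion /pnrm /= cinner_embed.
Qed.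

Lemma represents_tends u f : represents u f -> tends (fun n => embed (u n)) f.
Proof.
move=> uf e e0; have [N hN] := uf.1 _ (divr_gt0 e0 (ltr0n R 2)).
exists N => n Nn.
suff : nrm (embed (u n) - f) <= e / 2 by lra.
have urep : represents (fun m => psub (u n) (u m)) (embed (u n) - f).
  split=> [|y].
    by apply: pcauchyD; [exact: pcauchy_cst|apply: pcauchyZ; exact: uf.1].
  rewrite cfunD -scaleN1r cfunZ mulN1r /=; under eq_fun do rewrite pform_subl.
  by apply: tendsD; [exact: tends_cst|apply: tendsN; exact: uf.2].
rewrite -ler_sqr ?nnegrE ?nrm_ge0 ?divr_ge0 ?(ltW e0)//.
rewrite nrm_completion pnrm_sqr /=.
apply: le_eps => d d0; have [M hM] := cinner_tends urep urep d0.
have := hM (maxn N M) (leq_maxr _ _); set X := cinner _ _.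
have := hN n (maxn N M) Nn (leq_maxl _ _); rewrite pform_self => h1 h2.
have := Re_le_nrm ((pnrm (psub (u n) (u (maxn N M))) ^+ 2)%:C - X).
rewrite cReD cReN cReC ler_norml => /andP[_ h3].
have h4 : pnrm (psub (u n) (u (maxn N M))) ^+ 2 <= (e / 2) ^+ 2.
  by rewrite ler_sqr ?nnegrE ?pnrm_ge0 ?divr_ge0 ?(ltW e0) ?(ltW h1).
have := Re_le_nrm (X - (pnrm (psub (u n) (u (maxn N M))) ^+ 2)%:C).
rewrite nrmBC cReD cReN cReC ler_norml => /andP[_ h5]; lra.
Qed.

Lemma embed_dense f (e : R) : 0 < e -> exists x, nrm (f - embed x) < e.
Proof.
move=> e0; have [u uf] := rep_exists f; have [N hN] := represents_tends uf e0.
by exists (u N); rewrite nrmBC; exact: hN.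
Qed.

Lemma completion_seq_complete (w : nat -> completion) :
  cauchy_seq w -> exists l, tends w l.
Proof.
move=> cw.
have /choice[d hd] : forall n, exists x, nrm (w n - embed x) < n.+1%:R^-1.
  by move=> n; apply: embed_dense; rewrite invr_gt0 ltr0n.
have cd : pcauchy d.
  move=> e e0; have e3 : 0 < e / 3 by rewrite divr_gt0.
  have [N hN] := cw _ e3; have [M hM] := invn_lt e3.
  exists (maxn N M) => m n; rewrite !geq_max => /andP[Nm Mm] /andP[Nn Mn].
  rewrite -embed_dist.
  apply: (@nrm_lt3 _ _ (w m) (w n)); [|exact: hN|exact: lt_trans (hd n) (hM n Mn)].
  rewrite nrmBC; exact: lt_trans (hd m) (hM m Mm).
have /choice[F hF] : forall y, exists l, tends (fun n => pform (d n) y) l.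
  move=> y; apply: complex_cauchy; apply: pcauchy_form => //; exact: pcauchy_cst.
have drep : represents d (F : P -> C^o) by split.
pose f := @Completion F (asboolT (ex_intro _ d drep)).
have df : tends (fun n => embed (d n)) f by exact: (@represents_tends d f).
exists f => e e0; have e2 := divr_gt0 e0 (ltr0n R 2).
have [N hN] := df _ e2; have [M hM] := invn_lt e2.
exists (maxn N M) => n; rewrite geq_max => /andP[/hN h1 /hM h2].
by apply: (@nrm_lt2 _ _ (embed (d n))) => //; exact: lt_trans (hd n) h2.
Qed.

Lemma completion_complete (F : set_system completion) :
  ProperFilter F -> cauchy F -> cvg F.
Proof. by apply: seq_complete_cvg; exact: completion_seq_complete. Qed.

HB.instance Definition _ := Uniform_isComplete.Build completion completion_complete.

Lemma cinner_linearl (a : C) f g h : cinner (a *: f + g) h = a * cinner f h + cinner g h.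
Proof. by rewrite cinnerD cinnerZ. Qed.

Lemma cinner_norm f : cinner f f = `|f| ^+ 2.
Proof.
rewrite nrmE -rmorphXn nrm_completion pnrm_sqr /=.
by rewrite -[cinner f f]/(@pform _ cpre f f) pform_self pnrm_sqr.
Qed.

HB.instance Definition _ := CompleteNormedModule_isHilbert.Build R completion
  cinner_linearl cinnerC cinner_norm.

End CompletionType.

Lemma hilbert_completion (R : realType) (P : preinner R) :
  exists (K : hilbertType R) (iota : P -> K),
    (forall x y, [< iota x, iota y >] = pform x y) /\
    (forall k (e : R), 0 < e -> exists x, nrm (k - iota x) < e).
Proof.
exists (completion P : hilbertType R), (@embed R P); split.
  exact: cinner_embed.
exact: embed_dense.
Qed.

(** * Symmetric and selfadjoint relations *)

Section Relations.
Context {R : realType} {H : hilbertType R}.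
Local Notation C := R[i].
Implicit Types (T S : set (H * H)) (l : C) (f g : H * H).

Definition symmetric_relation T := T `<=` adjoint_relation T.

Definition closed_relation T := forall (u v : nat -> H) a b,
  (forall n, T (u n, v n)) -> tends u a -> tends v b -> T (a, b).

Lemma pair_surjE f : f = (f.1, f.2). Proof. by case: f. Qed.

Lemma tends_inner (u : nat -> H) a x : tends u a -> tends (fun n => [< u n, x >]) [< a, x >].
Proof.
move=> ua e e0; have x0 : 0 < nrm x + 1 by rewrite ltr_wpDl// nrm_ge0.
have [N hN] := ua _ (divr_gt0 e0 x0); exists N => n /hN; rewrite ltr_pdivlMr// => h.
rewrite -innerBl; apply: (le_lt_trans (cauchy_schwarz _ _)).
by apply: le_lt_trans h; rewrite ler_wpM2l ?nrm_ge0// lerDl.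
Qed.

Lemma tends_scale (c : C) (u : nat -> H) a :
  tends u a -> tends (fun n => c *: u n) (c *: a).
Proof.
move=> ua e e0; have c0 : 0 < nrm c + 1 by rewrite ltr_wpDl ?nrm_ge0.
have [N hN] := ua _ (divr_gt0 e0 c0); exists N => n /hN h.
rewrite -scalerBr nrmZ; move: h; rewrite ltr_pdivlMr// => h.
have := nrm_ge0 (u n - a); have := nrm_ge0 c; nra.
Qed.

Lemma adjoint_linear T : linear_subspace (adjoint_relation T).
Proof.
split=> [g _|a f f' hf hf' g Tg] /=; first by rewrite !inner0l.
by rewrite !innerE hf// hf'.
Qed.

Lemma adjoint_closed T : closed_relation (adjoint_relation T).
Proof.
move=> u v a b huv ua vb g Tg /=.
apply: (tends_uniq (tends_inner g.1 vb)).
suff -> : (fun n => [< v n, g.1 >]) = (fun n => [< u n, g.2 >]) by exact: tends_inner.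
by apply/funext => n; exact: huv.
Qed.

(** [Im <f2, f1>] vanishes, so the imaginary part of [<f2 - l * f1, f1>] is
    [- Im l * |f1| ^ 2]. *)
Lemma symmetric_bound T l f : symmetric_relation T -> T f ->
  `|complex.Im l| * nrm f.1 <= nrm (f.2 - l *: f.1).
Proof.
move=> symT Tf; have h := symT _ Tf _ Tf.
have [->|f0] := eqVneq f.1 0; first by rewrite nrm0 mulr0 nrm_ge0.
have f0' : 0 < nrm f.1 by rewrite nrm_gt0.
have e : complex.Im [< f.2 - l *: f.1, f.1 >] = - complex.Im l * nrm f.1 ^+ 2.
  have i0 : complex.Im [< f.2, f.1 >] = 0.
    have := congr1 (@complex.Im R) h; rewrite [in X in _ = X]innerC cImJ; lra.
  by rewrite !innerE inner_sqr cImD cImN cImM cReC cImC i0; ring.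
have := Im_le_nrm [< f.2 - l *: f.1, f.1 >].
rewrite e normrM normrN ger0_norm ?exprn_ge0 ?nrm_ge0// => h1.
have := le_trans h1 (cauchy_schwarz _ _).
by rewrite expr2 mulrA ler_pM2r.
Qed.

Lemma symmetric_eigen T l f : symmetric_relation T -> complex.Im l != 0 -> T f ->
  f.2 = l *: f.1 -> f.1 = 0.
Proof.
move=> symT l0 Tf fE; have := symmetric_bound l symT Tf.
rewrite fE subrr nrm0 => h; apply/eqP; rewrite -nrm_eq0 eq_le nrm_ge0 andbT.
by rewrite -(@ler_pM2l _ `|complex.Im l|) ?normr_gt0// mulr0.
Qed.

Lemma relationB T f g : linear_subspace T -> T f -> T g -> T (f.1 - g.1, f.2 - g.2).
Proof.
move=> [_ lT] Tf Tg; have := lT (-1) _ _ Tg Tf.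
rewrite [-1 *: g + f]pair_surjE /=.
by rewrite !scaleN1r [- g.1 + _]addrC [- g.2 + _]addrC.
Qed.

(** The range of [T - l] is closed because [T - l] is bounded below; it is then
    determined by its orthogonal complement. *)
Lemma range_double_orthogonal T l (c : R) (x : H) : linear_subspace T -> closed_relation T ->
  (forall f, T f -> nrm f.1 <= c * nrm (f.2 - l *: f.1)) ->
  (forall y, (forall f, T f -> [< f.2 - l *: f.1, y >] = 0) -> [< x, y >] = 0) ->
  exists v, T (v, x + l *: v).
Proof.
move=> linT clT bT orth; have [T0 lT] := linT.
pose S := [set y | exists2 f, T f & y = f.2 - l *: f.1].
have : S x.
  apply: double_orthogonal.
  - split; first by exists 0 => //; rewrite /= scaler0 subrr.
    move=> a _ _ [f Tf ->] [g Tg ->]; exists (a *: f + g); first exact: lT.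
    by rewrite /= scalerBr !scalerDr !scalerA [l * a]mulrC opprD addrACA.
  - move=> u y uS uy.
    have /choice[F hF] : forall n, exists f, T f /\ u n = f.2 - l *: f.1.
      by move=> n; have [f] := uS n; exists f.
    have cF : cauchy_seq (fun n => (F n).1).
      move=> e e0; have c0 : 0 < `|c| + 1 by rewrite ltr_wpDl.
      have [N hN] := tends_cauchy uy (divr_gt0 e0 c0); exists N => m n Nm Nn.
      have := hN m n Nm Nn; rewrite ltr_pdivlMr//; apply: le_lt_trans.
      have := bT _ (relationB linT (hF m).1 (hF n).1); rewrite /= (hF m).2 (hF n).2.
      have -> : (F m).2 - (F n).2 - l *: ((F m).1 - (F n).1) =
        (F m).2 - l *: (F m).1 - ((F n).2 - l *: (F n).1).
        by rewrite scalerBr !opprB addrACA [RHS]addrACA; congr (_ + _); rewrite addrC.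
      move=> /le_trans; apply; rewrite mulrC ler_wpM2l ?nrm_ge0//.
      by rewrite (le_trans (ler_norm c))// lerDl.
    have [a Fa] := cauchy_tends cF.
    exists (a, y + l *: a); last by rewrite /= addrK.
    apply: (clT (fun n => (F n).1) (fun n => (F n).2)) => //.
      by move=> n; rewrite -pair_surjE; exact: (hF n).1.
    have -> : (fun n => (F n).2) = (fun n => u n + l *: (F n).1).
      by apply/funext => n; rewrite (hF n).2 subrK.
    by apply: tendsD => //; exact: tends_scale.
  - by move=> y hy; apply: orth => f Tf; apply: hy; exists f.
by move=> [f Tf ->]; exists f.1; rewrite subrK -pair_surjE.
Qed.

Lemma selfadjoint_symmetric T : selfadjoint_relation T -> symmetric_relation T.
Proof. by move=> saT f Tf; rewrite saT. Qed.

Lemma selfadjoint_linear T : selfadjoint_relation T -> linear_subspace T.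
Proof. by move=> <-; exact: adjoint_linear. Qed.

Lemma selfadjoint_closed T : selfadjoint_relation T -> closed_relation T.
Proof. by move=> <-; exact: adjoint_closed. Qed.

Lemma Im_conj_neq0 l : complex.Im (Num.conj l) != 0 = (complex.Im l != 0).
Proof. by rewrite cImJ oppr_eq0. Qed.

Lemma symmetric_resolvent_bound T l f : symmetric_relation T -> complex.Im l != 0 -> T f ->
  nrm f.1 <= `|complex.Im l|^-1 * nrm (f.2 - l *: f.1).
Proof.
move=> symT l0 Tf; rewrite ler_pdivlMl ?normr_gt0//; exact: symmetric_bound Tf.
Qed.

(** A vector orthogonal to the range of [T - l] is an eigenvector of [T] at the
    conjugate of [l], hence zero. *)
Lemma selfadjoint_range T l (x : H) : selfadjoint_relation T -> complex.Im l != 0 ->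
  exists v, T (v, x + l *: v).
Proof.
move=> saT l0; have symT := selfadjoint_symmetric saT.
apply: (range_double_orthogonal (selfadjoint_linear saT) (selfadjoint_closed saT)).
  by move=> f Tf; exact: symmetric_resolvent_bound Tf.
move=> y hy; suff -> : y = 0 by rewrite inner0r.
have Ty : T (y, Num.conj l *: y).
  rewrite -saT => g Tg /=.
  have := hy _ Tg; rewrite !innerE => /eqP; rewrite subr_eq0 => /eqP h.
  by rewrite [in RHS]innerC h conjM -innerC.
apply: (@symmetric_eigen T (Num.conj l) _ symT _ Ty) => //; by rewrite Im_conj_neq0.
Qed.

Lemma resolventP T l (x v : H) : resolvent_relation T l (x, v) <-> T (v, x + l *: v).
Proof.
split=> [[g [h [/= Tg]]]|Tv].
  by rewrite /graph /= => -> ->; rewrite subrK.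
by exists (x + l *: v), (- (l *: v)); split; rewrite //= addrK.
Qed.

Lemma resolventE T l (x v : H) : linear_subspace T -> symmetric_relation T ->
  complex.Im l != 0 -> T (v, x + l *: v) -> resolvent T l x = v.
Proof.
move=> linT symT l0 Tv; rewrite /resolvent /relation_operator.
case: xgetP => [w _ /= /resolventP Tw|/(_ v) []]; last exact/resolventP.
have Td := relationB linT Tw Tv.
apply/eqP; rewrite -subr_eq0; apply/eqP.
apply: (symmetric_eigen symT l0 Td) => /=.
by rewrite opprD addrACA subrr add0r scalerBr.
Qed.

Lemma selfadjoint_resolvent T l (x : H) : selfadjoint_relation T -> complex.Im l != 0 ->
  T (resolvent T l x, x + l *: resolvent T l x).
Proof.
move=> saT l0; have [v Tv] := selfadjoint_range x saT l0.
by rewrite (resolventE (selfadjoint_linear saT) (selfadjoint_symmetric saT) l0 Tv).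
Qed.

Lemma resolvent_bound T l (x : H) : selfadjoint_relation T -> complex.Im l != 0 ->
  nrm (resolvent T l x) <= `|complex.Im l|^-1 * nrm x.
Proof.
move=> saT l0; have := selfadjoint_resolvent x saT l0 => Tr.
by have := symmetric_resolvent_bound (selfadjoint_symmetric saT) l0 Tr; rewrite /= addrK.
Qed.

Lemma linear_continuous_bounded {U V : hilbertType R} (T : U -> V) (c : R) :
  linear T -> (forall x, nrm (T x) <= c * nrm x) -> bounded_operator T.
Proof.
move=> linT bT; split=> // x; apply/cvgrPdist_lt => e e0.
have Ie : complex.Im e = 0 by exact: ger0_Im (ltW e0).
have eE : e = (complex.Re e)%:C by apply: complex_eq.
have r0 : 0 < complex.Re e by rewrite -ltcR -eE.
have c0 : 0 < `|c| + 1 by rewrite ltr_wpDl.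
apply/nbhs_ballP; exists (complex.Re e / (`|c| + 1))%:C; first by rewrite /= ltcR divr_gt0.
move=> y; rewrite -ball_normE /ball_ /= !nrmE eE !ltcR ltr_pdivlMr// => h.
have -> : T x - T y = T (x - y).
  by have := linT (-1) y x; rewrite !scaleN1r [x - y]addrC => ->; rewrite addrC.
apply: (le_lt_trans (bT _)); apply: le_lt_trans h.
by rewrite mulrC ler_wpM2l ?nrm_ge0// (le_trans (ler_norm c))// lerDl.
Qed.

Lemma selfadjoint_resolvent_set T l : selfadjoint_relation T -> complex.Im l != 0 ->
  resolvent_set T l.
Proof.
move=> saT l0; have linT := selfadjoint_linear saT; have symT := selfadjoint_symmetric saT.
exists (resolvent T l).
  apply: (@linear_continuous_bounded _ _ _ (`|complex.Im l|^-1)); last first.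
    by move=> x; exact: resolvent_bound.
  move=> a x y; apply: resolventE => //.
  have := linT.2 a _ _ (selfadjoint_resolvent x saT l0) (selfadjoint_resolvent y saT l0).
  congr (T (_, _)); rewrite /= !scalerDr !scalerA [a * l]mulrC.
  by rewrite addrACA.
apply/seteqP; split=> [[x v] /resolventP Tv|[x v]]; rewrite /graph /=; last move=> ->.
  by apply/esym; exact: resolventE.
by apply/resolventP; exact: selfadjoint_resolvent.
Qed.

(** The second adjoint of [S] is closed and symmetric with full range at both
    points.  An element of the adjoint differs from one of the second adjoint by an
    eigenvector at [l], which is orthogonal to the range at the conjugate point. *)
Lemma essentially_selfadjoint S (l : C) : symmetric_relation S -> complex.Im l != 0 ->
  (forall x, (forall f, S f -> [< x, f.2 - l *: f.1 >] = 0) -> x = 0) ->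
  (forall x, (forall f, S f -> [< x, f.2 - Num.conj l *: f.1 >] = 0) -> x = 0) ->
  selfadjoint_relation (adjoint_relation S).
Proof.
move=> symS l0 tot1 tot2.
set A := adjoint_relation S; set T := adjoint_relation A.
have ST : S `<=` T.
  by move=> f Sf g Ag; rewrite [LHS]innerC -(Ag f Sf) -innerC.
have TA : T `<=` A by move=> f Tf g Sg; apply: Tf; exact: symS.
have symT : symmetric_relation T by move=> f Tf g Tg; apply: Tf; exact: TA.
rewrite /selfadjoint_relation -/T; apply/seteqP; split=> // f Af.
have [v Tv] : exists v, T (v, f.2 - l *: f.1 + l *: v).
  apply: (range_double_orthogonal (adjoint_linear A) (@adjoint_closed A)).
    by move=> g Tg; exact: (symmetric_resolvent_bound symT l0 Tg).
  move=> y hy; suff -> : y = 0 by rewrite inner0r.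
  by apply: tot1 => g Sg; rewrite innerC hy ?conj0//; exact: ST.
have Ad := relationB (adjoint_linear S) Af (TA _ Tv).
suff v1 : f.1 - v = 0.
  have -> : f = (v, f.2 - l *: f.1 + l *: v); last exact: Tv.
  move/eqP: v1; rewrite subr_eq0 => /eqP v1.
  by rewrite [LHS]pair_surjE v1 subrK.
apply: tot2 => g Sg; have /= := Ad g Sg.
have -> : f.2 - (f.2 - l *: f.1 + l *: v) = l *: (f.1 - v).
  by rewrite scalerBr opprD opprB !addrA [f.2 + _]addrC addrK.
move=> h.
by rewrite innerBr -h innerZl innerZr conjCK subrr.
Qed.

End Relations.

(** * Selfadjoint operators from generalized resolvents *)

Section InnerSums.
Context {R : realType} {H : hilbertType R}.

Lemma inner_suml (I : Type) (s : seq I) (F : I -> H) x :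
  [< \sum_(i <- s) F i, x >] = \sum_(i <- s) [< F i, x >].
Proof. by apply: (big_morph (fun y => [< y, x >])); [move=> *; exact: innerDl|exact: inner0l]. Qed.

Lemma inner_sumr (I : Type) (s : seq I) (F : I -> H) x :
  [< x, \sum_(i <- s) F i >] = \sum_(i <- s) [< x, F i >].
Proof. by apply: (big_morph (fun y => [< x, y >])); [move=> *; exact: innerDr|exact: inner0r]. Qed.

End InnerSums.

Section Realization.
Context {R : realType} {H : hilbertType R}.
Local Notation C := R[i].

(** The properties of a compressed resolvent that determine a selfadjoint
    operator; the last one forbids a multivalued part. *)
Record generalized_resolvent (Rz : C -> H -> H) : Prop := GeneralizedResolvent {
  gr_linear : forall l (a : C) x y, complex.Im l != 0 ->
    Rz l (a *: x + y) = a *: Rz l x + Rz l y;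
  gr_adjoint : forall l x y, complex.Im l != 0 ->
    [< Rz l x, y >] = [< x, Rz (Num.conj l) y >];
  gr_Im_ge0 : forall l x, 0 < complex.Im l -> 0 <= complex.Im [< Rz l x, x >];
  gr_cdiff : forall l x y, complex.Im l != 0 -> cdiff (fun z => [< Rz z x, y >]) l;
  gr_limit : forall x (e : R), 0 < e -> exists Y : R, forall y, Y <= y ->
    nrm (x + ('i * y%:C) *: Rz ('i * y%:C) x) <= e
}.

Context (Rz : C -> H -> H) (grz : generalized_resolvent Rz).

Let f x y z := [< Rz z x, y >].

Let fZl c x y z : complex.Im z != 0 -> f (c *: x) y z = c * f x y z.
Proof.
move=> z0; have lR : linear (Rz z) by move=> a u v; exact: (gr_linear grz).
by rewrite /f (linZ _ _ lR) innerZl.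
Qed.

Let der x y z : C := xget 0 [set D | cderiv (f x y) z D].

Let derP x y z : complex.Im z != 0 -> cderiv (f x y) z (der x y z).
Proof.
move=> z0; rewrite /der; case: xgetP => [D _ //|no].
by have [D hD] := gr_cdiff grz x y z0; case: (no D).
Qed.

(* Half of the kernel of the form: Pick's matrix only sees [Rz] on the upper
   half-plane, and symmetrization adds the lower one. *)
Let L (a b : C * H) : C :=
  pick_term (f a.2 b.2) (der a.2 b.2 a.1) a.1 b.1.

Let near_nonreal (z : C) : complex.Im z != 0 -> near_point z (fun w => complex.Im w != 0).
Proof.
move=> z0; exists `|complex.Im z|; first by rewrite normr_gt0.
move=> w; apply: contraTneq => w0; rewrite -leNgt -normrN.
by have := Im_le_nrm (w - z); rewrite cImD cImN w0 add0r.
Qed.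

Let derZl c x y z : complex.Im z != 0 -> der (c *: x) y z = c * der x y z.
Proof.
move=> z0; apply: (cderiv_uniq (derP _ _ z0)).
have /cderivP h := cderivZ c (derP x y z0).
apply/cderivP => e /h h1.
apply: near_pointW (near_pointI (near_nonreal z0) h1) => w [w0].
by rewrite !fZl.
Qed.

Let derZr c x y z : complex.Im z != 0 -> der x (c *: y) z = Num.conj c * der x y z.
Proof.
move=> z0; apply: (cderiv_uniq (derP _ _ z0)).
have -> : f x (c *: y) = fun z => Num.conj c * f x y z.
  by apply/funext => w; rewrite /f innerZr.
exact: cderivZ (derP x y z0).
Qed.

Let LZl c (a b : C * H) : complex.Im a.1 != 0 -> complex.Im b.1 != 0 ->
  L (a.1, c *: a.2) b = c * L a b.
Proof.
move=> a0 b0; rewrite /L /pick_term /= derZl//.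
rewrite !fZl ?Im_conj_neq0//.
by do 3!case: ifP => _ //; ring.
Qed.

Let LZr c (a b : C * H) : complex.Im a.1 != 0 ->
  L a (b.1, c *: b.2) = Num.conj c * L a b.
Proof.
move=> a0; rewrite /L /pick_term /= derZr// /f !innerZr.
by do 3!case: ifP => _ //; ring.
Qed.

Definition nonreal := {l : C | complex.Im l != 0}.
(** Formal sums of vectors [e(l, h)], before completion. *)
Definition gvec := seq (nonreal * H).
Let pr (a : nonreal * H) : C * H := (val a.1, a.2).

Let Kf (a b : C * H) : C := L a b + Num.conj (L b a).

Let form (s t : gvec) : C := \sum_(a <- s) \sum_(b <- t) Kf (pr a) (pr b).

Let formD (x y z : gvec) : form (x ++ y) z = form x z + form y z.
Proof. by rewrite /form big_cat. Qed.

Let scal (c : C) (s : gvec) : gvec := [seq (a.1, c *: a.2) | a <- s].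

Let formZ c (x z : gvec) : form (scal c x) z = c * form x z.
Proof.
rewrite /form big_map big_distrr; apply: eq_bigr => a _ /=.
rewrite big_distrr; apply: eq_bigr => b _ /=.
have a0 := valP a.1; have b0 := valP b.1.
rewrite /Kf -[pr (a.1, _)]/((pr a).1, c *: (pr a).2) LZl// LZr//.
rewrite conjM conjCK; ring.
Qed.

Let formC (x y : gvec) : form x y = Num.conj (form y x).
Proof.
have csum (T : Type) (s : seq T) (F : T -> C) :
    Num.conj (\sum_(i <- s) F i) = \sum_(i <- s) Num.conj (F i).
  by apply: (big_morph (@Num.conj C)); [exact: conjD|exact: conj0].
rewrite /form csum exchange_big; apply: eq_bigr => b _ /=.
rewrite csum; apply: eq_bigr => a _ /=.
by rewrite /Kf conjD conjCK addrC.
Qed.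

Let Re_sum (T : Type) (s : seq T) (F : T -> C) :
  complex.Re (\sum_(i <- s) F i) = \sum_(i <- s) complex.Re (F i).
Proof. by apply: (big_morph (@complex.Re R)); [exact: cReD|]. Qed.

Let form_ge0 (x : gvec) : 0 <= complex.Re (form x x).
Proof.
have -> : complex.Re (form x x) =
    2 * complex.Re (\sum_(a <- x) \sum_(b <- x) L (pr a) (pr b)).
  have -> : form x x = \sum_(a <- x) \sum_(b <- x) L (pr a) (pr b)
      + \sum_(a <- x) \sum_(b <- x) Num.conj (L (pr a) (pr b)).
    rewrite [X in _ + X]exchange_big -big_split; apply: eq_bigr => a _ /=.
    by rewrite -big_split.
  rewrite cReD; have -> : forall u v : R, u = v -> v + u = 2 * v by move=> u v ->; ring.
    by [].
  rewrite !Re_sum; apply: eq_bigr => a _; rewrite !Re_sum; apply: eq_bigr => b _.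
  by rewrite cReJ.
rewrite mulr_ge0// big_tnth; under eq_bigr do rewrite big_tnth.
set t := in_tuple x.
apply: (@halfplane_pick R 'I_(size x) (fun i j => f (tnth t i).2 (tnth t j).2)
  (fun i j => der (tnth t i).2 (tnth t j).2 (val (tnth t i).1))
  (fun i => val (tnth t i).1)).
- by move=> i; exact: (valP (tnth t i).1).
- by move=> i j z z0; apply: (gr_cdiff grz); rewrite gt_eqF.
- by move=> i j z0; apply: derP; rewrite gt_eqF.
- move=> z c z0; have z1 : complex.Im z != 0 by rewrite gt_eqF.
  have := gr_Im_ge0 grz (\sum_i c i *: (tnth t i).2) z0.
  congr (0 <= complex.Im _).
  have Rsum (I : Type) (s : seq I) (F : I -> H) (d : I -> C) :
      Rz z (\sum_(i <- s) d i *: F i) = \sum_(i <- s) d i *: Rz z (F i).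
    have lR : linear (Rz z) by move=> a u v; exact: (gr_linear grz).
    elim: s => [|i s ih]; first by rewrite !big_nil (lin0 lR).
    by rewrite !big_cons lR ih.
  rewrite Rsum inner_suml; apply: eq_bigr => i _.
  rewrite innerZl inner_sumr big_distrr; apply: eq_bigr => j _.
  by rewrite /= innerZr mulrA.
Qed.

(* The resolvent identity, the four cases being the half-planes of [l] and [m]. *)
Let KfE (l m : C) (h g : H) : complex.Im l != 0 -> complex.Im m != 0 ->
  (l - Num.conj m) * Kf (l, h) (m, g) = f h g l - f h g (Num.conj m).
Proof.
move=> l0 m0.
have adj x y z : complex.Im z != 0 -> Num.conj (f x y z) = f y x (Num.conj z).
  by move=> z0; rewrite /f (gr_adjoint grz)// -innerC.
have ml : m - Num.conj l = - Num.conj (l - Num.conj m).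
  by rewrite conjD conjN conjCK opprB.
have [lm|lm] := eqVneq l (Num.conj m); first by rewrite lm !subrr mul0r.
have lm' : m != Num.conj l by apply: contra_neq lm => ->; rewrite conjCK.
have d0 : l - Num.conj m != 0 by rewrite subr_eq0.
have d0' : m - Num.conj l != 0 by rewrite subr_eq0.
have d1 : Num.conj m - l != 0 by rewrite subr_eq0 eq_sym.
rewrite /Kf /L /pick_term /= (negPf lm) (negPf lm') !andbF.
rewrite conjM conjV [Num.conj (m - _)]conjD [Num.conj (- _)]conjN conjCK.
have F1 : Num.conj (f g h m) = f h g (Num.conj m) by exact: adj.
have F2 : Num.conj (f g h (Num.conj l)) = f h g l.
  by rewrite adj ?Im_conj_neq0// conjCK.
move: (f h g l) (f h g (Num.conj m)) F1 F2 => p q F1 F2.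
case: (ltgtP (complex.Im l) 0) l0 => // hl _; case: (ltgtP (complex.Im m) 0) m0 => // hm _;
  rewrite ?subr0 ?sub0r ?conjN ?conj0 ?conjD ?conjN ?F1 ?F2.
- by field; rewrite ?d0 ?d1.
- by field; rewrite ?d0 ?d1.
- by field; rewrite ?d0 ?d1.
- by field; rewrite ?d0 ?d1.
Qed.

Definition gpre : preinner R := Preinner [::] formD formZ formC form_ge0.

Lemma i_nonreal : complex.Im ('i : C) != 0.
Proof. by rewrite cIm_i oner_eq0. Qed.

Let x0 : nonreal := exist _ 'i i_nonreal.

Context (K : hilbertType R) (iota : gpre -> K)
  (iotaE : forall x y, [< iota x, iota y >] = pform x y)
  (iota_dense : forall k (e : R), 0 < e -> exists x, nrm (k - iota x) < e).

(** [rvec l h] is [e(l, h)]; the value at real [l] is arbitrary. *)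
Definition rvec (l : C) (h : H) : K := iota [:: (insubd x0 l, h)].

Local Notation ev := rvec.

Let evE (l m : C) h g : complex.Im l != 0 -> complex.Im m != 0 ->
  [< ev l h, ev m g >] = Kf (l, h) (m, g).
Proof.
move=> l0 m0; rewrite /rvec iotaE /= /form !big_seq1.
by rewrite /pr /= !insubdK.
Qed.

Lemma rvec_gram (l m : C) h g : complex.Im l != 0 -> complex.Im m != 0 ->
  (l - Num.conj m) * [< ev l h, ev m g >] = [< Rz l h, g >] - [< Rz (Num.conj m) h, g >].
Proof. by move=> l0 m0; rewrite evE// KfE. Qed.

Let iota_sum (s : gpre) : iota s = \sum_(a <- s) ev (val a.1) a.2.
Proof.
have add (x y : gpre) : iota (padd x y) = iota x + iota y.
  apply/eqP; rewrite -subr_eq0 -inner_eq0; apply/eqP.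
  by rewrite !innerE !iotaE !(pformD, pformDr); ring.
elim: s => [|a s ih]; last first.
  rewrite big_cons -ih -[a :: s]/(@padd _ gpre [:: a] s) add; congr (_ + _).
  by rewrite /rvec valKd; case: a.
rewrite big_nil; apply/eqP; rewrite -inner_eq0 iotaE /= /form big_nil eqxx //.
Qed.

Lemma rvec_total (x : K) :
  (forall l h, complex.Im l != 0 -> [< x, ev l h >] = 0) -> x = 0.
Proof.
move=> h; apply/eqP; rewrite -nrm_eq0 -sqrf_eq0; apply/eqP.
have io s : [< x, iota s >] = 0.
  by rewrite iota_sum inner_sumr big1// => a _; apply: h; exact: valP a.1.
apply: le_anti; rewrite exprn_ge0 ?nrm_ge0// andbT.
apply: le_eps => e e0.
have x1 : 0 < nrm x + 1 by rewrite ltr_wpDl// nrm_ge0.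
have [s hs] := iota_dense x (divr_gt0 e0 x1).
have : nrm x ^+ 2 = complex.Re [< x, x - iota s >].
  by rewrite innerBr io subr0 inner_sqr cReC.
move=> ->; rewrite add0r; apply: (le_trans (ler_norm _)).
apply: (le_trans (Re_le_nrm _)); apply: (le_trans (cauchy_schwarz _ _)).
move: hs; rewrite ltr_pdivlMr// => hs.
have := nrm_ge0 x; have := nrm_ge0 (x - iota s); nra.
Qed.

(* The vectors [e(l, h)] with [l] a given point are limits of those at other
   points, so that omitting one point keeps them total. *)
Let tends_rvec (l : C) h : complex.Im l != 0 ->
  tends (fun n => ev (l + (dn n)%:C) h) (ev l h).
Proof.
move=> l0.
have lJ0 : complex.Im (Num.conj l) != 0 by rewrite Im_conj_neq0.
pose c (z : C) : C -> C := fun d => f h h (z + d).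
have cc z : complex.Im z != 0 -> ccont (c z) 0.
  move=> z0; apply: (@ccont_comp _ (fun d => z + d)).
    by apply: ccontD; [exact: ccont_cst|exact: ccont_id].
  by rewrite addr0; apply: cdiff_cont; exact: (gr_cdiff grz).
have dl : l - Num.conj l != 0.
  apply: contra_neq l0 => /(congr1 (@complex.Im R)); rewrite cImD cImN cImJ cIm0; lra.
pose k d := (c l d - c (Num.conj l) d) / (l - Num.conj l)
   - (c l d - f h h (Num.conj l)) / (l + d - Num.conj l)
   - (f h h l - c (Num.conj l) d) / (l - Num.conj l - d)
   + (f h h l - f h h (Num.conj l)) / (l - Num.conj l).
have ck : ccont k 0.
  apply: ccontD; last exact: ccont_cst.
  apply: ccontB; [apply: ccontB|].
  - by apply: ccontM; [apply: ccontB; exact: cc|exact: ccont_cst].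
  - apply: ccontM; first by apply: ccontB; [exact: cc|exact: ccont_cst].
    apply: ccontV; first by rewrite addr0.
    by apply: ccontB; [apply: ccontD; [exact: ccont_cst|exact: ccont_id]|exact: ccont_cst].
  - apply: ccontM; first by apply: ccontB; [exact: ccont_cst|exact: cc].
    apply: ccontV; first by rewrite subr0.
    by apply: ccontB; [exact: ccont_cst|exact: ccont_id].
have k0 : k 0 = 0 by rewrite /k /c !addr0 subr0; ring.
move=> e e0; have [N hN] := ccont_dn ck (exprn_gt0 2 e0).
exists N => n /hN; rewrite k0 subr0; set d := dn n => hk.
have ld0 : complex.Im (l + d%:C) != 0 by rewrite cImD cImC addr0.
have kE : k d%:C = (nrm (ev (l + d%:C) h - ev l h) ^+ 2)%:C.
  rewrite -inner_sqr !innerE.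
  have e1 := rvec_gram h h ld0 ld0; have e2 := rvec_gram h h ld0 l0.
  have e3 := rvec_gram h h l0 ld0; have e4 := rvec_gram h h l0 l0.
  rewrite !conjD conjCC in e1 e3.
  have n1 : l + d%:C - (Num.conj l + d%:C) != 0 by rewrite opprD addrACA subrr addr0.
  have n2 : l + d%:C - Num.conj l != 0.
    apply: contra_neq l0 => /(congr1 (@complex.Im R)).
    rewrite !cImD cImN cImJ cImC cIm0; lra.
  have n3 : l - (Num.conj l + d%:C) != 0.
    apply: contra_neq l0 => /(congr1 (@complex.Im R)).
    rewrite !(cImD, cImN) cImJ cImC cIm0; lra.
  rewrite (canRL (mulKf n1) e1) (canRL (mulKf n2) e2).
  rewrite (canRL (mulKf n3) e3) (canRL (mulKf dl) e4).
  have -> : l + d%:C - (Num.conj l + d%:C) = l - Num.conj l by ring.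
  have -> : l - (Num.conj l + d%:C) = l - Num.conj l - d%:C by ring.
  by rewrite /k /c /f; ring.
rewrite kE nrmC ger0_norm ?exprn_ge0 ?nrm_ge0// in hk.
by rewrite -ltr_sqr ?nnegrE ?nrm_ge0 ?(ltW e0).
Qed.

Let ell (n : nat) : C := 'i * (n.+1%:R)%:C.

Let ell_Im n : complex.Im (ell n) = n.+1%:R.
Proof. by rewrite /ell cImM cRe_i cIm_i cReC cImC mul0r add0r mul1r. Qed.

Let ell0 n : complex.Im (ell n) != 0.
Proof. by rewrite ell_Im pnatr_eq0. Qed.

Let q n h := h + ell n *: Rz (ell n) h.

Let q_small h : tends (fun n => q n h) 0.
Proof.
move=> e e0; have [Y hY] := gr_limit grz h (divr_gt0 e0 (ltr0n R 2)).
exists (Num.truncn Y) => n nN; rewrite subr0.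
have := hY n.+1%:R; rewrite -/(ell n) -/(q n h) => h1.
suff : nrm (q n h) <= e / 2 by lra.
by apply: h1; rewrite (le_trans (ltW (truncnS_gt _)))// ler_nat.
Qed.

(* [- l * (At - l)^-1] tends strongly to the identity for an operator [At]. *)
Let V n h : K := - (ell n *: ev (ell n) h).

Let Rz_conj l x y : complex.Im l != 0 ->
  [< Rz (Num.conj l) x, y >] = Num.conj [< Rz l y, x >].
Proof. by move=> l0; rewrite gr_adjoint ?Im_conj_neq0// conjCK -innerC. Qed.

Let nC_neq0 n : ((n.+1%:R)%:C : C) != 0.
Proof. by rewrite -nrm_gt0 nrmC normr_gt0 pnatr_eq0. Qed.

Let nCD_neq0 m n : ((n.+1%:R)%:C + (m.+1%:R)%:C : C) != 0.
Proof. by rewrite -rmorphD -nrm_gt0 nrmC normr_gt0 gt_eqF// addr_gt0// ltr0n. Qed.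

Let ellC n : ell n != 0.
Proof. by apply: contra_neq (ell0 n) => ->. Qed.

Let V_gram n m h : [< V n h, V m h >] = [< h, h >] -
  ((m.+1%:R)%:C * [< q n h, h >] + (n.+1%:R)%:C * Num.conj [< q m h, h >])
    / ((n.+1%:R)%:C + (m.+1%:R)%:C).
Proof.
have eg := rvec_gram h h (ell0 n) (ell0 m).
have i0 : 'i != 0 :> C by rewrite -nrm_gt0 nrm_i.
have lm : ell n - Num.conj (ell m) != 0.
  rewrite /ell !conjE mulNr opprK -mulrDr mulf_neq0//.
have E k : [< Rz (ell k) h, h >] = ([< q k h, h >] - [< h, h >]) / ell k.
  by rewrite /q innerDl innerZl; field; exact: ellC.
rewrite /V innerNl innerNr opprK innerZl innerZr (canRL (mulKf lm) eg).
rewrite Rz_conj// !E /ell !conjE -[Num.conj [< h, h >]]innerC.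
have := nC_neq0 n; have := nC_neq0 m; have := nCD_neq0 m n.
move: ((n.+1%:R)%:C : C) ((m.+1%:R)%:C : C) ('i : C) i0 => a b I I0 ab0 b0 a0.
have -> : I * a - - I * b = I * (a + b) by ring.
by field; rewrite ?oppr_eq0 ?I0 ?a0 ?b0 ?ab0.
Qed.

Let V_close n m h (e : R) : nrm (q n h) * nrm h <= e -> nrm (q m h) * nrm h <= e ->
  nrm ([< V n h, V m h >] - [< h, h >]) <= 2 * e.
Proof.
move=> hn hm; rewrite V_gram addrAC subrr add0r nrmN nrmM nrmV.
have abE : nrm ((n.+1%:R)%:C + (m.+1%:R)%:C : C) = n.+1%:R + m.+1%:R.
  by rewrite -rmorphD nrmC ger0_norm// addr_ge0.
have n0 : 0 < n.+1%:R :> R by rewrite ltr0n.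
have m0 : 0 < m.+1%:R :> R by rewrite ltr0n.
rewrite abE ler_pdivrMr ?addr_gt0//.
have := nrmD ((m.+1%:R)%:C * [< q n h, h >]) ((n.+1%:R)%:C * Num.conj [< q m h, h >]).
rewrite !nrmM nrmJ !nrmC !ger0_norm// => h1; apply: (le_trans h1).
have := le_trans (cauchy_schwarz (q n h) h) hn.
have := le_trans (cauchy_schwarz (q m h) h) hm.
move: (nrm [< q n h, h >]) (nrm [< q m h, h >]) (nrm_ge0 [< q n h, h >]) (nrm_ge0 [< q m h, h >]).
move: (n.+1%:R : R) (m.+1%:R : R) n0 m0 => a b a0 b0 x y xge yge ye xe.
have := ler_wpM2l (ltW b0) xe; have := ler_wpM2l (ltW a0) ye.
have : 0 <= a * e := mulr_ge0 (ltW a0) (le_trans yge ye).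
have : 0 <= b * e := mulr_ge0 (ltW b0) (le_trans yge ye).
lra.
Qed.

Let V_cauchy h : cauchy_seq (fun n => V n h).
Proof.
move=> e e0.
have h1 : 0 < nrm h + 1 by rewrite ltr_wpDl// nrm_ge0.
have e2 : 0 < e ^+ 2 / 16 by rewrite divr_gt0// exprn_gt0.
have [N hN] := q_small h (divr_gt0 e2 h1).
have small n : (N <= n)%N -> nrm (q n h) * nrm h <= e ^+ 2 / 16.
  move=> /hN; rewrite subr0 ltr_pdivlMr//.
  have := nrm_ge0 (q n h); have := nrm_ge0 h; nra.
exists N => m n Nm Nn.
rewrite -ltr_sqr ?nnegrE ?nrm_ge0 ?(ltW e0)//.
have -> : nrm (V m h - V n h) ^+ 2 = complex.Re (
    ([< V m h, V m h >] - [< h, h >]) - ([< V n h, V m h >] - [< h, h >])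
    - ([< V m h, V n h >] - [< h, h >]) + ([< V n h, V n h >] - [< h, h >])).
  by rewrite -[LHS]cReC -inner_sqr !innerE; congr complex.Re; ring.
have := V_close (small _ Nm) (small _ Nm); have := V_close (small _ Nn) (small _ Nm).
have := V_close (small _ Nm) (small _ Nn); have := V_close (small _ Nn) (small _ Nn).
set a := [< V m h, V m h >] - _; set b := [< V n h, V m h >] - _.
set c := [< V m h, V n h >] - _; set d := [< V n h, V n h >] - _.
move=> hd hc hb ha; apply: (le_lt_trans (ler_norm _)).
apply: (le_lt_trans (Re_le_nrm _)).
have := nrmD (a - b - c) d; have := nrmB (a - b) c; have := nrmB a b.
have : 0 < e ^+ 2 by rewrite exprn_gt0.
lra.
Qed.

Definition remb (h : H) : K := xget 0 [set k | tends (fun n => V n h) k].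

Local Notation J := remb.

Let V_tends h : tends (fun n => V n h) (J h).
Proof.
rewrite /remb; case: xgetP => [k _ //|no].
by have [k hk] := cauchy_tends (V_cauchy h); case: (no k).
Qed.

Lemma remb_rvec h m g : complex.Im m != 0 ->
  [< J h, ev m g >] = [< Rz (Num.conj m) h, g >].
Proof.
move=> m0; set P := [< Rz (Num.conj m) h, g >].
apply: (tends_uniq (tends_inner (ev m g) (V_tends h))) => e e0.
pose B := nrm [< h, g >] + nrm g + nrm (Num.conj m * P).
have B0 : 0 <= B by rewrite !addr_ge0 ?nrm_ge0.
have [N hN] := q_small h ltr01.
have Bm0 : 0 < B / e + nrm m + 1.
  by rewrite ltr_wpDl// addr_ge0 ?nrm_ge0// divr_ge0// ltW.
have [M hM] := invn_lt (etrans (invr_gt0 _) Bm0).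
exists (maxn N M) => n; rewrite geq_max => /andP[/hN hq /hM hn].
rewrite subr0 in hq.
have {}hn : B / e + nrm m + 1 < n.+1%:R.
  by rewrite -ltf_pV2 ?posrE ?ltr0n.
have nl : nrm (ell n) = n.+1%:R by rewrite /ell nrmM nrm_i mul1r nrmC ger0_norm.
have dl : B / e + 1 < nrm (ell n - Num.conj m).
  have := nrm_le_dist (ell n) (Num.conj m); rewrite nrmJ nl; move: hn.
  set a : R := n.+1%:R; lra.
have Be : 0 <= B / e by rewrite divr_ge0// ltW.
have dl0 : ell n - Num.conj m != 0 by rewrite -nrm_gt0; lra.
have -> : [< V n h, ev m g >] - P =
    ([< h, g >] - [< q n h, g >] + Num.conj m * P) / (ell n - Num.conj m).
  rewrite /V innerNl innerZl (canRL (mulKf dl0) (rvec_gram _ _ (ell0 n) m0)) -/P.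
  by rewrite /q innerDl innerZl; field.
rewrite nrmM nrmV ltr_pdivrMr ?nrm_gt0//.
have hb : nrm ([< h, g >] - [< q n h, g >] + Num.conj m * P) <= B.
  apply: (le_trans (nrmD _ _)); rewrite /B lerD2r.
  apply: (le_trans (nrmB _ _)); rewrite lerD2l.
  apply: (le_trans (cauchy_schwarz _ _)).
  by rewrite ler_piMl ?nrm_ge0// ltW.
apply: (le_lt_trans hb).
have : e * (B / e + 1) < e * nrm (ell n - Num.conj m) by rewrite ltr_pM2l.
rewrite mulrDr mulrCA divff ?gt_eqF// !mulr1; lra.
Qed.

Lemma rvec_remb l h g : complex.Im l != 0 -> [< ev l h, J g >] = [< Rz l h, g >].
Proof. by move=> l0; rewrite innerC remb_rvec// Rz_conj// conjCK. Qed.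

Lemma remb_isometric h g : [< J h, J g >] = [< h, g >].
Proof.
have t1 : tends (fun n => [< V n h, J g >]) [< J h, J g >] by exact: tends_inner.
apply: (tends_uniq t1).
have -> : (fun n => [< V n h, J g >]) = fun n => [< h, g >] + - [< q n h, g >].
  apply/funext => n; rewrite /V innerNl innerZl.
  rewrite innerC remb_rvec// Rz_conj// conjCK /q innerDl innerZl opprD addrA subrr add0r //.
have := tends_inner g (q_small h); rewrite inner0l => t2.
have := tendsD (@tends_cst _ C [< h, g >]) (tendsN t2).
by rewrite oppr0 addr0.
Qed.

Lemma remb_linear : linear J.
Proof.
move=> a x y; apply/eqP; rewrite -subr_eq0; apply/eqP; apply: rvec_total => l h l0.
by rewrite !innerE !remb_rvec// (gr_linear grz) ?Im_conj_neq0// !innerE subrr.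
Qed.

Definition rvgraph : set (K * K) :=
  [set p | exists l h, complex.Im l != 0 /\ p = (ev l h, J h + l *: ev l h)].

(** By [essentially_selfadjoint] this is also the closure of the span. *)
Definition rrel : set (K * K) := adjoint_relation rvgraph.

Lemma rvgraph_symmetric : symmetric_relation rvgraph.
Proof.
move=> _ [l [h [l0 ->]]] _ [m [g [m0 ->]]] /=.
rewrite !innerE remb_rvec// rvec_remb//.
have := rvec_gram h g l0 m0; set k := [< ev l h, ev m g >] => e.
apply/eqP; rewrite -subr_eq0; apply/eqP.
have -> : forall a b c d : C, a + b - (c + d) = (b - d) - (c - a) by move=> *; ring.
by rewrite -mulrBl e subrr.
Qed.

(* Orthogonality to the vector with parameter [l] yields orthogonality to [J h],
   then to the vectors with other parameters. *)
Let rvgraph_total l (x : K) : complex.Im l != 0 ->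
  (forall f, rvgraph f -> [< x, f.2 - l *: f.1 >] = 0) -> x = 0.
Proof.
move=> l0 hx; have xJ h : [< x, J h >] = 0.
  have := hx _ (ex_intro _ l (ex_intro _ h (conj l0 erefl))).
  by rewrite /= addrK.
have xe m h : complex.Im m != 0 -> m != l -> [< x, ev m h >] = 0.
  move=> m0 ml; have := hx _ (ex_intro _ m (ex_intro _ h (conj m0 erefl))).
  rewrite /= -addrA -scalerBl innerDr xJ add0r innerZr => /eqP.
  by rewrite mulf_eq0 conjC_eq0 subr_eq0 (negPf ml) => /eqP.
apply: rvec_total => m h m0.
have [->|/xe] := eqVneq m l; last exact.
rewrite innerC; apply/eqP; rewrite conjC_eq0; apply/eqP.
have := tends_innerl (z := x) (tends_rvec h l0); apply => n.
rewrite innerC xe ?conj0//; first by rewrite cImD cImC addr0.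
by rewrite -subr_eq0 addrC addKr -nrm_gt0 nrmC normr_gt0 gt_eqF// dn_gt0.
Qed.

Lemma rrel_selfadjoint : selfadjoint_relation rrel.
Proof.
have i0 : complex.Im ('i : C) != 0 by rewrite cIm_i oner_eq0.
apply: (essentially_selfadjoint rvgraph_symmetric i0) => x.
  exact: rvgraph_total.
by apply: rvgraph_total; rewrite Im_conj_neq0.
Qed.

Lemma rrel_rvec l h : complex.Im l != 0 -> rrel (ev l h, J h + l *: ev l h).
Proof. by move=> l0; apply: rvgraph_symmetric; exists l, h. Qed.

(** An element of the multivalued part is orthogonal to the domain, which contains
    the total family [e(l, h)]. *)
Lemma rrel_operator : is_operator rrel.
Proof.
apply/seteqP; split=> [x hx|x ->] /=; last first.
  exact: (adjoint_linear rvgraph).1.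
apply: rvec_total => l h l0.
have := hx _ (ex_intro _ l (ex_intro _ h (conj l0 erefl))).
by rewrite /= inner0l.
Qed.

Lemma rrel_resolvent l h : complex.Im l != 0 -> resolvent rrel l (J h) = ev l h.
Proof.
move=> l0; apply: resolventE => //; last exact: rrel_rvec.
  exact: adjoint_linear.
exact: selfadjoint_symmetric rrel_selfadjoint.
Qed.

Lemma rrel_minimal : minimal_extension J rrel.
Proof.
apply/seteqP; split=> // k _ B /nbhs_ballP[e /= e0 hB].
have Ie : complex.Im e = 0 by exact: ger0_Im (ltW e0).
have eE : e = (complex.Re e)%:C by apply: complex_eq.
have r0 : 0 < complex.Re e by rewrite -ltcR -eE.
have [s hs] := iota_dense k r0.
exists (iota s); split; last first.
  by apply: hB; rewrite -ball_normE /ball_ /= nrmE eE ltcR.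
move=> W [[W0 linW] SW]; rewrite iota_sum.
elim: s {hs} => [|a s ih]; first by rewrite big_nil.
rewrite big_cons -[ev _ _]scale1r; apply: linW => //; apply: SW; right.
exists (val a.1); first exact: selfadjoint_resolvent_set rrel_selfadjoint (valP a.1).
exists (J a.2); first by exists a.2.
by rewrite rrel_resolvent//; exact: (valP a.1).
Qed.

End Realization.

(** The vectors [e l h] stand for [(At - l)^-1 (J h)]: their inner products are
    prescribed by the resolvent identity, and the form is positive by Pick's
    inequality. *)
Theorem realization (R : realType) (H : hilbertType R) (Rz : R[i] -> H -> H) :
  generalized_resolvent Rz ->
  exists (K : hilbertType R) (J : H -> K) (At : set (K * K)) (e : R[i] -> H -> K),
    [/\ isometric_embedding J, selfadjoint_relation At, is_operator At &
        minimal_extension J At] /\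
    [/\ forall l h, complex.Im l != 0 -> At (e l h, J h + l *: e l h),
        forall l h g, complex.Im l != 0 -> [< e l h, J g >] = [< Rz l h, g >] &
        forall l h, complex.Im l != 0 -> (l - Num.conj l) * [< e l h, e l h >] =
          [< Rz l h, h >] - [< Rz (Num.conj l) h, h >]].
Proof.
move=> grz.
have [K [iota [iotaE iota_dense]]] := hilbert_completion (gpre grz).
exists K, (remb iota), (rrel iota), (rvec iota); split; split.
- by split; [exact: remb_linear|exact: remb_isometric].
- exact: rrel_selfadjoint.
- exact: rrel_operator.
- exact: rrel_minimal.
- by move=> l h; exact: rrel_rvec.
- by move=> l h g; exact: rvec_remb.
- by move=> l h l0; exact: rvec_gram.
Qed.

(** * Bounded operators and Nevanlinna pairs *)

Section BoundedOperators.
Context {R : realType} {U V : hilbertType R}.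
Local Notation C := R[i].

Lemma bounded_operator_bound (T : U -> V) : bounded_operator T ->
  exists2 c : R, 0 < c & forall x, nrm (T x) <= c * nrm x.
Proof.
move=> [lT cT]; have := cT 0; move/cvgrPdist_lt => /(_ 1 ltr01)/nbhs_ballP[d /= d0 hd].
have Id : complex.Im d = 0 by exact: ger0_Im (ltW d0).
have dE : d = (complex.Re d)%:C by apply: complex_eq.
have r0 : 0 < complex.Re d by rewrite -ltcR -dE.
set r := complex.Re d in dE r0.
have small x : nrm x < r -> nrm (T x) < 1.
  move=> xr; have := hd x; rewrite -ball_normE /ball_ /= sub0r normrN !nrmE dE.
  rewrite ltcR (lin0 lT) sub0r nrmN => /(_ xr).
  by rewrite -ltcR.
exists (2 / r); first by rewrite divr_gt0.
move=> x; have [->|x0] := eqVneq x 0; first by rewrite (lin0 lT) !nrm0 mulr0.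
have nx : 0 < nrm x by rewrite nrm_gt0.
have := small ((r / 2 / nrm x)%:C *: x).
rewrite linZ// !nrmZ nrmC gtr0_norm ?divr_gt0// divfK ?gt_eqF//.
have hr : r / 2 < r by rewrite ltr_pdivrMr// ltr_pMr// ltr1n.
move=> /(_ hr) h.
have -> : nrm (T x) = (2 / r * nrm x) * (r / 2 / nrm x * nrm (T x)).
  by field; rewrite ?gt_eqF//.
by apply: ler_piMr (ltW h); rewrite mulr_ge0 ?divr_ge0 ?(ltW nx) ?(ltW r0).
Qed.

Lemma bounded_operator_tends (T : U -> V) (u : nat -> U) a :
  bounded_operator T -> tends u a -> tends (fun n => T (u n)) (T a).
Proof.
move=> bT ua e e0; have [c c0 hc] := bounded_operator_bound bT.
have [N hN] := ua _ (divr_gt0 e0 c0); exists N => n /hN; rewrite ltr_pdivlMr// => h.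
by rewrite -(linB _ _ bT.1); apply: (le_lt_trans (hc _)); rewrite mulrC.
Qed.

Lemma adjoint_operatorP (T : U -> V) : bounded_operator T ->
  forall x v, [< T x, v >] = [< x, adjoint_operator T v >].
Proof.
move=> bT x v; rewrite /adjoint_operator; case: xgetP => [u _ //|no].
have [c c0 hc] := bounded_operator_bound bT.
have [u hu] : exists u, forall x, [< T x, v >] = [< x, u >].
  apply: (@riesz R U _ (c * nrm v)) => [a y z|y]; first by rewrite bT.1 !innerE.
  by rewrite (le_trans (cauchy_schwarz _ _))// mulrAC ler_wpM2r ?nrm_ge0.
by case: (no u).
Qed.

Lemma adjoint_operatorE (T : U -> V) v u :
  (forall x, [< T x, v >] = [< x, u >]) -> adjoint_operator T v = u.
Proof.
move=> hu; rewrite /adjoint_operator; case: xgetP => [w _ /= hw|/(_ u) []//].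
by apply: inner_extr => x; rewrite -hw hu.
Qed.
End BoundedOperators.

Section Pairs.
Context {R : realType} {B : hilbertType R}.
Local Notation C := R[i].

(** The sign for which [psi l + hsign l * phi l] is invertible. *)
Definition hsign (l : C) : C := if 0 < complex.Im l then 'i else - 'i.

(** The algebraic part of a Nevanlinna pair, in terms of inner products; it is what
    the solvability of the boundary value problem rests on.  The constant pairs
    [{0, 1}] and [{1, 0}] describe [A_0] and [A_1], which are treated alike. *)
Record boundary_pair (phi psi : C -> B -> B) : Prop := BoundaryPair {
  bp_phi : forall l, complex.Im l != 0 -> bounded_operator (phi l);
  bp_psi : forall l, complex.Im l != 0 -> bounded_operator (psi l);
  bp_Im : forall l c, complex.Im l != 0 ->
    0 <= complex.Im l * complex.Im [< psi l c, phi l c >];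
  bp_sym : forall l c d, complex.Im l != 0 ->
    [< phi l c, psi (Num.conj l) d >] = [< psi l c, phi (Num.conj l) d >];
  bp_inv : forall l, complex.Im l != 0 -> exists2 S : B -> B, bounded_operator S &
    (forall c, S (psi l c + hsign l *: phi l c) = c) /\
    (forall h, psi l (S h) + hsign l *: phi l (S h) = h)
}.

Lemma hsignJ l : complex.Im l != 0 -> Num.conj (hsign (Num.conj l)) = hsign l.
Proof.
rewrite /hsign cImJ oppr_gt0; case: (ltgtP (complex.Im l) 0) => // _ _.
  by rewrite !conjE.
by rewrite !conjE opprK.
Qed.

Lemma nrm_hsign l : nrm (hsign l) = 1.
Proof. by rewrite /hsign; case: ifP; rewrite ?nrmN nrm_i. Qed.

Lemma trivial_pair : boundary_pair (fun _ _ => 0) (fun _ => id).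
Proof.
have lid : bounded_operator (@id B).
  by apply: (@linear_continuous_bounded R B B id 1) => // x; rewrite mul1r.
split.
- move=> l _; apply: (@linear_continuous_bounded R B B _ 1) => [a x y|x].
    by rewrite scaler0 addr0.
  by rewrite nrm0 mul1r nrm_ge0.
- by [].
- by move=> l c _; rewrite inner0r cIm0 mulr0.
- by move=> l c d _; rewrite inner0l inner0r.
- by move=> l l0; exists id => //; split=> [c|h]; rewrite scaler0 addr0.
Qed.

Lemma nevanlinna_boundary_pair phi psi : nevanlinna_pair phi psi -> boundary_pair phi psi.
Proof.
move=> [hol pos sym [inv_up inv_low]].
have bphi l : complex.Im l != 0 -> bounded_operator (phi l) by move=> /hol[].
have bpsi l : complex.Im l != 0 -> bounded_operator (psi l) by move=> /hol[].
split=> //.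
- move=> l c l0.
  have -> : complex.Im [< psi l c, phi l c >] =
     complex.Re [< operator_Im (adjoint_operator (phi l) \o psi l) c, c >].
    rewrite /operator_Im (@adjoint_operatorE R B B _ c (adjoint_operator (psi l) (phi l c))).
      rewrite /= innerZl innerBl.
      rewrite [[< adjoint_operator (phi l) _, c >]]innerC -adjoint_operatorP//; last exact: bphi.
      rewrite [[< adjoint_operator (psi l) _, c >]]innerC -adjoint_operatorP//; last exact: bpsi.
      rewrite -innerC [[< psi l c, phi l c >]]innerC.
      set z := [< phi l c, psi l c >].
      have -> : (2 * 'i)^-1 = (2^-1)%:C * - 'i :> C.
        by rewrite invfM invCi realCV rmorph_nat.
      by rewrite !ReImE; field.
    move=> x /=; rewrite [LHS]innerC -adjoint_operatorP; last exact: bphi.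
    by rewrite -innerC adjoint_operatorP//; exact: bpsi.
  have := pos l l0 c; rewrite lecE => /andP[_].
  rewrite -realCV cReM cReC cImC mulr0 subr0.
  set z := complex.Re [< _, c >] => h.
  have -> : complex.Im l * z = (z / complex.Im l) * complex.Im l ^+ 2 by field.
  by apply: mulr_ge0; [exact: h|exact: sqr_ge0].
- move=> l c d l0; have l0' : complex.Im (Num.conj l) != 0 by rewrite Im_conj_neq0.
  have := sym l l0 c => /eqP; rewrite subr_eq0 => /eqP h.
  have e1 := adjoint_operatorP (bpsi _ l0') d (phi l c).
  have e2 := adjoint_operatorP (bphi _ l0') d (psi l c).
  by rewrite innerC e1 h -e2 -innerC.
- move=> l l0; rewrite /hsign.
  have main (s : C) : resolvent_set (graph (fun h => psi l h + s *: phi l h)) 0 ->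
     exists2 S : B -> B, bounded_operator S &
      (forall c, S (psi l c + s *: phi l c) = c) /\
      (forall h, psi l (S h) + s *: phi l (S h) = h).
    move=> [S bS Sg]; exists S => //.
    have key c h : (psi l c + s *: phi l c = h) <-> S h = c.
      split=> hc.
        have : graph S (h, c); last by [].
        by rewrite -Sg; apply/resolventP; rewrite scale0r addr0.
      have : resolvent_relation (graph (fun h => psi l h + s *: phi l h)) 0 (h, c).
        by rewrite Sg /graph /=.
      by move/resolventP; rewrite scale0r addr0 /graph /=.
    by split=> [c|h]; [apply/key|apply/key].
  case: (ltgtP (complex.Im l) 0) l0 => // hl _; apply: main; last exact: inv_up.
  have := inv_low l hl; congr (resolvent_set (graph _) 0); apply/funext => h.
  by rewrite scaleNr.
Qed.

End Pairs.

(** * Resolvents of boundary conditions *)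

Section Triplet.
Context {R : realType} {H B : hilbertType R}.
Local Notation C := R[i].
Variables (A : set (H * H)) (G0 G1 : H * H -> B).
Hypothesis cso : closed_symmetric_operator A.
Hypothesis bt : boundary_triplet A G0 G1.

Local Notation As := (adjoint_relation A).

Lemma graph_linearB T (G : H * H -> B) f g : bounded_on_graph T G ->
  T f -> T g -> G (f.1 - g.1, f.2 - g.2) = G f - G g.
Proof.
move=> [lG _] Tf Tg; have := lG (-1) g f Tg Tf.
have -> : -1 *: g + f = (f.1 - g.1, f.2 - g.2).
  by rewrite [LHS]pair_surjE /= !scaleN1r [- g.1 + _]addrC [- g.2 + _]addrC.
by move=> ->; rewrite scaleN1r addrC.
Qed.

Lemma graph_bound T (G : H * H -> B) : bounded_on_graph T G ->
  exists2 k : R, 0 < k & forall f, T f -> nrm (G f) <= k * (nrm f.1 + nrm f.2).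
Proof.
move=> [_ [k hk]]; exists (`|k| + 1); first by rewrite ltr_wpDl.
move=> f /hk; rewrite nrmE !inner_sqr -rmorphXn /= -rmorphD -rmorphM /= lecR => h.
have p0 := nrm_ge0 f.1; have q0 := nrm_ge0 f.2; have s0 := nrm_ge0 (G f).
have k0 := normr_ge0 k; have kk := ler_norm k.
move: p0 q0 s0 k0 kk h; set p := nrm f.1; set q := nrm f.2; set s := nrm (G f).
move=> p0 q0 s0 k0 kk h.
rewrite -ler_sqr ?nnegrE ?mulr_ge0 ?addr_ge0//.
apply: (le_trans h); apply: (@le_trans _ _ (`|k| * (p ^+ 2 + q ^+ 2))).
  by rewrite ler_wpM2r// addr_ge0// sqr_ge0.
rewrite exprMn ler_pM ?addr_ge0 ?sqr_ge0//; nra.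
Qed.

Lemma graph_tends T (G : H * H -> B) (u v : nat -> H) a b :
  linear_subspace T -> bounded_on_graph T G -> (forall n, T (u n, v n)) -> T (a, b) ->
  tends u a -> tends v b -> tends (fun n => G (u n, v n)) (G (a, b)).
Proof.
move=> linT bG Tuv Tab ua vb e e0; have [k k0 hk] := graph_bound bG.
have e1 : 0 < e / k / 2 by rewrite !divr_gt0.
have [N1 h1] := ua _ e1; have [N2 h2] := vb _ e1.
exists (maxn N1 N2) => n; rewrite geq_max => /andP[/h1 {}h1 /h2 {}h2].
rewrite -(graph_linearB bG)//; apply: (le_lt_trans (hk _ _)); first exact: relationB.
rewrite /= mulrC -ltr_pdivlMr//; lra.
Qed.

Lemma linG0 (a : C) f g : As f -> As g -> G0 (a *: f + g) = a *: G0 f + G0 g.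
Proof. by have [_ [[h _] _] _ _] := bt; exact: h. Qed.

Lemma linG1 (a : C) f g : As f -> As g -> G1 (a *: f + g) = a *: G1 f + G1 g.
Proof. by have [_ [_ [h _]] _ _] := bt; exact: h. Qed.

Lemma G0B f g : As f -> As g -> G0 (f.1 - g.1, f.2 - g.2) = G0 f - G0 g.
Proof. by have [_ [bG _] _ _] := bt; exact: (graph_linearB bG). Qed.

Lemma G1B f g : As f -> As g -> G1 (f.1 - g.1, f.2 - g.2) = G1 f - G1 g.
Proof. by have [_ [_ bG] _ _] := bt; exact: (graph_linearB bG). Qed.

Lemma green f g : As f -> As g ->
  [< f.2, g.1 >] - [< f.1, g.2 >] = [< G1 f, G0 g >] - [< G0 f, G1 g >].
Proof. by have [_ _ h _] := bt; exact: h. Qed.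

Lemma boundary_onto h0 h1 : exists f, [/\ As f, G0 f = h0 & G1 f = h1].
Proof. by have [_ _ _ h] := bt; exact: h. Qed.

Lemma symA : A `<=` As. Proof. by have [_ _ _ h] := cso. Qed.

(** By Green's identity the boundary values are orthogonal to those of [A^*], which
    fill [B]. *)
Lemma boundary_values0 f : A f -> G0 f = 0 /\ G1 f = 0.
Proof.
move=> Af; have Asf := symA Af.
have main g : As g -> [< G1 f, G0 g >] - [< G0 f, G1 g >] = 0.
  move=> Asg; rewrite -green//.
  by rewrite [[< f.2, _ >]]innerC -(Asg f Af) -innerC subrr.
split.
  have [g [Asg g0 g1]] := boundary_onto 0 (G0 f).
  have := main g Asg; rewrite g0 g1 inner0r sub0r => /eqP.
  by rewrite oppr_eq0 inner_eq0 => /eqP.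
have [g [Asg g0 g1]] := boundary_onto (G1 f) 0.
by have := main g Asg; rewrite g0 g1 inner0r subr0 => /eqP; rewrite inner_eq0 => /eqP.
Qed.

Section Pair.
Variables (phi psi : C -> B -> B).
Hypothesis bp : boundary_pair phi psi.

(** The restriction of [A^*] by the boundary condition [(- G0 f, G1 f) \in tau l].
    Its resolvent at the same point [l] is the compressed resolvent. *)
Definition boundary_relation l : set (H * H) :=
  [set f | As f /\ exists c, G0 f = - phi l c /\ G1 f = psi l c].

Lemma boundary_relation_sub l f : complex.Im l != 0 -> A f -> boundary_relation l f.
Proof.
move=> l0 Af; have [e0 e1] := boundary_values0 Af; split; first exact: symA.
exists 0; rewrite e0 e1 (lin0 (bp_phi bp l0).1) (lin0 (bp_psi bp l0).1).
by rewrite oppr0.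
Qed.

Lemma boundary_relation_linear l : complex.Im l != 0 ->
  linear_subspace (boundary_relation l).
Proof.
move=> l0; split.
  by apply: boundary_relation_sub => //; have [[]] := cso.
move=> a f g [Af [c [c0 c1]]] [Ag [d [d0 d1]]]; split.
  by apply: (adjoint_linear A).2.
exists (a *: c + d); rewrite linG0// linG1// (bp_phi bp l0).1 (bp_psi bp l0).1.
by rewrite c0 c1 d0 d1 opprD scalerN.
Qed.

(** By Green's identity [Im <f2, f1>] is [- Im <psi l c, phi l c>]. *)
Lemma boundary_relation_Im l f : complex.Im l != 0 -> boundary_relation l f ->
  complex.Im l * complex.Im [< f.2 - l *: f.1, f.1 >] <= - (complex.Im l * nrm f.1) ^+ 2.
Proof.
move=> l0 [Af [c [c0 c1]]]; have := green Af Af; rewrite c0 c1.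
have := bp_Im bp c l0; rewrite !innerE inner_sqr.
rewrite [[< f.1, f.2 >]]innerC [[< phi l c, psi l c >]]innerC.
set p := [< psi l c, _ >]; set q := [< f.2, f.1 >] => h /(congr1 (@complex.Im R)).
rewrite !ReImE => e; have {}e : complex.Im q = - complex.Im p by lra.
rewrite e; set L := complex.Im l in h *; nra.
Qed.

Lemma boundary_relation_bound l f : complex.Im l != 0 -> boundary_relation l f ->
  nrm f.1 <= `|complex.Im l|^-1 * nrm (f.2 - l *: f.1).
Proof.
move=> l0 /(boundary_relation_Im l0) h.
rewrite ler_pdivlMl ?normr_gt0//.
have [->|f0] := eqVneq f.1 0; first by rewrite nrm0 mulr0 nrm_ge0.
have L0 : 0 < `|complex.Im l| by rewrite normr_gt0.
have p0 : 0 < `|complex.Im l| * nrm f.1 by rewrite mulr_gt0// nrm_gt0.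
rewrite -(ler_pM2r p0).
have := cauchy_schwarz (f.2 - l *: f.1) f.1; have := Im_le_nrm [< f.2 - l *: f.1, f.1 >].
set g := [< _, _ >] in h * => h1 h2; apply: (@le_trans _ _ (`|complex.Im l| * `|complex.Im g|)).
  rewrite -expr2 exprMn real_normK ?num_real// -exprMn -normrM -[leRHS]normrN.
  by apply: le_trans (ler_norm _); rewrite lerNr.
by rewrite [leRHS]mulrCA ler_pM2l// (le_trans h1).
Qed.

(** By [bp_inv] the parameter [c] is a bounded function of the boundary values, so
    it converges along a convergent sequence of solutions. *)
Lemma boundary_relation_closed l : complex.Im l != 0 -> closed_relation (boundary_relation l).
Proof.
move=> l0 u v a b huv ua vb; have [S bS [SK KS]] := bp_inv bp l0.
have [_ [bG0 bG1] _ _] := bt; have linA := adjoint_linear A.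
have Auv n : As (u n, v n) by case: (huv n).
have Aab : As (a, b) by apply: (@adjoint_closed _ _ A u v).
have t0 := graph_tends linA bG0 Auv Aab ua vb; have t1 := graph_tends linA bG1 Auv Aab ua vb.
pose k n := G1 (u n, v n) + - hsign l *: G0 (u n, v n).
have tk : tends k (G1 (a, b) + - hsign l *: G0 (a, b)) by apply: tendsD t1 (tends_scale _ t0).
have kE n : G0 (u n, v n) = - phi l (S (k n)) /\ G1 (u n, v n) = psi l (S (k n)).
  have [_ [c [c0 c1]]] := huv n; rewrite /k c0 c1.
  by rewrite scalerN scaleNr opprK SK.
have tS := bounded_operator_tends bS tk.
split=> //; exists (S (G1 (a, b) + - hsign l *: G0 (a, b))); split.
  apply: (tends_uniq t0).
  have := tendsN (bounded_operator_tends (bp_phi bp l0) tS).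
  by congr tends; apply/funext => n; rewrite (kE n).1.
apply: (tends_uniq t1).
have := bounded_operator_tends (bp_psi bp l0) tS.
by congr tends; apply/funext => n; rewrite (kE n).2.
Qed.

Lemma boundary_relation_eigen l f : complex.Im l != 0 -> boundary_relation l f ->
  f.2 = l *: f.1 -> f.1 = 0.
Proof.
move=> l0 Tf fE; have := boundary_relation_bound l0 Tf; rewrite fE subrr nrm0 mulr0 => h.
by apply/eqP; rewrite -nrm_eq0 eq_le h nrm_ge0.
Qed.

(** The relations of a pair at conjugate points are adjoint to each other; an
    element of the orthogonal complement of the range thus is an eigenvector of
    the relation at the conjugate point. *)
Lemma boundary_relation_range l (h : H) : complex.Im l != 0 ->
  exists v, boundary_relation l (v, h + l *: v).
Proof.
move=> l0; have m0 : complex.Im (Num.conj l) != 0 by rewrite Im_conj_neq0.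
apply: (range_double_orthogonal (boundary_relation_linear l0) (boundary_relation_closed l0)).
  by move=> f Tf; exact: boundary_relation_bound.
move=> y hy; suff -> : y = 0 by rewrite inner0r.
set m := Num.conj l in m0 *.
have Ay : As (y, m *: y).
  move=> g Ag /=; have := hy g (boundary_relation_sub l0 Ag).
  rewrite !innerE => /eqP; rewrite subr_eq0 => /eqP e.
  by rewrite [in RHS]innerC e conjM -innerC.
apply: (@boundary_relation_eigen m (y, m *: y)) => //; split=> //.
set y0 := G0 _; set y1 := G1 _.
have key c : [< psi l c, y0 >] + [< phi l c, y1 >] = 0.
  have [f [Af f0 f1]] := boundary_onto (- phi l c) (psi l c).
  have Tf : boundary_relation l f by split=> //; exists c.
  have := green Af Ay; rewrite -/y0 -/y1 f0 f1 /= innerNl opprK => <-.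
  by have := hy f Tf; rewrite innerBl innerZl innerZr /m conjCK.
have [S bS [SK KS]] := bp_inv bp m0.
pose d := S (y1 - hsign m *: y0).
(* [d] is chosen so that the deviations [z0], [z1] of the boundary values from
   those prescribed by [d] are proportional; orthogonality to the range of
   [psi l + hsign l * phi l] then makes both vanish. *)
have [S' bS' [SK' KS']] := bp_inv bp l0.
have dE : psi m d + hsign m *: phi m d = y1 - hsign m *: y0 by rewrite KS.
pose z0 := y0 + phi m d; pose z1 := y1 - psi m d.
have z1E : z1 = hsign m *: z0.
  rewrite /z1 /z0 scalerDr; apply/eqP; rewrite subr_eq -addrA [_ *: phi m d + _]addrC dE.
  by rewrite addrC subrK.
have z0E : z0 = 0.
  apply/eqP; rewrite -inner_eq0 -{1}(KS' z0).
  set c := S' z0.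
  have := key c; rewrite -[y0](addrK (phi m d)) -[y1](subrK (psi m d)) -/z0 -/z1.
  have sym := bp_sym bp c d l0; rewrite -/m in sym.
  rewrite z1E !innerE sym -(hsignJ l0) -/m => e.
  by apply/eqP; rewrite -[RHS]e; ring.
exists d; split; apply/eqP; rewrite -subr_eq0.
  by rewrite opprK -/z0 z0E.
by rewrite -/z1 z1E z0E scaler0.
Qed.

Lemma boundary_resolventE l (h v : H) : complex.Im l != 0 ->
  boundary_relation l (v, h + l *: v) -> resolvent (boundary_relation l) l h = v.
Proof.
move=> l0 Tv; rewrite /resolvent /relation_operator.
case: xgetP => [w _ /= /resolventP Tw|/(_ v) []]; last exact/resolventP.
have Td := relationB (boundary_relation_linear l0) Tw Tv.
apply/eqP; rewrite -subr_eq0; apply/eqP.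
apply: (boundary_relation_eigen l0 Td) => /=.
by rewrite opprD addrACA subrr add0r scalerBr.
Qed.

Definition pair_resolvent l : H -> H := resolvent (boundary_relation l) l.

Lemma pair_resolventP l h : complex.Im l != 0 ->
  boundary_relation l (pair_resolvent l h, h + l *: pair_resolvent l h).
Proof.
move=> l0; have [v Tv] := boundary_relation_range h l0.
by rewrite /pair_resolvent (boundary_resolventE l0 Tv).
Qed.

Lemma pair_resolvent_bound l h : complex.Im l != 0 ->
  nrm (pair_resolvent l h) <= `|complex.Im l|^-1 * nrm h.
Proof.
by move=> l0; have := boundary_relation_bound l0 (pair_resolventP h l0); rewrite /= addrK.
Qed.

Lemma pair_resolvent_linear l (a : C) x y : complex.Im l != 0 ->
  pair_resolvent l (a *: x + y) = a *: pair_resolvent l x + pair_resolvent l y.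
Proof.
move=> l0; apply: boundary_resolventE => //.
have := (boundary_relation_linear l0).2 a _ _ (pair_resolventP x l0) (pair_resolventP y l0).
congr (boundary_relation l (_, _)); rewrite /= !scalerDr !scalerA [a * l]mulrC.
by rewrite addrACA.
Qed.

Lemma pair_resolvent_adjoint l x y : complex.Im l != 0 ->
  [< pair_resolvent l x, y >] = [< x, pair_resolvent (Num.conj l) y >].
Proof.
move=> l0; have m0 : complex.Im (Num.conj l) != 0 by rewrite Im_conj_neq0.
have [Au [c [c0 c1]]] := pair_resolventP x l0.
have [Av [d [d0 d1]]] := pair_resolventP y m0.
have := green Au Av; rewrite c0 c1 d0 d1 /= !innerE conjCK (bp_sym bp c d l0).
rewrite opprK addNr => e; apply/eqP; rewrite eq_sym -subr_eq0; apply/eqP.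
by rewrite -e; ring.
Qed.

Lemma pair_resolvent_Im l x : complex.Im l != 0 ->
  (complex.Im l * nrm (pair_resolvent l x)) ^+ 2 <=
  complex.Im l * complex.Im [< pair_resolvent l x, x >].
Proof.
move=> l0; have := boundary_relation_Im l0 (pair_resolventP x l0).
by rewrite /= addrK [[< x, _ >]]innerC cImJ mulrN lerN2.
Qed.

(** The operator [1 + l * (T - l)^-1] at [l = i * y]. *)
Definition remainder (y : R) (f : H) : H :=
  f + ('i * y%:C) *: pair_resolvent ('i * y%:C) f.

Lemma Im_iy (y : R) : complex.Im ('i * y%:C : C) = y.
Proof. by rewrite !ReImE; ring. Qed.

(** Weak convergence to zero on the diagonal implies strong convergence. *)
Lemma remainder_sqr (y : R) f : y != 0 ->
  nrm (remainder y f) ^+ 2 <= complex.Re [< remainder y f, f >].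
Proof.
move=> y0; have l0 : complex.Im ('i * y%:C : C) != 0 by rewrite Im_iy.
have := pair_resolvent_Im f l0; rewrite /remainder; set v := pair_resolvent _ f.
rewrite Im_iy nrm_sqrD nrmZ !exprMn innerDl inner_sqr innerZl innerZr cReD cReC.
have -> : nrm ('i * y%:C : C) ^+ 2 = y ^+ 2.
  by rewrite nrm_sqr !ReImE; ring.
by rewrite [[< f, v >]]innerC; set w := [< v, f >]; rewrite !ReImE; nra.
Qed.

End Pair.
End Triplet.

(** * The Krein-Naimark formula and Green's identity *)

Section Krein.
Context {R : realType} {H B : hilbertType R}.
Local Notation C := R[i].
Variables (A : set (H * H)) (G0 G1 : H * H -> B).
Hypothesis cso : closed_symmetric_operator A.
Hypothesis bt : boundary_triplet A G0 G1.

Local Notation As := (adjoint_relation A).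
Local Notation M := (weyl_function A G0 G1).
Local Notation gamma := (gamma_field A G0).

Lemma trivial_relation l :
  boundary_relation A G0 G1 (fun _ _ => 0) (fun _ => id) l = boundary_kernel A G0.
Proof.
apply/seteqP; split=> f [Af]; first by move=> [c [/= f0 _]]; split; rewrite // f0 oppr0.
by move=> f0; split=> //; exists (G1 f); split; rewrite //= f0 oppr0.
Qed.

Lemma kernel_resolventP l h : complex.Im l != 0 ->
  boundary_kernel A G0 (resolvent (boundary_kernel A G0) l h,
                        h + l *: resolvent (boundary_kernel A G0) l h).
Proof.
move=> l0; rewrite -(trivial_relation l).
exact: (pair_resolventP cso bt (trivial_pair (B := B)) h l0).
Qed.

Lemma eigen_relationB l f g : As f -> As g -> f.2 - l *: f.1 = g.2 - l *: g.1 ->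
  eigen_relation As l (f.1 - g.1, f.2 - g.2).
Proof.
move=> Af Ag e; split; first exact: relationB (adjoint_linear A) Af Ag.
rewrite /= -[f.2](subrK (l *: f.1)) e scalerBr.
by rewrite addrC !addrA addNr add0r addrC.
Qed.

Lemma defect_elementP l b : complex.Im l != 0 ->
  eigen_relation As l (defect_element A G0 l b) /\ G0 (defect_element A G0 l b) = b.
Proof.
move=> l0; have [f [Af f0 _]] := boundary_onto bt b 0.
have [Ar r0] := kernel_resolventP (f.2 - l *: f.1) l0.
set r := resolvent _ _ _ in Ar r0.
rewrite /defect_element; case: xgetP => [e _ //|no].
case: (no (f.1 - r, f.2 - (f.2 - l *: f.1 + l *: r))); split.
  by apply: (eigen_relationB Af Ar); rewrite /= addrK.
by rewrite (G0B bt Af Ar) r0 subr0.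
Qed.

Lemma weyl_linear l : complex.Im l != 0 -> linear (M l).
Proof.
move=> l0 a b b'.
have [[Ae le] e0] := defect_elementP b l0; have [[Ae' le'] e0'] := defect_elementP b' l0.
have [linA0 linA] := adjoint_linear A.
rewrite -[in LHS]e0 -[in LHS]e0' -(linG0 bt)// (weyl_functionE bt l0) ?(linG1 bt)//.
split; first exact: linA.
by rewrite /= le le' scalerDr !scalerA mulrC.
Qed.

Lemma gamma_linear l : complex.Im l != 0 -> linear (gamma l).
Proof.
move=> l0 a b b'.
have [[Ae le] e0] := defect_elementP b l0; have [[Ae' le'] e0'] := defect_elementP b' l0.
have [linA0 linA] := adjoint_linear A.
rewrite -[in LHS]e0 -[in LHS]e0' -(linG0 bt)// (gamma_fieldE bt l0)//.
split; first exact: linA.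
by rewrite /= le le' scalerDr !scalerA mulrC.
Qed.

(** Green's identity for a defect element and an element of [A_0]. *)
Lemma gamma_adjoint l h : complex.Im l != 0 ->
  adjoint_operator (gamma (Num.conj l)) h =
  G1 (resolvent (boundary_kernel A G0) l h, h + l *: resolvent (boundary_kernel A G0) l h).
Proof.
move=> l0; have m0 : complex.Im (Num.conj l) != 0 by rewrite Im_conj_neq0.
apply: adjoint_operatorE => b.
have [Au u0] := kernel_resolventP h l0; have [[Ae le] e0] := defect_elementP b m0.
have := green bt Au Ae; rewrite u0 e0 inner0l subr0 le /= innerDl innerZl innerZr conjCK addrK.
by move=> e; rewrite [LHS]innerC /gamma_field e -innerC.
Qed.

Section Pair.
Variables (phi psi : C -> B -> B).
Hypothesis bp : boundary_pair phi psi.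

Local Notation W l := (fun c => psi l c + M l (phi l c)).
Local Notation Rz := (pair_resolvent A G0 G1 phi psi).
Local Notation winv l := (inverse_operator (W l)).

(** Subtracting an element of [A^*] with the same image under [A^* - l] from
    the solution leaves a defect element, on whose boundary values [M l] acts. *)
Lemma boundary_difference l f : complex.Im l != 0 -> As f ->
  exists c, let v := Rz l (f.2 - l *: f.1) in
  let d := (v - f.1, l *: (v - f.1)) in
  [/\ As d, G0 d = - phi l c - G0 f, G1 d = psi l c - G1 f & G1 d = M l (G0 d)].
Proof.
move=> l0 Af; have := pair_resolventP cso bt bp (f.2 - l *: f.1) l0.
set v := Rz l _ => -[Av [c [c0 c1]]]; exists c => /=.
have [Ad ld] : eigen_relation As l (v - f.1, f.2 - l *: f.1 + l *: v - f.2).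
  by apply: (eigen_relationB Av Af); rewrite /= addrK.
have <- : (v - f.1, f.2 - l *: f.1 + l *: v - f.2) = (v - f.1, l *: (v - f.1)).
  by congr pair.
split=> //.
- by rewrite (G0B bt Av Af) c0.
- by rewrite (G1B bt Av Af) c1.
- by rewrite (weyl_functionE bt l0).
Qed.

Lemma weyl_sum_linear l : complex.Im l != 0 -> linear (W l).
Proof.
move=> l0 a b b'; rewrite (bp_psi bp l0).1 (bp_phi bp l0).1 (weyl_linear l0).
by rewrite scalerDr addrACA.
Qed.

(** A kernel element is the parameter of an eigenvector satisfying the boundary
    condition. *)
Lemma weyl_sum_inj l : complex.Im l != 0 -> injective (W l).
Proof.
move=> l0; suff ker c : W l c = 0 -> c = 0.
  move=> c c' e; apply/eqP; rewrite -subr_eq0; apply/eqP; apply: ker.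
  by rewrite (linB _ _ (weyl_sum_linear l0)) e subrr.
move=> Wc; have [[Ae le] e0] := defect_elementP (- phi l c) l0.
set e := defect_element _ _ _ _ in Ae le e0.
have e1 : G1 e = psi l c.
  have -> : G1 e = M l (- phi l c) by [].
  by rewrite (linN _ (weyl_linear l0)); apply/eqP; rewrite eq_sym -subr_eq0 opprK Wc.
have z : e.1 = 0.
  apply: (boundary_relation_eigen bt bp l0 _ le); split=> //; exists c; split=> //.
have ez : e = 0 by rewrite [e]pair_surjE le z scaler0.
have [_ [[lG0 _] [lG1 _]] _ _] := bt; have [A0 _] := adjoint_linear A.
have G00 (G : H * H -> B) : bounded_on_graph As G -> G 0 = 0.
  by move=> bG; have := graph_linearB bG A0 A0; rewrite /= !subr0 subrr.
have [_ [bG0 bG1] _ _] := bt.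
have [S bS [SK _]] := bp_inv bp l0.
rewrite -(SK c) -e1 -[phi l c]opprK -e0 ez !G00// oppr0 scaler0 addr0.
exact: (lin0 bS.1).
Qed.

Lemma weyl_sum_invE l c : complex.Im l != 0 -> winv l (W l c) = c.
Proof.
move=> l0; rewrite /inverse_operator; case: xgetP => [c' _ /= /(weyl_sum_inj l0)//|/(_ c) []//].
Qed.

(** The solution of the boundary value problem differs from that for [A_0] by a
    defect element with boundary value [- phi l c]; comparing the values of [G1]
    determines [c]. *)
Lemma krein_formula l h : complex.Im l != 0 ->
  resolvent (boundary_kernel A G0) l h
  - gamma l (relation_operator (relation_inverse
      (relation_sum (graph (M l)) (nevanlinna_family phi psi l)))
      (adjoint_operator (gamma (Num.conj l)) h)) = Rz l h.
Proof.
move=> l0; rewrite gamma_adjoint//.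
have [Au u0] := kernel_resolventP h l0; set u := resolvent _ _ _ in Au u0 *.
have [c /=] := boundary_difference l0 Au; rewrite /= addrK u0 subr0 => -[Ad d0 d1 dM].
have Wc : W l c = G1 (u, h + l *: u).
  move: dM; rewrite d0 d1 (linN _ (weyl_linear l0)) => /eqP.
  by rewrite subr_eq addrC -subr_eq opprK => /eqP.
have -> : relation_operator (relation_inverse
      (relation_sum (graph (M l)) (nevanlinna_family phi psi l))) (G1 (u, h + l *: u)) = phi l c.
  rewrite -Wc /relation_operator; case: xgetP => [x _ /=|/(_ (phi l c)) []].
    rewrite /relation_inverse /relation_sum /graph /= => -[_ [_ [-> [c' _ [ <- <-]] e]]].
    by rewrite (weyl_sum_inj l0 (_ : W l c = W l c'))// e addrC.
  by exists (M l (phi l c)), (psi l c); split=> //=; [exists c|rewrite addrC].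
have := gamma_fieldE bt l0 (f := (Rz l h - u, l *: (Rz l h - u))).
rewrite d0 (linN _ (gamma_linear l0)) /= => /(_ (conj Ad erefl)) ->.
by rewrite addrC subrK.
Qed.

(** Green's identity turns the compressed resolvent into the two functions of
    the boundary conditions. *)
Lemma boundary_form0 l f g : complex.Im l != 0 ->
  boundary_kernel A G0 f -> boundary_kernel A G0 g ->
  [< Rz l (f.2 - l *: f.1) - f.1, g.2 - Num.conj l *: g.1 >]
  = - [< phi l (winv l (G1 f)), G1 g >].
Proof.
move=> l0 [Af f0] [Ag g0]; have [c /= [Ad d0 d1 dM]] := boundary_difference l0 Af.
have := green bt Ad Ag; rewrite g0 d0 f0 subr0 /= !innerE conjCK => e.
have -> : winv l (G1 f) = c.
  rewrite -(weyl_sum_invE c l0); congr (winv l _); apply/eqP.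
  move: dM; rewrite d0 d1 f0 subr0 (linN _ (weyl_linear l0)) => /eqP.
  by rewrite subr_eq addrC -subr_eq opprK eq_sym.
move: e; rewrite sub0r opprK => e; rewrite -e; ring.
Qed.

Lemma boundary_form1 l f g : complex.Im l != 0 ->
  boundary_kernel A G1 f -> boundary_kernel A G1 g ->
  [< Rz l (f.2 - l *: f.1) - f.1, g.2 - Num.conj l *: g.1 >]
  = [< psi l (winv l (M l (G0 f))), G0 g >].
Proof.
move=> l0 [Af f1] [Ag g1]; have [c /= [Ad d0 d1 dM]] := boundary_difference l0 Af.
have := green bt Ad Ag; rewrite g1 d1 f1 subr0 /= !innerE conjCK => e.
have -> : winv l (M l (G0 f)) = - c.
  rewrite -(weyl_sum_invE (- c) l0) (linN _ (weyl_sum_linear l0)); congr (winv l _).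
  move: dM; rewrite d0 d1 f1 subr0 (linB _ _ (weyl_linear l0)) (linN _ (weyl_linear l0)) => ->.
  by rewrite addrAC addNr add0r opprK.
rewrite (linN _ (bp_psi bp l0).1) innerNl.
move: e; rewrite subr0 => e; rewrite -e; ring.
Qed.

End Pair.
End Krein.

(** * Holomorphy of the compressed resolvent *)

Ltac nonneg := repeat first
  [done | exact: nrm_ge0 | exact: ltW | apply: addr_ge0 | apply: mulr_ge0].

Section Differentiability.
Context {R : realType} {H B : hilbertType R}.
Local Notation C := R[i].

Lemma holomorphic_expansion (F : C -> B -> B) m : holomorphic_at F m ->
  exists2 D : B -> B, bounded_operator D & forall e : R, 0 < e ->
    near_point m (fun l => forall u,
      nrm (F l u - F m u - (l - m) *: D u) <= e * nrm (l - m) * nrm u).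
Proof.
move=> [D bD hD]; exists D => // e /hD[d d0 hd]; exists d => // l lm u.
have := hd l; rewrite nrmE ltcR => /(_ lm u).
by rewrite !nrmE -!rmorphM lecR.
Qed.

Lemma holomorphic_lipschitz (F : C -> B -> B) m : holomorphic_at F m ->
  exists2 K : R, 0 < K & near_point m (fun l => forall u,
    nrm (F l u - F m u) <= K * nrm (l - m) * nrm u).
Proof.
move=> /holomorphic_expansion[D bD hD].
have [c c0 hc] := bounded_operator_bound bD.
exists (c + 1); first by rewrite addr_gt0.
apply: near_pointW (hD 1 ltr01) => l h u; have := nrm_le_dist (F l u - F m u) ((l - m) *: D u).
move=> /le_trans; apply; rewrite mulrDl mulrDl lerD//.
by rewrite nrmZ mulrAC [leRHS]mulrC ler_wpM2l ?nrm_ge0.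
Qed.

Lemma near_nonreal (m : C) : complex.Im m != 0 ->
  near_point m (fun l => [/\ complex.Im l != 0, hsign l = hsign m &
     `|complex.Im l|^-1 <= 2 / `|complex.Im m|]).
Proof.
move=> m0; have p0 : 0 < `|complex.Im m| by rewrite normr_gt0.
exists (`|complex.Im m| / 2); first by rewrite divr_gt0.
move=> l lm; have := le_lt_trans (Im_le_nrm (l - m)) lm; rewrite cImD cImN => h.
have h2 : `|complex.Im m| / 2 < `|complex.Im l|.
  have := ler_normD (complex.Im m - complex.Im l) (complex.Im l).
  rewrite subrK distrC => h3; lra.
have l0 : 0 < `|complex.Im l| by apply: lt_trans h2; rewrite divr_gt0.
split; first by rewrite -normr_gt0.
  rewrite /hsign; congr (if _ then _ else _).
  move: h; rewrite ltr_norml => /andP[].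
  case: (ltrgtP (complex.Im m) 0) m0 p0 => // hm _ _.
    by rewrite ltr0_norm// => h3 h4; apply/negbTE; rewrite -leNgt; lra.
  by rewrite gtr0_norm// => h3 h4; lra.
rewrite -[leRHS]invrK invf_div lef_pV2 ?posrE ?divr_gt0//; exact: ltW.
Qed.

Lemma near_pointT (z : C) (d : R) : 0 < d -> near_point z (fun w => nrm (w - z) < d).
Proof. by move=> d0; exists d. Qed.

Variables (A : set (H * H)) (G0 G1 : H * H -> B) (phi psi : C -> B -> B).
Hypothesis cso : closed_symmetric_operator A.
Hypothesis bt : boundary_triplet A G0 G1.
Hypothesis np : nevanlinna_pair phi psi.

Local Notation As := (adjoint_relation A).
Local Notation Rz := (pair_resolvent A G0 G1 phi psi).
Let bp := nevanlinna_boundary_pair np.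

Definition solution_parameter l x c :=
  [/\ As (Rz l x, x + l *: Rz l x), G0 (Rz l x, x + l *: Rz l x) = - phi l c &
      G1 (Rz l x, x + l *: Rz l x) = psi l c].

Lemma solution_parameter_ex l x : complex.Im l != 0 -> exists c, solution_parameter l x c.
Proof. by move=> l0; have [Af [c [c0 c1]]] := pair_resolventP cso bt bp x l0; exists c. Qed.

(** Comparison of two resolvents: the term that is not of first order in
    [l - m] is a boundary term, which vanishes for [l = m]. *)
Lemma pair_resolvent_difference l m x y c d : complex.Im l != 0 -> complex.Im m != 0 ->
  solution_parameter l x c -> solution_parameter (Num.conj m) y d ->
  [< Rz l x - Rz m x, y >] = (l - m) * [< Rz l x, Rz (Num.conj m) y >]
    - ([< phi l c - phi m c, psi (Num.conj m) d >]
       - [< psi l c - psi m c, phi (Num.conj m) d >]).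
Proof.
move=> l0 m0 [Af f0 f1] [Ag g0 g1]; have := green bt Af Ag.
rewrite f0 f1 g0 g1 /= !innerE conjCK opprK => e.
rewrite (pair_resolvent_adjoint cso bt bp x y m0) (bp_sym bp c d m0).
move: e; set a := [< x, _ >]; set b := [< Rz l x, y >].
move/eqP; rewrite -subr_eq0 => /eqP e; apply/eqP; rewrite -subr_eq0; apply/eqP.
by rewrite -[RHS]oppr0 -e; ring.
Qed.

(** The inverse of [psi m + hsign m * phi m] recovers the parameter at [l] from the
    boundary values, up to a term that [|l - m|] makes small against it. *)
Lemma solution_parameter_bounded m x : complex.Im m != 0 ->
  exists2 K : R, 0 < K & near_point m (fun l => [/\ complex.Im l != 0, nrm (l - m) <= 1,
    nrm (Rz l x) <= K & forall c, solution_parameter l x c -> nrm c <= K]).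
Proof.
move=> m0; have [hol _ _ _] := np; have [_ _ hphi hpsi] := hol m m0.
have [K1 K10 n1] := holomorphic_lipschitz hphi.
have [K2 K20 n2] := holomorphic_lipschitz hpsi.
have [_ [bG0 bG1] _ _] := bt.
have [k0 k00 h0] := graph_bound bG0; have [k1 k10 h1] := graph_bound bG1.
have [S bS [SK KS]] := bp_inv bp m0; have [s s0 hs] := bounded_operator_bound bS.
pose r := 2 / `|complex.Im m| * nrm x.
pose k := (k1 + k0) * (r + (nrm x + (nrm m + 1) * r)).
have r0 : 0 <= r by rewrite mulr_ge0 ?nrm_ge0// divr_ge0.
have kk0 : 0 <= k by rewrite mulr_ge0 ?addr_ge0 ?mulr_ge0 ?addr_ge0 ?nrm_ge0// ltW.
exists (2 * s * k + r + 1).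
  by rewrite ltr_wpDl// addr_ge0// mulr_ge0// mulr_ge0// ltW.
have d0 : 0 < (2 * s * (K1 + K2))^-1 by rewrite invr_gt0 !mulr_gt0// addr_gt0.
apply: near_pointW (near_pointI (near_nonreal m0) (near_pointI (near_pointI n1 n2)
   (near_pointI (near_pointT m ltr01) (near_pointT m d0)))).
move=> l [[l0 sE Il] [[{}n1 {}n2] [lm1 lmd]]].
have Rr : nrm (Rz l x) <= r.
  apply: le_trans (pair_resolvent_bound cso bt bp x l0) _.
  by rewrite ler_wpM2r ?nrm_ge0.
split=> //; first exact: ltW.
  by rewrite (le_trans Rr)// -addrA addrCA lerDl addr_ge0// mulr_ge0// mulr_ge0// ltW.
move=> c sol; have [Af f0 f1] := sol.
set f := (_, _) in Af f0 f1.
have lb : nrm l <= nrm m + 1.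
  by apply: (le_trans (nrm_le_dist l m)); rewrite lerD2l ltW.
have f2 : nrm f.2 <= nrm x + (nrm m + 1) * r.
  by rewrite /f /=; apply: (le_trans (nrmD _ _)); rewrite lerD2l nrmZ ler_pM ?nrm_ge0.
have kl : nrm (G1 f - hsign l *: G0 f) <= k.
  apply: (le_trans (nrmB _ _)); rewrite nrmZ nrm_hsign mul1r /k mulrDl lerD//.
    by apply: (le_trans (h1 _ Af)); rewrite ler_wpM2l ?(ltW k10)// lerD.
  by apply: (le_trans (h0 _ Af)); rewrite ler_wpM2l ?(ltW k00)// lerD.
have cE : c = S (G1 f - hsign l *: G0 f - (psi l c - psi m c + hsign m *: (phi l c - phi m c))).
  by rewrite f0 f1 sE -[LHS]SK; congr S; rewrite scalerN opprK scalerBr addrACA -opprD subKr.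
have lc : nrm (psi l c - psi m c + hsign m *: (phi l c - phi m c)) <=
    (K1 + K2) * nrm (l - m) * nrm c.
  apply: (le_trans (nrmD _ _)); rewrite nrmZ nrm_hsign mul1r addrC mulrDl mulrDl.
  by rewrite lerD.
have c2 : nrm c <= s * (k + (K1 + K2) * nrm (l - m) * nrm c).
  rewrite [in leLHS]cE; apply: (le_trans (hs _)); rewrite ler_wpM2l ?(ltW s0)//.
  by apply: (le_trans (nrmB _ _)); exact: lerD.
have half : s * ((K1 + K2) * nrm (l - m) * nrm c) <= nrm c / 2.
  rewrite !mulrA [leRHS]mulrC ler_wpM2r ?nrm_ge0//.
  have : nrm (l - m) * (2 * s * (K1 + K2)) <= 1.
    by rewrite -ler_pdivlMr ?div1r ?ltW// !mulr_gt0// addr_gt0.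
  by set q := nrm (l - m); lra.
by move: c2; rewrite mulrDr; lra.
Qed.

(** The resolvent difference itself is inserted for [y] in
    [pair_resolvent_difference]. *)
Lemma solution_parameter_lipschitz m x c0 : complex.Im m != 0 ->
  solution_parameter m x c0 -> exists2 K : R, 0 < K & near_point m (fun l =>
  [/\ complex.Im l != 0, nrm (Rz l x - Rz m x) <= K * nrm (l - m) &
      forall c, solution_parameter l x c ->
        nrm c <= K /\ nrm (c - c0) <= K * nrm (l - m)]).
Proof.
move=> m0 sol0; have [hol _ _ _] := np; have [_ _ hphi hpsi] := hol m m0.
have [K1 K10 n1] := holomorphic_lipschitz hphi.
have [K2 K20 n2] := holomorphic_lipschitz hpsi.
have [_ [bG0 bG1] _ _] := bt.
have [k0 k00 h0] := graph_bound bG0; have [k1 k10 h1] := graph_bound bG1.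
have [S bS [SK KS]] := bp_inv bp m0; have [s s0 hs] := bounded_operator_bound bS.
have [K K0 bK] := solution_parameter_bounded x m0.
have m0' : complex.Im (Num.conj m) != 0 by rewrite Im_conj_neq0.
(* [p] bounds the norm of the resolvent of the conjugate point, and [q] the
   boundary values of the corresponding elements. *)
pose p := `|complex.Im (Num.conj m)|^-1.
pose q := (k0 + k1) * (p + (1 + nrm m * p)).
have p0 : 0 <= p by rewrite invr_ge0.
have q0 : 0 <= q by rewrite mulr_ge0 ?addr_ge0 ?mulr_ge0 ?nrm_ge0// ltW.
pose L := K * p + (K1 + K2) * K * q.
have L0 : 0 <= L by nonneg.
have dR l : complex.Im l != 0 -> nrm (Rz l x) <= K ->
  (forall c, solution_parameter l x c -> nrm c <= K) ->
  (forall u, nrm (phi l u - phi m u) <= K1 * nrm (l - m) * nrm u) ->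
  (forall u, nrm (psi l u - psi m u) <= K2 * nrm (l - m) * nrm u) ->
  nrm (Rz l x - Rz m x) <= L * nrm (l - m).
  move=> l0 RK cK {}n1 {}n2; set y := Rz l x - Rz m x.
  have [c solc] := solution_parameter_ex x l0.
  have [d sold] := solution_parameter_ex y m0'.
  have := pair_resolvent_difference l0 m0 solc sold; rewrite -/y inner_sqr.
  have [Ag g0 g1] := sold.
  have rp : nrm (Rz (Num.conj m) y) <= p * nrm y by exact: pair_resolvent_bound.
  have gq : nrm (Rz (Num.conj m) y) + nrm (y + Num.conj m *: Rz (Num.conj m) y) <=
     (p + (1 + nrm m * p)) * nrm y.
    rewrite mulrDl lerD// (le_trans (nrmD _ _))// mulrDl mul1r lerD2l nrmZ nrmJ -mulrA.
    by rewrite ler_wpM2l ?nrm_ge0.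
  have dphi : nrm (phi (Num.conj m) d) <= q * nrm y.
    rewrite -nrmN -g0; apply: (le_trans (h0 _ Ag)); rewrite -mulrA.
    by apply: ler_pM => //=; nonneg; rewrite lerDl ltW.
  have dpsi : nrm (psi (Num.conj m) d) <= q * nrm y.
    rewrite -g1; apply: (le_trans (h1 _ Ag)); rewrite -mulrA.
    by apply: ler_pM => //=; nonneg; rewrite lerDr ltW.
  move=> /(congr1 nrm); rewrite nrmC ger0_norm ?sqr_ge0// => e.
  have [->|y0] := eqVneq y 0; first by rewrite nrm0 mulr_ge0 ?nrm_ge0.
  have ny : 0 < nrm y by rewrite nrm_gt0.
  rewrite -(ler_pM2r ny) -expr2 e; apply: (le_trans (nrmB _ _)).
  have t1 : nrm ((l - m) * [< Rz l x, Rz (Num.conj m) y >]) <= nrm (l - m) * (K * (p * nrm y)).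
    rewrite nrmM ler_wpM2l ?nrm_ge0//; apply: (le_trans (cauchy_schwarz _ _)).
    by rewrite ler_pM ?nrm_ge0.
  have t2 : nrm [< phi l c - phi m c, psi (Num.conj m) d >] <=
      K1 * nrm (l - m) * K * (q * nrm y).
    apply: (le_trans (cauchy_schwarz _ _)); rewrite ler_pM ?nrm_ge0//.
    by apply: (le_trans (n1 _)); rewrite ler_wpM2l ?mulr_ge0 ?nrm_ge0 ?cK// ltW.
  have t3 : nrm [< psi l c - psi m c, phi (Num.conj m) d >] <=
      K2 * nrm (l - m) * K * (q * nrm y).
    apply: (le_trans (cauchy_schwarz _ _)); rewrite ler_pM ?nrm_ge0//.
    by apply: (le_trans (n2 _)); rewrite ler_wpM2l ?mulr_ge0 ?nrm_ge0 ?cK// ltW.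
  apply: (le_trans (lerD t1 (le_trans (nrmB _ _) (lerD t2 t3)))).
  by rewrite le_eqVlt; apply/orP; left; apply/eqP; rewrite /L; ring.
pose N := s * ((k1 + k0) * (L + (K + nrm m * L)) + (K1 + K2) * K).
have N0 : 0 <= N by nonneg.
exists (K + L + N); first by rewrite -addrA ltr_wpDr// addr_ge0.
apply: near_pointW (near_pointI (near_nonreal m0) (near_pointI (near_pointI n1 n2) bK)).
move=> l [[l0 sE _] [[{}n1 {}n2] [_ _ RK cK]]].
have dl := dR l l0 RK cK n1 n2.
split=> //.
  apply: (le_trans dl); rewrite ler_wpM2r ?nrm_ge0// addrAC lerDr addr_ge0// ltW//.
move=> c sol; split; first by apply: (le_trans (cK _ sol)); rewrite -addrA lerDl addr_ge0.
have [Af f0 f1] := sol; have [Ag g0 g1] := sol0.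
set f := (Rz l x, _) in Af f0 f1; set g := (Rz m x, _) in Ag g0 g1.
have Ad := relationB (adjoint_linear A) Af Ag.
have e0 := G0B bt Af Ag; have e1 := G1B bt Af Ag.
set h := (_, _) in Ad e0 e1.
have h2 : nrm h.1 + nrm h.2 <= (L + (K + nrm m * L)) * nrm (l - m).
  rewrite mulrDl lerD//= opprD addrACA subrr add0r.
  have -> : l *: Rz l x - m *: Rz m x = (l - m) *: Rz l x + m *: (Rz l x - Rz m x).
    by rewrite scalerBl scalerBr addrA subrK.
  apply: (le_trans (nrmD _ _)); rewrite !nrmZ mulrDl lerD//.
    by rewrite mulrC ler_wpM2r ?nrm_ge0.
  by rewrite -mulrA ler_wpM2l ?nrm_ge0.
have sb (a b b' : B) : (a - b) - (a - b') = b' - b by rewrite opprB addrC addrA subrK.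
have cE : c - c0 = S (G1 h - hsign m *: G0 h -
    (psi l c - psi m c + hsign m *: (phi l c - phi m c))).
  rewrite e0 e1 f0 f1 g0 g1 -[LHS]SK; congr S.
  rewrite (linB _ _ (bp_phi bp m0).1) (linB _ _ (bp_psi bp m0).1).
  by rewrite -scalerN [- (- _ - _)]opprD !opprK opprD addrACA sb -scalerBr sb.
rewrite cE; apply: (le_trans (hs _)).
rewrite 2!mulrDl; apply: (@le_trans _ _ (N * nrm (l - m))); last first.
  by rewrite lerDr addr_ge0// mulr_ge0 ?nrm_ge0// ltW.
rewrite /N -mulrA ler_wpM2l ?(ltW s0)//; apply: (le_trans (nrmB _ _)); rewrite mulrDl lerD//.
  apply: (le_trans (nrmB _ _)); rewrite nrmZ nrm_hsign mul1r -mulrA mulrDl lerD//.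
    by apply: (le_trans (h1 _ Ad)); rewrite ler_wpM2l ?(ltW k10).
  by apply: (le_trans (h0 _ Ad)); rewrite ler_wpM2l ?(ltW k00).
apply: (le_trans (nrmD _ _)); rewrite nrmZ nrm_hsign mul1r addrC !mulrDl lerD//.
  apply: (le_trans (n1 _)); rewrite mulrAC ler_wpM2r ?nrm_ge0// ler_wpM2l ?(ltW K10)//.
  exact: cK.
apply: (le_trans (n2 _)); rewrite mulrAC ler_wpM2r ?nrm_ge0// ler_wpM2l ?(ltW K20)//.
exact: cK.
Qed.

(** Replacing [phi l - phi m], [psi l - psi m] by their linear parts and the
    solution at [l] by that at [m] in [pair_resolvent_difference] costs
    [o(|l - m|)]. *)
Lemma pair_resolvent_cdiff m x y : complex.Im m != 0 ->
  cdiff (fun l => [< Rz l x, y >]) m.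
Proof.
move=> m0; have m0' : complex.Im (Num.conj m) != 0 by rewrite Im_conj_neq0.
have [hol _ _ _] := np; have [_ _ hphi hpsi] := hol m m0.
have [Dphi bDphi xphi] := holomorphic_expansion hphi.
have [Dpsi bDpsi xpsi] := holomorphic_expansion hpsi.
have [k1 k10 hk1] := bounded_operator_bound bDphi.
have [k2 k20 hk2] := bounded_operator_bound bDpsi.
have [c0 sol0] := solution_parameter_ex x m0.
have [d sold] := solution_parameter_ex y m0'.
have [K K0 lip] := solution_parameter_lipschitz m0 sol0.
set g := Rz (Num.conj m) y; set a := psi (Num.conj m) d; set b := phi (Num.conj m) d.
exists ([< Rz m x, g >] - ([< Dphi c0, a >] - [< Dpsi c0, b >])).
apply/cderivP => e e0.
pose N := K * (nrm g + (1 + k1) * nrm a + (1 + k2) * nrm b) + 1.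
have N0 : 0 < N.
  by apply: ltr_wpDl => //; nonneg.
have eN : 0 < e / N by rewrite divr_gt0.
apply: near_pointW (near_pointI lip (near_pointI (near_pointI (xphi _ eN) (xpsi _ eN))
  (near_pointT m eN))) => l [[l0 dR cK] [[{}xphi {}xpsi] lme]].
have [c solc] := solution_parameter_ex x l0; have [cb cc0] := cK c solc.
rewrite -innerBl (pair_resolvent_difference l0 m0 solc sold) -/g -/a -/b.
have -> : (l - m) * [< Rz l x, g >] - ([< phi l c - phi m c, a >] - [< psi l c - psi m c, b >])
   - (l - m) * ([< Rz m x, g >] - ([< Dphi c0, a >] - [< Dpsi c0, b >])) =
   (l - m) * [< Rz l x - Rz m x, g >]
   - (([< phi l c - phi m c - (l - m) *: Dphi c, a >] + (l - m) * [< Dphi (c - c0), a >])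
     - ([< psi l c - psi m c - (l - m) *: Dpsi c, b >] + (l - m) * [< Dpsi (c - c0), b >])).
  rewrite (linB _ _ bDphi.1) (linB _ _ bDpsi.1) !innerE; ring.
set q := nrm (l - m) in dR lme xphi xpsi cc0 *.
have q0 : 0 <= q by exact: nrm_ge0.
have t1 : nrm ((l - m) * [< Rz l x - Rz m x, g >]) <= q * (K * (e / N) * nrm g).
  rewrite nrmM ler_wpM2l//; apply: (le_trans (cauchy_schwarz _ _)).
  rewrite ler_wpM2r ?nrm_ge0//; apply: (le_trans dR); rewrite ler_wpM2l ?(ltW K0)//; exact: ltW.
have t (k : R) (D u : B -> B) (z : B) : 0 < k -> (forall x, nrm (D x) <= k * nrm x) ->
   nrm (u c - (l - m) *: D c) <= e / N * q * nrm c ->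
   nrm ([< u c - (l - m) *: D c, z >] + (l - m) * [< D (c - c0), z >]) <=
   q * (K * (e / N) * ((1 + k) * nrm z)).
  move=> kk0 hk h; apply: (le_trans (nrmD _ _)).
  have -> : q * (K * (e / N) * ((1 + k) * nrm z)) =
    e / N * q * K * nrm z + q * (k * (K * (e / N)) * nrm z) by ring.
  rewrite lerD//.
    apply: (le_trans (cauchy_schwarz _ _)); rewrite ler_wpM2r ?nrm_ge0//.
    by apply: (le_trans h); rewrite ler_wpM2l// mulr_ge0// ltW.
  rewrite nrmM ler_wpM2l//; apply: (le_trans (cauchy_schwarz _ _)).
  rewrite ler_wpM2r ?nrm_ge0//; apply: (le_trans (hk _)); rewrite ler_wpM2l ?(ltW kk0)//.
  by apply: (le_trans cc0); rewrite ler_wpM2l ?(ltW K0)// ltW.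
have t2 := t k1 Dphi (fun c => phi l c - phi m c) a k10 hk1 (xphi c).
have t3 := t k2 Dpsi (fun c => psi l c - psi m c) b k20 hk2 (xpsi c).
apply: (le_trans (nrmB _ _)).
apply: (le_trans (lerD t1 (le_trans (nrmB _ _) (lerD t2 t3)))).
have -> : q * (K * (e / N) * nrm g) +
    (q * (K * (e / N) * ((1 + k1) * nrm a)) + q * (K * (e / N) * ((1 + k2) * nrm b))) =
    q * (e / N) * (N - 1) by rewrite /N; ring.
rewrite [leRHS]mulrC -mulrA ler_wpM2l// mulrAC ler_pdivrMr// ler_wpM2l ?(ltW e0)//.
by rewrite gerBl.
Qed.

End Differentiability.

(** * Strong limits along the imaginary axis *)

Section Vanishing.
Context {R : realType}.
Local Notation C := R[i].

Definition vanishes {V : normedZmodType C} (F : R -> V) :=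
  forall e : R, 0 < e -> exists Y : R, forall y, Y <= y -> nrm (F y) <= e.

Lemma vanishes_le {V W : normedZmodType C} (F : R -> V) (G : R -> W) (Y0 : R) :
  (forall y, Y0 <= y -> nrm (F y) <= nrm (G y)) -> vanishes G -> vanishes F.
Proof.
move=> FG vG e /vG[Y hY]; exists (Num.max Y Y0) => y; rewrite ge_max => /andP[/hY h /FG].
by move=> /le_trans; apply.
Qed.

Lemma vanishesD {V : normedZmodType C} (F G : R -> V) :
  vanishes F -> vanishes G -> vanishes (fun y => F y + G y).
Proof.
move=> vF vG e e0; have e2 := divr_gt0 e0 (ltr0n R 2).
have [Y hY] := vF _ e2; have [Z hZ] := vG _ e2.
exists (Num.max Y Z) => y; rewrite ge_max => /andP[/hY h1 /hZ h2].
by apply: (le_trans (nrmD _ _)); rewrite [leRHS](splitr e) lerD.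
Qed.

Lemma vanishes_inv {V : normedZmodType C} (F : R -> V) (c : R) :
  (forall y, 1 <= y -> nrm (F y) <= y^-1 * c) -> vanishes F.
Proof.
move=> hF e e0; exists (Num.max 1 (`|c| / e)) => y; rewrite ge_max => /andP[y1 cy].
have y0 : 0 < y by apply: lt_le_trans y1.
apply: (le_trans (hF _ y1)); rewrite ler_pdivrMl//.
by apply: (le_trans (ler_norm c)); rewrite -ler_pdivrMr.
Qed.

Lemma vanishes_sqr {V : normedZmodType C} (F : R -> V) (G : R -> C) :
  (forall y, 1 <= y -> nrm (F y) ^+ 2 <= complex.Re (G y)) -> vanishes G -> vanishes F.
Proof.
move=> FG vG e e0; have [Y hY] := vG (e ^+ 2) (exprn_gt0 2 e0).
exists (Num.max 1 Y) => y; rewrite ge_max => /andP[/FG h1 /hY h2].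
rewrite -ler_sqr ?nnegrE ?nrm_ge0 ?(ltW e0)//; apply: (le_trans h1).
by apply: le_trans h2; apply: le_trans (ler_norm _) (Re_le_nrm _).
Qed.

Lemma weak_lim0P {U V : hilbertType R} (F : R -> U -> V) :
  weak_lim0_pinfty F <-> forall u v, vanishes (fun y => [< F y u, v >]).
Proof.
split=> hF u v.
  move=> e e0; have := hF u v; move/cvgrPdist_lt => /(_ e%:C).
  rewrite ltcR => /(_ e0)[Y [_ hY]]; exists (Y + 1) => y Yy.
  have := hY y; rewrite sub0r normrN nrmE ltcR => h; apply/ltW/h.
  by apply: lt_le_trans Yy; rewrite ltrDl.
apply/cvgrPdist_lt => e e0.
have Ie : complex.Im e = 0 by exact: ger0_Im (ltW e0).
have eE : e = (complex.Re e)%:C by apply: complex_eq.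
have r0 : 0 < complex.Re e by rewrite -ltcR -eE.
have [Y hY] := hF u v _ (divr_gt0 r0 (ltr0n R 2)).
exists Y; split; first exact: num_real.
move=> y /ltW/hY h; rewrite sub0r normrN nrmE eE ltcR; apply: (le_lt_trans h).
by rewrite ltr_pdivrMr// ltr_pMr// ltr1n.
Qed.

(** The vectors along which a bounded family vanishes form a closed subspace. *)
Lemma vanishes_total {V : hilbertType R} {W : normedModType C} (S : set V)
    (F : R -> V -> W) (c : R) :
  (forall y, 1 <= y -> linear (F y)) ->
  (forall y x, 1 <= y -> nrm (F y x) <= c * nrm x) ->
  (forall g, (forall s, S s -> [< s, g >] = 0) -> g = 0) ->
  (forall s, S s -> vanishes (fun y => F y s)) -> forall x, vanishes (fun y => F y x).
Proof.
move=> lF bF totS vS x; pose D := [set x | vanishes (fun y => F y x)].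
have F0 y : 1 <= y -> F y 0 = 0 by move=> /lF; exact: lin0.
suff : D x by [].
apply: double_orthogonal.
- split=> [e e0|a u v Du Dv]; first by exists 1 => y /F0 ->; rewrite nrm0 ltW.
  apply: (@vanishes_le _ _ _ (fun y => a *: F y u + F y v) 1).
    by move=> y /lF ->.
  apply: vanishesD Dv => e e0; have a0 : 0 < nrm a + 1 by rewrite ltr_wpDl ?nrm_ge0.
  have [Y hY] := Du _ (divr_gt0 e0 a0); exists Y => y /hY; rewrite ler_pdivlMr// => h.
  rewrite nrmZ mulrC; apply: le_trans h; rewrite ler_wpM2l ?nrm_ge0//.
  by rewrite lerDl.
- move=> u l Du ul e e0; have c0 : 0 < `|c| + 1 by rewrite ltr_wpDl.
  have e2 := divr_gt0 e0 (ltr0n R 2).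
  have [N /(_ N (leqnn N)) hN] := ul _ (divr_gt0 e2 c0).
  have [Y hY] := Du N _ e2; exists (Num.max 1 Y) => y; rewrite ge_max => /andP[y1 /hY h].
  have -> : F y l = F y (l - u N) + F y (u N).
    have := lF y y1 1 (l - u N) (u N); rewrite !scale1r subrK //.
  apply: (le_trans (nrmD _ _)); rewrite [leRHS](splitr e) lerD//.
  apply: (le_trans (bF _ _ y1)); rewrite nrmBC; move: hN; rewrite ltr_pdivlMr// => hN.
  apply: le_trans (ltW hN); rewrite mulrC ler_wpM2l ?nrm_ge0//.
  by apply: (le_trans (ler_norm c)); rewrite lerDl.
- move=> y hy; suff -> : y = 0 by rewrite inner0r.
  by apply: totS => s /vS; exact: hy.
Qed.

Lemma Im_iy_neq0 (y : R) : 1 <= y -> complex.Im ('i * y%:C : C) != 0.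
Proof. by move=> y1; rewrite Im_iy gt_eqF// (lt_le_trans _ y1). Qed.

Lemma nrm_iy (y : R) : 1 <= y -> nrm ('i * y%:C : C) = y.
Proof.
by move=> y1; rewrite nrmM nrm_i mul1r nrmC ger0_norm// (le_trans _ y1).
Qed.

(** On the domain of [T] the family is [(T - l)^-1 * T], of order [1 / y], and the
    domain is dense because [T] is an operator. *)
Lemma selfadjoint_operator_vanishes {K : hilbertType R} (T : set (K * K)) k :
  selfadjoint_relation T -> is_operator T ->
  vanishes (fun y => k + ('i * y%:C) *: resolvent T ('i * y%:C) k).
Proof.
move=> saT opT; have linT := selfadjoint_linear saT; have symT := selfadjoint_symmetric saT.
have linR l : complex.Im l != 0 -> linear (resolvent T l).
  move=> l0 a x y; apply: resolventE => //.
  have := linT.2 a _ _ (selfadjoint_resolvent x saT l0) (selfadjoint_resolvent y saT l0).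
  by congr (T (_, _)); rewrite /= !scalerDr !scalerA [a * l]mulrC addrACA.
have bR y x : 1 <= y -> nrm (resolvent T ('i * y%:C) x) <= y^-1 * nrm x.
  move=> y1; have := resolvent_bound x saT (Im_iy_neq0 y1).
  by rewrite Im_iy ger0_norm// (le_trans _ y1).
pose F (y : R) (x : K) := x + ('i * y%:C) *: resolvent T ('i * y%:C) x.
apply: (@vanishes_total _ _ [set x | exists x', T (x, x')] F 2).
- move=> y y1 a u v; rewrite /F (linR _ (Im_iy_neq0 y1)).
  by rewrite !scalerDr !scalerA [a * _]mulrC addrACA.
- move=> y x y1; apply: (le_trans (nrmD _ _)); rewrite mulrDl mul1r lerD2l nrmZ nrm_iy//.
  by rewrite -ler_pdivlMl ?bR// (lt_le_trans _ y1).
- move=> g hg; suff : mul_part T g by rewrite opT.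
  rewrite /mul_part /= -saT => f Tf /=; rewrite inner0l innerC hg ?conj0//.
  by exists f.2; rewrite -pair_surjE.
- move=> x [x' Tx]; apply: (@vanishes_inv _ _ (nrm x')) => y y1.
  suff -> : F y x = resolvent T ('i * y%:C) x' by exact: bR.
  have l0 := Im_iy_neq0 y1; set l := 'i * y%:C in l0 *.
  have e : resolvent T l (x' - l *: x) = x by apply: resolventE => //; rewrite subrK.
  by rewrite /F -/l -[X in X + _]e (linB _ _ (linR _ l0)) (linZ _ _ (linR _ l0)) subrK.
Qed.

End Vanishing.

(** * Admissibility *)

Section Admissibility.
Context {R : realType} {H B : hilbertType R}.
Local Notation C := R[i].

Lemma swapped_pair : boundary_pair (fun _ : C => @id B) (fun _ _ => 0).
Proof.
have [bid bz _ _ _] := trivial_pair (B := B).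
split=> //.
- by move=> l c _; rewrite inner0l cIm0 mulr0.
- by move=> l c d _; rewrite inner0l inner0r.
- move=> l l0; have s0 : hsign l != 0 by rewrite -nrm_eq0 nrm_hsign oner_eq0.
  exists (fun c => (hsign l)^-1 *: c); last first.
    by split=> c; rewrite add0r scalerA ?mulVf ?divff// scale1r.
  apply: (@linear_continuous_bounded R B B _ 1) => [a x y|x].
    by rewrite scalerDr !scalerA mulrC.
  by rewrite nrmZ nrmV nrm_hsign invr1 mul1r.
Qed.

Lemma closed_sequentially (T : set (H * H)) : closed T -> closed_relation T.
Proof.
move=> clT u v a b Tuv /tendsP ua /tendsP vb.
have uvab : (u n, v n) @[n --> \oo] --> (a, b) by exact: cvg_pair.
by apply: (closed_cvg (u_ := fun n => (u n, v n)) T clT (nearW _ Tuv) _ uvab).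
Qed.

Variables (A : set (H * H)) (G0 G1 : H * H -> B).
Hypothesis cso : closed_symmetric_operator A.
Hypothesis bt : boundary_triplet A G0 G1.
Local Notation As := (adjoint_relation A).

(** The resolvent at ['i] of an element [g] orthogonal to the domain vanishes, by
    [pair_resolvent_Im]. *)
Lemma pair_mul_part phi psi g : boundary_pair phi psi ->
  (forall f, boundary_relation A G0 G1 phi psi 'i f -> [< f.1, g >] = 0) ->
  boundary_relation A G0 G1 phi psi 'i (0, g).
Proof.
move=> bp hg; have i0 : complex.Im ('i : C) != 0 by rewrite cIm_i oner_eq0.
have := pair_resolventP cso bt bp g i0; have := pair_resolvent_Im cso bt bp g i0.
set v := pair_resolvent _ _ _ _ _ _ _ => h Tv.
suff v0 : v = 0 by move: Tv; rewrite v0 scaler0 addr0.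
have := hg _ Tv; rewrite /= => e; move: h; rewrite e cIm0 mulr0 cIm_i mul1r => h.
apply/eqP; rewrite -nrm_eq0 -sqrf_eq0 eq_le h sqr_ge0 //.
Qed.

Lemma swapped_relation l :
  boundary_relation A G0 G1 (fun _ => id) (fun _ _ => 0) l = boundary_kernel A G1.
Proof.
apply/seteqP; split=> f [Af]; first by move=> [c [/= _ f1]]; split.
by move=> f1; split=> //; exists (- G0 f); rewrite opprK.
Qed.

Lemma kernel0_total g : is_operator (boundary_kernel A G0) ->
  (forall f, boundary_kernel A G0 f -> [< f.1, g >] = 0) -> g = 0.
Proof.
move=> op hg; suff : mul_part (boundary_kernel A G0) g by rewrite op.
rewrite /mul_part /= -(@trivial_relation _ _ _ A G0 G1 'i).
by apply: pair_mul_part trivial_pair _ => f; rewrite trivial_relation; exact: hg.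
Qed.

Lemma kernel1_total g : is_operator (boundary_kernel A G1) ->
  (forall f, boundary_kernel A G1 f -> [< f.1, g >] = 0) -> g = 0.
Proof.
move=> op hg; suff : mul_part (boundary_kernel A G1) g by rewrite op.
rewrite /mul_part /= -(swapped_relation 'i).
by apply: pair_mul_part swapped_pair _ => f; rewrite swapped_relation; exact: hg.
Qed.

(** By Green's identity an element of [A^*] without boundary values lies in the
    second adjoint of [A], and [A] is closed. *)
Lemma zero_boundary_values f : As f -> G0 f = 0 -> G1 f = 0 -> A f.
Proof.
move=> Af f0 f1; have i0 : complex.Im ('i : C) != 0 by rewrite cIm_i oner_eq0.
have [linA clA _ symA'] := cso.
have [v Av] : exists v, A (v, (f.2 - 'i *: f.1) + 'i *: v).
  apply: (range_double_orthogonal linA (closed_sequentially clA)) => [g Ag|y hy].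
    exact: (symmetric_resolvent_bound symA' i0 Ag).
  have Ay : As (y, Num.conj 'i *: y).
    move=> g Ag /=; have := hy g Ag; rewrite !innerE => /eqP; rewrite subr_eq0 => /eqP e.
    by rewrite [in RHS]innerC e conjM -innerC.
  have := green bt Af Ay; rewrite f0 f1 !inner0l subrr /= innerBl innerZl innerZr conjCK //.
have Asv := symA' _ Av; have [v0 v1] := boundary_values0 cso bt Av.
have [Ad ed] : eigen_relation As 'i (f.1 - v, f.2 - (f.2 - 'i *: f.1 + 'i *: v)).
  by apply: (eigen_relationB Af Asv); rewrite /= addrK.
have d1 : f.1 - v = 0.
  have bk : boundary_relation A G0 G1 (fun _ _ => 0) (fun _ => id) 'i
      (f.1 - v, f.2 - (f.2 - 'i *: f.1 + 'i *: v)).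
    rewrite trivial_relation; split=> //.
    by rewrite (G0B bt Af Asv) f0 v0 subrr.
  exact: (boundary_relation_eigen bt trivial_pair i0 bk ed).
suff -> : f = (v, f.2 - 'i *: f.1 + 'i *: v) by [].
by move/eqP: d1; rewrite subr_eq0 => /eqP d1; rewrite [LHS]pair_surjE d1 subrK.
Qed.

(** For [g] orthogonal to the domain of [A^*], the pair [(0, g)] lies in [A_0] and
    in [A_1], hence in [A]. *)
Lemma adjoint_total g : (forall f, As f -> [< f.1, g >] = 0) -> g = 0.
Proof.
move=> hg; have [_ _ op _] := cso; suff : mul_part A g by rewrite op.
have : boundary_relation A G0 G1 (fun _ _ => 0) (fun _ => id) 'i (0, g).
  by apply: pair_mul_part trivial_pair _ => f [Af _]; exact: hg.
have : boundary_relation A G0 G1 (fun _ => id) (fun _ _ => 0) 'i (0, g).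
  by apply: pair_mul_part swapped_pair _ => f [Af _]; exact: hg.
rewrite swapped_relation trivial_relation => -[Ag g1] [_ g0].
exact: zero_boundary_values.
Qed.

Variables (phi psi : C -> B -> B).
Hypothesis np : nevanlinna_pair phi psi.
Let bp := nevanlinna_boundary_pair np.
Local Notation Rz := (pair_resolvent A G0 G1 phi psi).
Local Notation Q := (remainder A G0 G1 phi psi).
Local Notation M := (weyl_function A G0 G1).
Local Notation winv l := (inverse_operator (fun h => psi l h + M l (phi l h))).

Lemma remainder_linear y : 1 <= y -> linear (Q y).
Proof.
move=> y1 a u v; rewrite /remainder (pair_resolvent_linear cso bt bp _ _ _ (Im_iy_neq0 y1)).
by rewrite !scalerDr !scalerA [a * _]mulrC addrACA.
Qed.

Lemma axis_resolvent_bound y x : 1 <= y -> nrm (Rz ('i * y%:C) x) <= y^-1 * nrm x.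
Proof.
move=> y1; have := pair_resolvent_bound cso bt bp x (Im_iy_neq0 y1).
by rewrite Im_iy ger0_norm// (le_trans _ y1).
Qed.

Lemma remainder_bound y x : 1 <= y -> nrm (Q y x) <= 2 * nrm x.
Proof.
move=> y1; apply: (le_trans (nrmD _ _)); rewrite mulrDl mul1r lerD2l nrmZ nrm_iy//.
by rewrite -ler_pdivlMl ?axis_resolvent_bound// (lt_le_trans _ y1).
Qed.

(** At [f2 - l * f1] the resolvent takes the value [R(l) f2 - l * R(l) f1], so the
    form contains [l * <Q f1, g1>]; its other terms are bounded. *)
Lemma form_asymptotics f g :
  vanishes (fun y => [< Q y f.1, g.1 >]) <->
  vanishes (fun y => (y^-1)%:C * [< Rz ('i * y%:C) (f.2 - ('i * y%:C) *: f.1) - f.1,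
                                   g.2 - Num.conj ('i * y%:C) *: g.1 >]).
Proof.
pose E y := [< Rz ('i * y%:C) (f.2 - ('i * y%:C) *: f.1) - f.1,
                                   g.2 - Num.conj ('i * y%:C) *: g.1 >].
have vd : vanishes (fun y => (y^-1)%:C * E y - 'i * [< Q y f.1, g.1 >]).
  apply: (@vanishes_inv _ _ _ (nrm f.2 * nrm g.2 + nrm f.2 * nrm g.1 + 2 * nrm f.1 * nrm g.2)).
  move=> y y1; have y0 : 0 < y by apply: lt_le_trans y1.
  have l0 := Im_iy_neq0 y1; have nl := nrm_iy y1.
  have linR : linear (Rz ('i * y%:C)).
    by move=> a u v; exact: (pair_resolvent_linear cso bt bp).
  have r2 := axis_resolvent_bound f.2 y1; have q1 := remainder_bound f.1 y1.
  have yV : y^-1 <= 1 by rewrite invf_le1.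
  set l := 'i * y%:C in l0 nl linR r2 *.
  have -> : (y^-1)%:C * E y - 'i * [< Q y f.1, g.1 >] =
     (y^-1)%:C * ([< Rz l f.2, g.2 >] - l * [< Rz l f.2, g.1 >] - [< Q y f.1, g.2 >]).
    rewrite /E -/l (linB _ _ linR) (linZ _ _ linR).
    have -> : Rz l f.2 - l *: Rz l f.1 - f.1 = Rz l f.2 - Q y f.1.
      by rewrite /remainder -/l -addrA -opprD [l *: _ + _]addrC.
    have -> : 'i = (y^-1)%:C * l :> C.
      by rewrite /l realCV mulrCA mulVf ?mulr1// eq_complex /= gt_eqF.
    by rewrite !innerE conjCK; ring.
  rewrite nrmM nrmC ger0_norm ?invr_ge0 ?(ltW y0)// ler_wpM2l ?invr_ge0 ?(ltW y0)//.
  apply: (le_trans (nrmB _ _)); rewrite lerD//; last first.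
    by apply: (le_trans (cauchy_schwarz _ _)); rewrite ler_wpM2r ?nrm_ge0.
  apply: (le_trans (nrmB _ _)); rewrite lerD//.
    apply: (le_trans (cauchy_schwarz _ _)); rewrite ler_wpM2r ?nrm_ge0//.
    by apply: (le_trans r2); rewrite ler_piMl ?nrm_ge0.
  rewrite nrmM nl; apply: (@le_trans _ _ (y * (nrm (Rz l f.2) * nrm g.1))).
    by rewrite ler_wpM2l ?(ltW y0)// cauchy_schwarz.
  by rewrite mulrA ler_wpM2r ?nrm_ge0// -ler_pdivlMl.
have iN (F : R -> C) y : nrm ('i * F y) = nrm (F y) by rewrite nrmM nrm_i mul1r.
split=> h.
  have hi : vanishes (fun y => 'i * [< Q y f.1, g.1 >]).
    by apply: (@vanishes_le _ _ _ _ _ 0) h => y _; rewrite (iN (fun y => [< Q y f.1, g.1 >])).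
  apply: (@vanishes_le _ _ _ _ _ 0) (vanishesD vd hi) => y _.
  by rewrite subrK.
have vN : vanishes (fun y => - ((y^-1)%:C * E y - 'i * [< Q y f.1, g.1 >])).
  by apply: (@vanishes_le _ _ _ _ _ 0) vd => y _; rewrite nrmN.
apply: (@vanishes_le _ _ _ _ _ 0) (vanishesD vN h) => y _.
by rewrite opprB -/(E y) subrK (iN (fun y => [< Q y f.1, g.1 >])).
Qed.

(** [G1] maps [A_0] onto [B], so the form on [A_0] tests all pairs of vectors. *)
Lemma condition_a : weak_lim0_pinfty (fun (y : R) (h : B) =>
    (y^-1)%:C *: phi ('i * y%:C) (winv ('i * y%:C) h)) <->
  (forall f g, boundary_kernel A G0 f -> boundary_kernel A G0 g ->
     vanishes (fun y => [< Q y f.1, g.1 >])).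
Proof.
rewrite weak_lim0P; split=> [h f g Af Ag|h u v].
  rewrite form_asymptotics; apply: (@vanishes_le _ _ _ _ _ 1) (h (G1 f) (G1 g)) => y y1.
  by rewrite (boundary_form0 cso bt bp (Im_iy_neq0 y1) Af Ag) mulrN nrmN innerZl.
have [f [Af f0 <-]] := boundary_onto bt 0 u; have [g [Ag g0 <-]] := boundary_onto bt 0 v.
have := h f g (conj Af f0) (conj Ag g0); rewrite form_asymptotics.
apply: (@vanishes_le _ _ _ _ _ 1) => y y1.
by rewrite (boundary_form0 cso bt bp (Im_iy_neq0 y1))// mulrN nrmN innerZl.
Qed.

(** [G0] maps [A_1] onto [B]. *)
Lemma condition_b : weak_lim0_pinfty (fun (y : R) (h : B) =>
    (y^-1)%:C *: psi ('i * y%:C) (winv ('i * y%:C) (M ('i * y%:C) h))) <->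
  (forall f g, boundary_kernel A G1 f -> boundary_kernel A G1 g ->
     vanishes (fun y => [< Q y f.1, g.1 >])).
Proof.
rewrite weak_lim0P; split=> [h f g Af Ag|h u v].
  rewrite form_asymptotics; apply: (@vanishes_le _ _ _ _ _ 1) (h (G0 f) (G0 g)) => y y1.
  by rewrite (boundary_form1 cso bt bp (Im_iy_neq0 y1) Af Ag) innerZl.
have [f [Af <- f1]] := boundary_onto bt u 0; have [g [Ag <- g1]] := boundary_onto bt v 0.
have := h f g (conj Af f1) (conj Ag g1); rewrite form_asymptotics.
apply: (@vanishes_le _ _ _ _ _ 1) => y y1.
by rewrite (boundary_form1 cso bt bp (Im_iy_neq0 y1))// innerZl.
Qed.

Lemma remainder_vanishes f : vanishes (fun y => [< Q y f, f >]) -> vanishes (fun y => Q y f).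
Proof.
apply: vanishes_sqr => y y1; apply: (remainder_sqr cso bt bp).
by rewrite gt_eqF// (lt_le_trans _ y1).
Qed.

Lemma remainder_total (S : set H) : (forall g, (forall s, S s -> [< s, g >] = 0) -> g = 0) ->
  (forall f, S f -> vanishes (fun y => Q y f)) -> forall f, vanishes (fun y => Q y f).
Proof.
move=> totS hS; apply: (@vanishes_total _ _ _ S Q 2) => // [y|y x]; first exact: remainder_linear.
exact: remainder_bound.
Qed.

Local Notation admissible := (Pi_admissible A G0 G1 (nevanlinna_family phi psi)).

Lemma isometric_bounded {K : hilbertType R} (J : H -> K) :
  isometric_embedding J -> bounded_operator J.
Proof.
move=> [lJ iJ]; apply: (@linear_continuous_bounded _ _ _ _ 1) => // x.
by rewrite mul1r -ler_sqr ?nnegrE ?nrm_ge0// -lecR -!inner_sqr iJ.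
Qed.

(** The projection onto [J(H)], read in [H], is the adjoint of [J]. *)
Lemma projection_ontoP {K : hilbertType R} (J : H -> K) k g : isometric_embedding J ->
  [< projection_onto J k, g >] = [< k, J g >].
Proof.
move=> isoJ; have aP := adjoint_operatorP (isometric_bounded isoJ); have [lJ iJ] := isoJ.
rewrite /projection_onto; case: xgetP => [h _ /= /(_ g)|/(_ (adjoint_operator J k)) []].
  by rewrite innerBl iJ => /eqP; rewrite subr_eq0 => /eqP ->.
by move=> x /=; rewrite innerBl iJ [[< k, _ >]]innerC aP -innerC subrr.
Qed.

Lemma projection_ontoE {K : hilbertType R} (J : H -> K) k h : isometric_embedding J ->
  (forall g, [< k, J g >] = [< h, g >]) -> projection_onto J k = h.
Proof. by move=> isoJ hk; apply: inner_ext => g; rewrite projection_ontoP. Qed.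

(** [Q] is the compression of [1 + l * (At - l)^-1]. *)
Lemma admissible_vanishes f g : admissible -> vanishes (fun y => [< Q y f, g >]).
Proof.
move=> [K [J [At [[isoJ [_ saAt] _ _ krein] opAt]]]].
have v := selfadjoint_operator_vanishes (J f) saAt opAt.
apply: (@vanishes_le _ _ _ _ (fun y => (nrm (J g))%:C *:
   (J f + ('i * y%:C) *: resolvent At ('i * y%:C) (J f))) 1).
  move=> y y1; have l0 := Im_iy_neq0 y1; set l := 'i * y%:C in l0 *.
  rewrite /remainder -/l -(krein_formula cso bt bp f l0) -(krein l l0).
  rewrite innerDl innerZl (projection_ontoP _ _ isoJ) -isoJ.2 -innerZl -innerDl.
  by rewrite nrmZ nrmC ger0_norm ?nrm_ge0// mulrC cauchy_schwarz.
move=> e e0; have g0 : 0 < nrm (J g) + 1 by rewrite ltr_wpDl ?nrm_ge0.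
have [Y hY] := v _ (divr_gt0 e0 g0); exists Y => y /hY; rewrite ler_pdivlMr// => h.
rewrite nrmZ nrmC ger0_norm ?nrm_ge0// mulrC; apply: le_trans h.
by rewrite ler_wpM2l ?nrm_ge0// lerDl.
Qed.

(** That the realization extends [A] follows from equality in Cauchy-Schwarz: for
    [f] in [A] the vector [e('i, f2 - 'i * f1)] has the norm of [f1] and projects
    to it. *)
Lemma vanishes_admissible : (forall f, vanishes (fun y => Q y f)) -> admissible.
Proof.
move=> vQ; have grz : generalized_resolvent Rz.
  split.
  - by move=> l a x y; exact: (pair_resolvent_linear cso bt bp).
  - by move=> l x y; exact: (pair_resolvent_adjoint cso bt bp).
  - move=> l x l0; have := pair_resolvent_Im cso bt bp x (lt0r_neq0 l0).
    by move=> /(le_trans (sqr_ge0 _)); rewrite pmulr_rge0.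
  - by move=> l x y; exact: (pair_resolvent_cdiff cso bt np).
  - by move=> x; exact: vQ.
have [K [J [At [e [[isoJ saAt opAt minAt] [Ate eJ ee]]]]]] := realization grz.
have linAt := selfadjoint_linear saAt; have symAt := selfadjoint_symmetric saAt.
exists K, J, At; split=> //; split=> //.
  move=> f Af; have i0 : complex.Im ('i : C) != 0 by rewrite cIm_i oner_eq0.
  set h := f.2 - 'i *: f.1.
  have Rh : Rz 'i h = f.1.
    apply: (boundary_resolventE cso bt bp i0).
    by rewrite subrK -pair_surjE; exact: (boundary_relation_sub cso bt bp i0 Af).
  have [_ _ _ symA'] := cso.
  have sqr : nrm (e 'i h) ^+ 2 = nrm f.1 ^+ 2.
    have := ee 'i h i0.
    rewrite [[< Rz (Num.conj 'i) h, h >]]innerC -(pair_resolvent_adjoint cso bt bp h h i0) Rh.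
    have := symA' _ Af _ Af; rewrite /h => e0; rewrite inner_sqr innerBr innerZr inner_sqr.
    have : complex.Im [< f.1, f.2 >] = 0.
      by have := congr1 (@complex.Im R) e0; rewrite [in LHS]innerC cImJ; lra.
    move=> e1 /(congr1 (@complex.Im R)); rewrite !ReImE e1; nra.
  have eE : e 'i h = J f.1.
    apply/eqP; rewrite -subr_eq0 -nrm_eq0 -sqrf_eq0 nrm_sqrB sqr eJ// Rh inner_sqr cReC.
    have -> : nrm (J f.1) ^+ 2 = nrm f.1 ^+ 2.
      by have := isoJ.2 f.1 f.1; rewrite !inner_sqr => /(congr1 (@complex.Re R)).
    by apply/eqP; ring.
  have := Ate 'i h i0; rewrite eE -(linZ _ _ isoJ.1) -(linD _ _ isoJ.1) /h subrK.
  by [].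
move=> l l0 f; rewrite (krein_formula cso bt bp f l0).
apply: projection_ontoE => // g.
by rewrite (resolventE linAt symAt l0 (Ate l f l0)) eJ.
Qed.

End Admissibility.

Theorem theorem7p5 (R : realType) (H B : hilbertType R) (A : set (H * H))
    (G0 G1 : H * H -> B) (phi psi : R[i] -> B -> B) :
  closed_symmetric_operator A ->
  equal_defect_numbers A ->
  boundary_triplet A G0 G1 ->
  nevanlinna_pair phi psi ->
  let M := weyl_function A G0 G1 in
  let iy (y : R) : R[i] := 'i * y%:C in
  let admissible := Pi_admissible A G0 G1 (nevanlinna_family phi psi) in
  let inv (y : R) : B -> B :=
    inverse_operator (fun h => psi (iy y) h + M (iy y) (phi (iy y) h)) in
  let cond_a := weak_lim0_pinfty (fun (y : R) (h : B) =>
    (y^-1)%:C *: phi (iy y) (inv y h)) in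
  let cond_b := weak_lim0_pinfty (fun (y : R) (h : B) =>
    (y^-1)%:C *: psi (iy y) (inv y (M (iy y) h))) in
  [/\ admissible <-> cond_a /\ cond_b,
      is_operator (boundary_kernel A G0) -> (admissible <-> cond_a)
    & is_operator (boundary_kernel A G1) -> (admissible <-> cond_b)].
Proof.
move=> cso _ bt np M iy admissible inv cond_a cond_b.
have ca : cond_a <-> _ := condition_a cso bt np.
have cb : cond_b <-> _ := condition_b cso bt np.
have nec : admissible -> cond_a /\ cond_b.
  by move=> adm; rewrite ca cb; split=> f g _ _; exact: (admissible_vanishes cso bt np _ _ adm).
have va f : cond_a -> boundary_kernel A G0 f ->
    vanishes (fun y => remainder A G0 G1 phi psi y f.1).
  by rewrite ca => h Af; apply: (remainder_vanishes cso bt np); exact: h.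
have vb f : cond_b -> boundary_kernel A G1 f ->
    vanishes (fun y => remainder A G0 G1 phi psi y f.1).
  by rewrite cb => h Af; apply: (remainder_vanishes cso bt np); exact: h.
have suf (T : set (H * H)) :
    (forall g, (forall f, T f -> [< f.1, g >] = 0) -> g = 0) ->
    (forall f, T f -> vanishes (fun y => remainder A G0 G1 phi psi y f.1)) -> admissible.
  move=> totT vT; apply: (vanishes_admissible cso bt np).
  apply: (remainder_total cso bt np (S := [set x | exists2 f, T f & f.1 = x])).
    by move=> g hg; apply: totT => f Tf; apply: hg; exists f.
  by move=> _ [f Tf <-]; exact: vT.
split.
(* Subtract from [f] the element of [A_0] with the same value of [G1]. *)
- split=> // -[a b]; apply: (suf _ (adjoint_total cso bt)) => f Af.
  have [f0 [Af0 f00 f01]] := boundary_onto bt 0 (G1 f).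
  have Ad := relationB (adjoint_linear A) Af Af0.
  have := vanishesD (va f0 a (conj Af0 f00)) (vb _ b (conj Ad _)).
  rewrite (G1B bt Af Af0) f01 subrr => /(_ erefl).
  apply: (@vanishes_le _ _ _ _ _ 1) => y y1 /=.
  by rewrite -(linD _ _ (remainder_linear cso bt np y1)) addrC subrK.
- move=> op; split=> [/nec[]//|a].
  by apply: (suf _ (fun g => kernel0_total cso bt op (g := g))) => f; exact: va.
- move=> op; split=> [/nec[]//|b].
  by apply: (suf _ (fun g => kernel1_total cso bt op (g := g))) => f; exact: vb.
Qed.
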